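(* Let $m\ge 2$ and let $F=(F_1,\dots,F_m):\overline{D}\to\mathbb{C}^m$ be continuous. Assume that $F(e^{i\theta})\in D^m$ for all $\theta\in[0,2\pi)$. For $r\in(0,1]$, $k\in\mathbb{Z}$ and $j=1,\dots,m$, let $A_{jk}(r)$ denote the $k$-th Fourier coefficient of $\theta\mapsto F_j(re^{i\theta})$. Assume that for each $j=1,\dots,m$ $$\sum_{n\in\mathbb{Z}}\frac{|A_{jn}(r)|}{r^n}<1\qquad\text{for all } r\in(0,1].$$ Let $\Omega_1\subset\mathbb{C}^{m+1}$ be an open neighbourhood of $\Gamma(F)\cup(\partial D\times D^m)$, and let $\Omega_2\subset\mathbb{C}^{m+1}$ be any connected open set satisfying $$\partial D\times D^m\ \subset\ \overline{\Omega_2}\ \subset\ \Omega_1\cap\big(\{z\in\mathbb{C}:|z|\ge 1\}\times D^m\big),$$ where $\overline{\Omega_2}$ denotes the closure relative to $\mathbb{C}\times D^m$ and $\Omega_2\subset\mathbb{C}\times D^m$. If $f$ is holomorphic on $\Omega_1$, then $f|_{\Omega_2}$ has a holomorphic extension to $D\times D^m$; that is, there exist an open set $W\supset(\overline{D}\times D^m)\cup\Omega_2$ and a holomorphic function $g$ on $W$ such that $g=f$ on $\Omega_2$.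
   Context: $D=\{z\in\mathbb{C}:|z|<1\}$ is the open unit disc, $\partial D$ is the unit circle, $\overline{D}$ is the closed unit disc, and $D^m\subset\mathbb{C}^m$ is the unit polydisc (the $m$-fold product of $D$). $\Gamma(F)=\{(z,F(z)):z\in\overline{D}\}\subset\mathbb{C}^{m+1}$ is the graph of $F$. The Fourier coefficients are $A_{jk}(r)=\frac{1}{2\pi}\int_0^{2\pi}F_j(re^{i\theta})e^{-ik\theta}\,d\theta$. *)

(* Defs.v *)
From HB Require Import structures.
From mathcomp Require Import all_boot all_order all_algebra.
From mathcomp Require Import complex.
From mathcomp Require Import all_classical all_reals all_analysis.

Set Implicit Arguments.
Unset Strict Implicit.
Unset Printing Implicit Defensive.

Import Order.TTheory GRing.Theory Num.Theory.
Import numFieldNormedType.Exports.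
Import Normc.

Local Open Scope classical_set_scope.
Local Open Scope ring_scope.
Local Open Scope complex_scope.

(* MathComp-Analysis puts the norm topology on abstract numeric fields, but the
   concrete type R[i] needs its own instance; it is a normed module over itself,
   so that linearity and differentiability below are complex. *)
#[non_forgetful_inheritance]
HB.instance Definition _ (R : realType) := PseudoPointedMetric.copy R[i] R[i]^o.
#[non_forgetful_inheritance]
HB.instance Definition _ (R : realType) := NormedModule.copy R[i] R[i]^o.

Definition closed_disc (R : realType) : set R[i] := [set z | `|z| <= 1].

Definition open_disc (R : realType) : set R[i] := [set z | `|z| < 1].

Definition unit_circle (R : realType) : set R[i] := [set z | `|z| = 1].

Definition polydisc (R : realType) (m : nat) : set 'rV[R[i]]_m :=
  [set w | forall j, @open_disc R (w ord0 j)].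

Arguments closed_disc R : clear implicits.
Arguments open_disc R : clear implicits.
Arguments unit_circle R : clear implicits.
Arguments polydisc R m : clear implicits.

(* C^(m+1) is written as the normed product C * C^m throughout. *)
Definition graph_over_closed_disc (R : realType) (m : nat)
    (F : R[i] -> 'rV[R[i]]_m) : set (R[i] * 'rV[R[i]]_m) :=
  [set p | closed_disc R p.1 /\ p.2 = F p.1].

(* [differentiable] over the field R[i] is complex Frechet differentiability. *)
Definition holomorphic_on (R : realType) (m : nat)
    (U : set (R[i] * 'rV[R[i]]_m)) (f : R[i] * 'rV[R[i]]_m -> R[i]) : Prop :=
  forall p, U p -> differentiable f p.

Definition closure_in (T : topologicalType) (Y A : set T) : set T :=
  closure A `&` Y.

Definition expi (R : realType) (t : R) : R[i] := cos t +i* sin t.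

(* The Lebesgue integral over [a, b] of a complex-valued function. *)
Definition Cintegral (R : realType) (a b : R) (h : R -> R[i]) : R[i] :=
  (\int[lebesgue_measure]_(t in `[a, b]) complex.Re (h t)) +i*
  (\int[lebesgue_measure]_(t in `[a, b]) complex.Im (h t)).

Definition fourier_coef (R : realType) (u : R -> R[i]) (k : int) : R[i] :=
  ((2 * pi)^-1)%:C *
  Cintegral 0 (2 * pi) (fun t => u t * expi (- (k%:~R * t))).

Definition circle_coef (R : realType) (m : nat) (F : R[i] -> 'rV[R[i]]_m)
    (j : 'I_m) (k : int) (r : R) : R[i] :=
  fourier_coef (fun t => F (r%:C * expi t) ord0 j) k.

(* Main.v *)
Require Import Defs.
From HB Require Import structures.
From mathcomp Require Import all_boot all_order all_algebra.
From mathcomp Require Import complex ring lra.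
From mathcomp Require Import all_classical all_reals all_analysis.

Set Implicit Arguments.
Unset Strict Implicit.
Unset Printing Implicit Defensive.

Import Order.TTheory GRing.Theory Num.Theory.
Import numFieldNormedType.Exports.
Import Normc.

Local Open Scope classical_set_scope.
Local Open Scope ring_scope.
Local Open Scope complex_scope.

(* By convexity of the polydisc and the Fejer kernel, for every r in (0, 1] the map F is uniformly
   approximated on |z| = r by Laurent polynomials Phi sending the unit circle into the polydisc:
   damp the Fourier modes A_n(r) e^(i n t), write e^(i n t) as r^-n z^n, and use the bound on the sum.
   For such Phi (indeed for all maps holomorphic off 0 with these two properties at radius r) the
   moments of f(z, Phi z) over |z| = 1 and over |z| = r agree.  This holds at r = 1 and is locally
   constant in r: by Cauchy's theorem on a thin annulus it passes to maps near one approximant, and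
   by the identity principle on complex lines to all of the convex family.  For small r one may take
   constant maps, for which the inner moments vanish by Cauchy's theorem on a disc.  Hence
   the integral of f(z, w) z^n over the unit circle vanishes for n >= 0 and w in an open set, so for
   all w in the polydisc, and the Cauchy integral of f(., w) over the unit circle extends f. *)

(** * Integrals of continuous complex-valued functions over a real interval *)

Section ComplexIntegral.
Variable R : realType.
Implicit Types (a b c t : R) (u v : R -> R[i]) (z w : R[i]).

(** [F] is only continuous, so Cauchy's theorem does not apply to its graph, and a Laurent
    approximant is controlled only on the circle for which it was built: by continuity it stays
    close to [F] on a thin annulus, with no uniformity in the radius. The property carried from
    radius to radius therefore quantifies over all maps that are close to [F] on the given circle,
    so that the approximant may change at every step. For r < 1 and n < 0 the weight r^-n is small,
    so the hypothesis does not make the Fourier series on |z| = r absolutely convergent. This is why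
    Fejer means are used: they converge uniformly for every continuous function and only shrink the
    moduli of the coefficients, so the bound on the weighted sum survives. Only the moment with n =
    0 has to be deformed, since z^n f is holomorphic wherever f is. *)

Lemma cReD z w : complex.Re (z + w) = complex.Re z + complex.Re w.
Proof. by case: z; case: w. Qed.
Lemma cImD z w : complex.Im (z + w) = complex.Im z + complex.Im w.
Proof. by case: z; case: w. Qed.
Lemma cReM z w : complex.Re (z * w) =
  complex.Re z * complex.Re w - complex.Im z * complex.Im w.
Proof. by case: z; case: w. Qed.
Lemma cImM z w : complex.Im (z * w) =
  complex.Re z * complex.Im w + complex.Im z * complex.Re w.
Proof. by case: z; case: w. Qed.

Lemma normc_ge0 z : 0 <= normc z.
Proof. by case: z => x y; exact: sqrtr_ge0. Qed.

Lemma normcB z w : normc (z - w) = normc (w - z).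
Proof. by rewrite -normcN opprB. Qed.

Lemma le_normcB z w : normc z - normc w <= normc (z - w).
Proof. by rewrite lerBlDr -{1}(subrK w z) le_normcD. Qed.

Lemma normcX z n : normc (z ^+ n) = normc z ^+ n.
Proof. by elim: n => [|n IH]; rewrite ?expr0 ?normc1// !exprS normcM IH. Qed.

Lemma normc_real x : normc x%:C = `|x| :> R.
Proof. by rewrite /normc /= expr0n /= addr0 sqrtr_sqr. Qed.

Lemma le_normc_sum (I : Type) (s : seq I) (P : pred I) (F : I -> R[i]) :
  normc (\sum_(i <- s | P i) F i) <= \sum_(i <- s | P i) normc (F i).
Proof.
elim/big_ind2 : _ => [|x1 x2 y1 y2 h1 h2|//]; first by rewrite normc0.
exact: le_trans (le_normcD _ _) (lerD h1 h2).
Qed.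

Lemma Re_le_normc z : `|complex.Re z| <= normc z.
Proof.
by case: z => x y; rewrite /normc /= -sqrtr_sqr ler_wsqrtr// lerDl sqr_ge0.
Qed.

Lemma Im_le_normc z : `|complex.Im z| <= normc z.
Proof.
by case: z => x y; rewrite /normc /= -sqrtr_sqr ler_wsqrtr// lerDr sqr_ge0.
Qed.

Lemma normc_le_ReIm z : normc z <= `|complex.Re z| + `|complex.Im z|.
Proof.
case: z => x y; rewrite /normc /= -[leRHS]ger0_norm ?addr_ge0// -sqrtr_sqr.
apply: ler_wsqrtr; rewrite sqrrD !real_normK ?num_real//.
by rewrite -addrA [leRHS]addrC -addrA [_ ^+ 2 + x ^+ 2]addrC lerDr mulrn_wge0 ?mulr_ge0.
Qed.

(** The norm of [R[i]] takes its values in [R[i]], but a positive element of [R[i]] has zero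
    imaginary part, so a real epsilon is enough. *)
Lemma cvg_normcP (T : Type) (F : set_system T) (FF : Filter F)
    (f : T -> R[i]) (l : R[i]) :
  f x @[x --> F] --> l <->
  forall e : R, 0 < e -> \forall x \near F, normc (f x - l) < e.
Proof.
split=> [/cvgrPdist_lt h e e0|h].
  have /h : 0 < e%:C by rewrite (ltcR 0).
  by apply: filterS => x; rewrite normcB -ltcR.
apply/cvgrPdist_lt => e; case: e => x y; rewrite ltcE /= => /andP[/eqP -> x0].
by apply: filterS (h _ x0) => t; rewrite normcB -ltcR.
Qed.

Lemma cvg_Re (T : Type) (F : set_system T) (FF : Filter F)
    (f : T -> R[i]) (l : R[i]) :
  f x @[x --> F] --> l -> complex.Re (f x) @[x --> F] --> complex.Re l.
Proof.
move=> /cvg_normcP h; apply/cvgrPdist_lt => e e0; apply: filterS (h _ e0) => x.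
apply: le_lt_trans; rewrite normcB; apply: le_trans (Re_le_normc _).
by rewrite cReD; case: (f x).
Qed.

Lemma cvg_Im (T : Type) (F : set_system T) (FF : Filter F)
    (f : T -> R[i]) (l : R[i]) :
  f x @[x --> F] --> l -> complex.Im (f x) @[x --> F] --> complex.Im l.
Proof.
move=> /cvg_normcP h; apply/cvgrPdist_lt => e e0; apply: filterS (h _ e0) => x.
apply: le_lt_trans; rewrite normcB; apply: le_trans (Im_le_normc _).
by rewrite cImD; case: (f x).
Qed.

Lemma cvg_complex (T : Type) (F : set_system T) (FF : Filter F)
    (f g : T -> R) (x y : R) :
  f t @[t --> F] --> x -> g t @[t --> F] --> y ->
  (f t +i* g t) @[t --> F] --> x +i* y.
Proof.
move=> /cvgrPdist_lt hf /cvgrPdist_lt hg; apply/cvg_normcP => e e0.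
have e20 : 0 < e / 2 by rewrite divr_gt0.
apply: filterS2 (hf _ e20) (hg _ e20) => t h1 h2.
apply: le_lt_trans (normc_le_ReIm _) _.
by rewrite [e](splitr e) /= (distrC (f t)) (distrC (g t)); exact: ltrD.
Qed.

(** Continuity at points of the segment is two-sided in [R], not relative to the segment; this
    passes to subintervals at once and composes without subspace topologies. *)
Definition ccont a b u := forall t, a <= t <= b -> {for t, continuous u}.

Lemma ccontD a b u v : ccont a b u -> ccont a b v -> ccont a b (fun t => u t + v t).
Proof. by move=> hu hv t ab; apply: cvgD; [exact: hu|exact: hv]. Qed.

Lemma ccontM a b u v : ccont a b u -> ccont a b v -> ccont a b (fun t => u t * v t).
Proof. by move=> hu hv t ab; apply: cvgM; [exact: hu|exact: hv]. Qed.

Lemma ccont_cst a b z : ccont a b (fun=> z).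
Proof. by move=> t ab; exact: cvg_cst. Qed.

Lemma ccontN a b u : ccont a b u -> ccont a b (fun t => - u t).
Proof. by move=> hu t ab; apply: cvgN; exact: hu. Qed.

Lemma ccontB a b u v : ccont a b u -> ccont a b v -> ccont a b (fun t => u t - v t).
Proof. by move=> hu hv; exact: (ccontD hu (ccontN hv)). Qed.

Let integrable_cont a b (f : R -> R) :
  (forall t, a <= t <= b -> {for t, continuous f}) ->
  lebesgue_measure.-integrable `[a, b] (EFin \o f).
Proof.
move=> h; apply: continuous_compact_integrable; first exact: segment_compact.
by apply: continuous_in_subspaceT => t; rewrite inE /= in_itv /=; exact: h.
Qed.

Lemma integrable_Re a b u : ccont a b u ->
  lebesgue_measure.-integrable `[a, b] (EFin \o (fun t => complex.Re (u t))).
Proof. by move=> h; apply: integrable_cont => t /h; exact: cvg_Re. Qed.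

Lemma integrable_Im a b u : ccont a b u ->
  lebesgue_measure.-integrable `[a, b] (EFin \o (fun t => complex.Im (u t))).
Proof. by move=> h; apply: integrable_cont => t /h; exact: cvg_Im. Qed.

Lemma eq_Cintegral a b u v : (forall t, a <= t <= b -> u t = v t) ->
  Cintegral a b u = Cintegral a b v.
Proof.
move=> h; rewrite /Cintegral; congr (_ +i* _);
by apply: eq_Rintegral => t; rewrite inE /= in_itv /= => /h ->.
Qed.

Lemma CintegralD a b u v : ccont a b u -> ccont a b v ->
  Cintegral a b (fun t => u t + v t) = Cintegral a b u + Cintegral a b v.
Proof.
move=> hu hv; rewrite /Cintegral.
under eq_Rintegral do rewrite cReD.
rewrite RintegralD//; [|exact: integrable_Re..].
under [X in _ +i* X]eq_Rintegral do rewrite cImD.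
by rewrite RintegralD//; exact: integrable_Im.
Qed.

Lemma CintegralZ a b z u : ccont a b u ->
  Cintegral a b (fun t => z * u t) = z * Cintegral a b u.
Proof.
move=> hu; case: z => x y; rewrite /Cintegral.
have iZ (f : R -> R) k : lebesgue_measure.-integrable `[a, b] (EFin \o f) ->
    lebesgue_measure.-integrable `[a, b] (EFin \o (fun t => k * f t)).
  by move=> h; apply: eq_integrable (integrableZl _ k h).
under eq_Rintegral do rewrite cReM /=.
rewrite RintegralB//; [|exact/iZ/integrable_Re|exact/iZ/integrable_Im].
under [X in _ +i* X]eq_Rintegral do rewrite cImM /=.
rewrite RintegralD//; [|exact/iZ/integrable_Im|exact/iZ/integrable_Re].
by rewrite !RintegralZl//; solve [exact: integrable_Im|exact: integrable_Re].
Qed.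

Lemma CintegralN a b u : ccont a b u ->
  Cintegral a b (fun t => - u t) = - Cintegral a b u.
Proof.
move=> hu; rewrite -mulN1r -CintegralZ//.
by apply: eq_Cintegral => t _; rewrite mulN1r.
Qed.

Lemma CintegralB a b u v : ccont a b u -> ccont a b v ->
  Cintegral a b (fun t => u t - v t) = Cintegral a b u - Cintegral a b v.
Proof. by move=> hu hv; rewrite (CintegralD hu (ccontN hv)) CintegralN. Qed.

Lemma Cintegral_cst a b z : a <= b -> Cintegral a b (fun=> z) = z * (b - a)%:C.
Proof.
move=> ab; rewrite /Cintegral !Rintegral_cst//= lebesgue_measure_itv /= lte_fin.
case: ltP => ab'; last first.
  have -> : b = a by apply/eqP; rewrite eq_le ab ab'.
  by rewrite subrr /= !mulr0.
by case: z => x y; apply/eqP; rewrite eq_complex /= !mulr0 subr0 add0r !eqxx.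
Qed.

(** The factor 2 comes from bounding real and imaginary parts separately. It recurs in all later
    estimates and is harmless, because each of them is used up to a constant. *)
Lemma normc_Cintegral_le a b u M : a <= b -> ccont a b u ->
  (forall t, a <= t <= b -> normc (u t) <= M) ->
  normc (Cintegral a b u) <= 2 * M * (b - a).
Proof.
move=> ab hu hM.
have bnd (f : R -> R) : lebesgue_measure.-integrable `[a, b] (EFin \o f) ->
    (forall t, a <= t <= b -> `|f t| <= M) ->
    `|\int[lebesgue_measure]_(t in `[a, b]) f t| <= M * (b - a).
  move=> fi fM; apply: le_trans (le_normr_Rintegral _ fi) _ => //.
  apply: (@le_trans _ _ (\int[lebesgue_measure]_(t in `[a, b]) M)).
    apply: le_Rintegral => //.
    - exact: (integrable_abse fi).
    - by apply: (@integrable_cont a b (fun=> M)) => t _; exact: cvg_cst.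
  rewrite Rintegral_cst//= lebesgue_measure_itv /= lte_fin.
  by case: ltP => ab'//=; rewrite mulr0 mulr_ge0 ?subr_ge0//;
    apply: le_trans (fM a _); rewrite ?lexx ?ab.
apply: le_trans (normc_le_ReIm _) _; rewrite -mulrA mulr_natl mulr2n /=.
by apply: lerD; apply: bnd; [exact: integrable_Re|move=> t /hM; exact: le_trans (Re_le_normc _)
  |exact: integrable_Im|move=> t /hM; exact: le_trans (Im_le_normc _)].
Qed.

Lemma Cintegral_split a b c u : a <= c <= b -> ccont a b u ->
  Cintegral a b u = Cintegral a c u + Cintegral c b u.
Proof.
move=> /andP[ac cb] hu.
have sp (f : R -> R) : lebesgue_measure.-integrable `[a, b] (EFin \o f) ->
   \int[lebesgue_measure]_(t in `[a, b]) f t =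
   \int[lebesgue_measure]_(t in `[a, c]) f t +
   \int[lebesgue_measure]_(t in `[c, b]) f t.
  move=> fi; rewrite -(Rintegral_itv_obnd_cbnd (r := c)).
    by rewrite -(@Rintegral_itvB _ f (BLeft a) (BRight b) c) ?bnd_simp// addrC subrK.
  by apply: integrableS fi => //; apply: subset_itvr; rewrite bnd_simp.
by rewrite /Cintegral !(sp (fun=> _))//; [exact: integrable_Im|exact: integrable_Re].
Qed.

Lemma Cintegral_FTC a b (f g f' g' : R -> R) : a <= b ->
  (forall t, is_derive t 1 f (f' t)) -> (forall t, is_derive t 1 g (g' t)) ->
  continuous f' -> continuous g' ->
  Cintegral a b (fun t => f' t +i* g' t) = (f b +i* g b) - (f a +i* g a).
Proof.
move=> ab df dg cf cg.
have H (k k' : R -> R) : (forall t, is_derive t 1 k (k' t)) -> continuous k' ->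
    \int[lebesgue_measure]_(t in `[a, b]) k' t = k b - k a.
  move=> dk ck; move: ab; rewrite le_eqVlt => /predU1P[<-|ab].
    by rewrite set_itv1 Rintegral_set1 subrr.
  have kc : continuous k.
    by move=> t; apply: differentiable_continuous; apply/derivable1_diffP; case: (dk t).
  rewrite /Rintegral (@continuous_FTC2 _ _ k)//.
  - by apply: continuous_in_subspaceT => t _; exact: ck.
  - split; first by move=> t _; case: (dk t).
    + by apply: cvg_at_right_filter; exact: kc.
    + by apply: cvg_at_left_filter; exact: kc.
  - by move=> t _; rewrite derive1E; case: (dk t).
by rewrite /Cintegral (H _ _ df cf) (H _ _ dg cg).
Qed.

End ComplexIntegral.

(** * Polar coordinates and the exponential on the circle *)

Section Polar.
Variable R : realType.
Implicit Types (a b r s t : R) (z w : R[i]).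

Definition polar r t : R[i] := r%:C * expi t.

Lemma polarE r t : polar r t = r%:C * expi t.
Proof. by []. Qed.

Lemma expiD s t : expi (s + t) = expi s * expi t.
Proof.
by rewrite /expi cosD sinD; apply/eqP; rewrite eq_complex /= eqxx addrC mulrC [sin t * _]mulrC eqxx.
Qed.

Lemma expi0 : expi 0 = 1 :> R[i].
Proof. by rewrite /expi cos0 sin0. Qed.

Lemma expi2pi : expi (2 * pi) = 1 :> R[i].
Proof. by rewrite /expi mulr_natl cos2pi sin2pi. Qed.

Lemma normc_expi t : normc (expi t) = 1.
Proof. by rewrite /normc /expi cos2Dsin2 sqrtr1. Qed.

Lemma expi_neq0 t : expi t != 0.
Proof. by apply/eqP => h; have := normc_expi t; rewrite h normc0 => /eqP; rewrite eq_sym oner_eq0. Qed.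

Lemma normc_polar r t : 0 <= r -> normc (polar r t) = r.
Proof. by move=> r0; rewrite normcM normc_expi mulr1 normc_real ger0_norm. Qed.

Lemma polar_neq0 r t : 0 < r -> polar r t != 0.
Proof.
move=> r0; apply/eqP => h; have := normc_polar t (ltW r0).
by rewrite h normc0 => r1; move: r0; rewrite -r1 ltxx.
Qed.

Lemma polar0 t : polar 0 t = 0.
Proof. by rewrite /polar mul0r. Qed.

Lemma polar1 t : polar 1 t = expi t.
Proof. by rewrite /polar mul1r. Qed.

Lemma expi_continuous : continuous (@expi R).
Proof.
move=> t; apply: cvg_complex; [exact: continuous_cos|exact: continuous_sin].
Qed.

Lemma polar_continuous : continuous (fun p : R * R => polar p.1 p.2).
Proof.
move=> -[r t]; apply: cvgM.
  apply: (@cvg_complex _ _ _ _ (fun p : R * R => p.1) (fun=> 0)); first exact: cvg_fst.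
  exact: cvg_cst.
apply: (@continuous_comp _ _ _ snd (@expi R)); first exact: cvg_snd.
exact: expi_continuous.
Qed.

Lemma polarl_continuous t : continuous (polar ^~ t).
Proof.
move=> r; apply: cvgM; last exact: cvg_cst.
by apply: (@cvg_complex _ _ _ _ id (fun=> 0)); [exact: cvg_id|exact: cvg_cst].
Qed.

Lemma polarr_continuous r : continuous (polar r).
Proof. by move=> t; apply: cvgM; [exact: cvg_cst|exact: expi_continuous]. Qed.

Lemma expiZ_continuous r : continuous (fun t => expi (r * t)).
Proof.
move=> t; apply: (@continuous_comp _ _ _ (fun t => r * t) (@expi R)); last exact: expi_continuous.
by apply: cvgM; [exact: cvg_cst|exact: cvg_id].
Qed.

Lemma expiM_nat (n : nat) t : expi (n%:R * t) = expi t ^+ n.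
Proof.
elim: n => [|n IH]; first by rewrite mul0r expi0 expr0.
by rewrite -natr1 mulrDl mul1r expiD IH exprSr.
Qed.

Lemma expiN t : expi (- t) = (expi t)^-1.
Proof.
apply: (mulfI (expi_neq0 t)); rewrite -expiD subrr expi0 mulfV//; exact: expi_neq0.
Qed.

(** The factor i k is kept inside the integral, so that k = 0 needs no separate case. *)
Lemma Cintegral_expi k a b : a <= b ->
  Cintegral a b (fun t => 'i * k%:C * expi (k * t)) = expi (k * b) - expi (k * a).
Proof.
move=> ab.
have dc t : is_derive t 1 (fun t => cos (k * t)) (- k * sin (k * t)).
  by apply: is_derive_eq; rewrite /GRing.scale /=; ring.
have ds t : is_derive t 1 (fun t => sin (k * t)) (k * cos (k * t)).
  by apply: is_derive_eq; rewrite /GRing.scale /=; ring.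
have ck : continuous (fun t => k * t) by move=> t; apply: cvgM; [exact: cvg_cst|exact: cvg_id].
rewrite /expi -(@Cintegral_FTC _ a b _ _ _ _ ab dc ds).
- by apply: eq_Cintegral => t _ /=; congr (_ +i* _); ring.
- move=> t; apply: cvgM; first exact: cvg_cst.
  by apply: continuous_comp; [exact: ck|exact: continuous_sin].
- move=> t; apply: cvgM; first exact: cvg_cst.
  by apply: continuous_comp; [exact: ck|exact: continuous_cos].
Qed.

(** The difference is the integral of i e^(i x) from t to s, whose integrand has modulus 1. *)
Lemma normc_expiB s t : normc (expi s - expi t) <= 2 * `|s - t|.
Proof.
wlog st : s t / t <= s.
  move=> H; case: (leP t s) => [/H//|/ltW/H]; rewrite normcB.
  by rewrite distrC.
rewrite -[s]mul1r -[t]mul1r -Cintegral_expi// !mul1r ger0_norm ?subr_ge0//.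
rewrite -[2 in leRHS]mulr1; apply: normc_Cintegral_le => //.
  apply: ccontM; first exact: ccont_cst.
  by move=> x _; exact: expiZ_continuous.
move=> x _; rewrite normcM normc_expi mulr1 normcM normc_real normr1 mulr1.
by rewrite /normc /= expr0n /= add0r expr1n sqrtr1.
Qed.

Lemma normc_polarB r s t u : 0 <= r ->
  normc (polar r t - polar s u) <= `|r - s| + 2 * r * `|t - u|.
Proof.
move=> r0.
have -> : polar r t - polar s u = r%:C * (expi t - expi u) + (r - s)%:C * expi u.
  rewrite /polar rmorphB /=; ring.
apply: le_trans (le_normcD _ _) _; rewrite addrC !normcM normc_expi mulr1 !normc_real.
by rewrite lerD2l (ger0_norm r0) [2 * r]mulrC -mulrA ler_wpM2l// normc_expiB.
Qed.

End Polar.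

(** * Contour integrals over polar rectangles *)

Section Goursat.
Variables (R : realType) (h : R[i] -> R[i]).
Implicit Types (a b c r s t : R) (z w : R[i]).

Definition ray_integral t a b := Cintegral a b (fun r => h (polar r t) * expi t).

Definition arc_integral r a b :=
  Cintegral a b (fun t => h (polar r t) * ('i * polar r t)).

(** The counterclockwise contour integral of [h] around a <= |z| <= b, s <= arg z <= t: out along
    the ray s, along the outer arc, in along the ray t, back along the inner arc. Polar rectangles
    suit annuli: for a full turn the two rays cancel. *)
Definition polar_boundary a b s t :=
  ray_integral s a b + arc_integral b s t - ray_integral t a b - arc_integral a s t.

Definition polar_cont a b s t :=
  forall r u, a <= r <= b -> s <= u <= t -> {for polar r u, continuous h}.

Lemma ccont_ray a b u : (forall r, a <= r <= b -> {for polar r u, continuous h}) ->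
  ccont a b (fun r => h (polar r u) * expi u).
Proof.
move=> hc r rab; apply: cvgM; last exact: cvg_cst.
by apply: cvg_comp; [exact: polarl_continuous|exact: hc].
Qed.

Lemma ccont_arc a b r : (forall u, a <= u <= b -> {for polar r u, continuous h}) ->
  ccont a b (fun t => h (polar r t) * ('i * polar r t)).
Proof.
move=> hc u uab; apply: cvgM; last first.
  by apply: cvgM; [exact: cvg_cst|exact: polarr_continuous].
by apply: (@continuous_comp _ _ _ (polar r) h); [exact: polarr_continuous|exact: hc].
Qed.

Lemma polar_boundary_splitr a b c s t : a <= c <= b -> s <= t ->
  polar_cont a b s t ->
  polar_boundary a b s t = polar_boundary a c s t + polar_boundary c b s t.
Proof.
move=> cab st hc; rewrite /polar_boundary /ray_integral.
rewrite !(@Cintegral_split _ a b c)//; last 2 first.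
- by apply: ccont_ray => r rab; apply: hc; rewrite // lexx ?st.
- by apply: ccont_ray => r rab; apply: hc; rewrite // lexx ?st.
ring.
Qed.

Lemma polar_boundary_splitt a b c s t : a <= b -> s <= c <= t ->
  polar_cont a b s t ->
  polar_boundary a b s t = polar_boundary a b s c + polar_boundary a b c t.
Proof.
move=> ab cst hc; rewrite /polar_boundary /arc_integral.
rewrite !(@Cintegral_split _ s t c)//; last 2 first.
- by apply: ccont_arc => r rab; apply: hc; rewrite // lexx ?st.
- by apply: ccont_arc => r rab; apply: hc; rewrite // lexx ab.
ring.
Qed.

End Goursat.

(** * Ingredients of Goursat's argument: affine integrands, length estimates, nested intervals *)

Section Goursat2.
Variables (R : realType).
Implicit Types (a b c r s t : R) (z w : R[i]).

Lemma Cintegral_id a b : a <= b ->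
  Cintegral a b (fun r => r%:C) = ((b ^+ 2 - a ^+ 2) / 2)%:C.
Proof.
move=> ab.
have d t : is_derive t 1 (fun t => t ^+ 2 / 2) t.
  by apply: is_derive_eq; rewrite /GRing.scale /=; field.
have d0 t : is_derive t 1 (fun t : R => 0 : R) 0 by exact: is_derive_cst.
rewrite (@Cintegral_FTC _ a b _ _ _ _ ab d d0).
- by apply/eqP; rewrite eq_complex /= subr0 eqxx andbT; apply/eqP; field.
- by move=> t; exact: cvg_id.
- by move=> t; exact: cvg_cst.
Qed.

(** An affine function has an explicit primitive, so the four sides are computed and cancel. In
    Goursat's argument this removes the first order Taylor part. *)
Lemma polar_boundary_affine (p q : R[i]) a b s t : a <= b -> s <= t ->
  polar_boundary (fun z => p + q * z) a b s t = 0.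
Proof.
move=> ab st.
have cid : ccont a b (fun r => r%:C).
  by move=> r _; apply: (@cvg_complex _ _ _ _ id (fun=> 0)); [exact: cvg_id|exact: cvg_cst].
have ray u : ray_integral (fun z => p + q * z) u a b =
    p * expi u * (b - a)%:C + q * expi u ^+ 2 * ((b ^+ 2 - a ^+ 2) / 2)%:C.
  rewrite /ray_integral -Cintegral_id// -(Cintegral_cst _ ab) -CintegralZ//.
  rewrite -CintegralD; [|exact: ccont_cst|by apply: ccontM; [exact: ccont_cst|]].
  by apply: eq_Cintegral => r _; rewrite /polar; ring.
have cZ k : ccont s t (fun x => 'i * k%:C * expi (k * x)).
  by apply: ccontM; [exact: ccont_cst|move=> x _; exact: expiZ_continuous].
have arc r : arc_integral (fun z => p + q * z) r s t =
    p * r%:C * (expi t - expi s) + q * r%:C ^+ 2 / 2 * (expi t ^+ 2 - expi s ^+ 2).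
  rewrite /arc_integral -!expiM_nat -(@Cintegral_expi _ 2 s t st).
  have := Cintegral_expi 1 st; rewrite !mul1r => <-.
  rewrite -!CintegralZ//.
  rewrite -CintegralD; [|by apply: ccontM; [exact: ccont_cst|exact: cZ]..].
  apply: eq_Cintegral => u _; rewrite /polar (expiM_nat 2) mul1r.
  rewrite (_ : (2%:R)%:C = 2); last by rewrite rmorph_nat.
  by rewrite rmorph1; field.
rewrite /polar_boundary !ray !arc !rmorphM !rmorphB !rmorphXn fmorphV rmorph_nat /=.
by field.
Qed.

Lemma polar_boundaryD (h k : R[i] -> R[i]) a b s t : a <= b -> s <= t ->
  polar_cont h a b s t -> polar_cont k a b s t ->
  polar_boundary (fun z => h z + k z) a b s t =
  polar_boundary h a b s t + polar_boundary k a b s t.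
Proof.
move=> ab st hc kc.
have ray u : s <= u <= t -> ray_integral (fun z => h z + k z) u a b =
    ray_integral h u a b + ray_integral k u a b.
  move=> ust; rewrite /ray_integral -CintegralD; last 2 first.
  - by apply: ccont_ray => r rab; exact: hc.
  - by apply: ccont_ray => r rab; exact: kc.
  by apply: eq_Cintegral => r _; rewrite mulrDl.
have arc r : a <= r <= b -> arc_integral (fun z => h z + k z) r s t =
    arc_integral h r s t + arc_integral k r s t.
  move=> rab; rewrite /arc_integral -CintegralD; last 2 first.
  - by apply: ccont_arc => u ust; exact: hc.
  - by apply: ccont_arc => u ust; exact: kc.
  by apply: eq_Cintegral => u _; rewrite mulrDl.
rewrite /polar_boundary !ray ?arc ?lexx ?ab ?st//; ring.
Qed.

Lemma normc_imaginary_unit : normc 'i = 1 :> R.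
Proof. by rewrite /normc /= expr0n /= add0r expr1n sqrtr1. Qed.

(** Two rays of length b - a and two arcs of length at most b (t - s), each with the factor 2 of the
    integral estimate. *)
Lemma normc_polar_boundary (h : R[i] -> R[i]) a b s t M :
  0 <= a -> a <= b -> s <= t -> polar_cont h a b s t ->
  (forall r u, a <= r <= b -> s <= u <= t -> normc (h (polar r u)) <= M) ->
  normc (polar_boundary h a b s t) <= 4 * M * ((b - a) + b * (t - s)).
Proof.
move=> a0 ab st hc hM.
have M0 : 0 <= M.
  by apply: le_trans (hM a s _ _); rewrite ?normc_ge0 ?lexx ?ab ?st.
have ray u : s <= u <= t -> normc (ray_integral h u a b) <= 2 * M * (b - a).
  move=> ust; apply: normc_Cintegral_le => //.
    by apply: ccont_ray => r rab; exact: hc.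
  by move=> r rab; rewrite normcM normc_expi mulr1 hM.
have arc r : a <= r <= b -> normc (arc_integral h r s t) <= 2 * (M * b) * (t - s).
  move=> rab; apply: normc_Cintegral_le => //.
    by apply: ccont_arc => u ust; exact: hc.
  have r0 : 0 <= r by case/andP: rab => /(le_trans a0).
  move=> u ust; rewrite !normcM normc_imaginary_unit mul1r -normcM -/(polar r u) normc_polar//.
  apply: ler_pM => //; rewrite ?normc_ge0 ?hM//; by case/andP: rab.
have := ray s; have := ray t; have := arc a; have := arc b.
rewrite !lexx ab st => /(_ isT) A1 /(_ isT) A2 /(_ isT) A3 /(_ isT) A4.
rewrite /polar_boundary.
apply: le_trans (le_normcD _ _) _; rewrite normcN.
apply: le_trans (lerD (le_normcD _ _) (lexx _)) _; rewrite normcN.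
apply: le_trans (lerD (lerD (le_normcD _ _) (lexx _)) (lexx _)) _.
apply: le_trans (lerD (lerD (lerD A4 A1) A3) A2) _.
by lra.
Qed.

(** The common point is the supremum of the left endpoints, each of which lies below every right
    endpoint. *)
Lemma nested_interval (x : nat -> R) (L : R) : 0 <= L ->
  (forall n, x n <= x n.+1 /\ x n.+1 + L / 2 ^+ n.+1 <= x n + L / 2 ^+ n) ->
  exists y, forall n, x n <= y <= x n + L / 2 ^+ n.
Proof.
move=> L0 H.
have Lge0 n : 0 <= L / 2 ^+ n by rewrite divr_ge0// exprn_ge0.
have inc n m : x n <= x (n + m)%N.
  elim: m => [|m IH]; rewrite ?addn0 ?addnS//; apply: le_trans IH _; by case: (H (n + m)%N).
have dec n m : x (n + m)%N + L / 2 ^+ (n + m)%N <= x n + L / 2 ^+ n.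
  elim: m => [|m IH]; rewrite ?addn0 ?addnS//; apply: le_trans IH; by case: (H (n + m)%N).
have ub n : ubound (range x) (x n + L / 2 ^+ n).
  move=> _ [m _ <-]; case/orP: (leq_total n m) => nm.
    by have := dec n (m - n)%N; rewrite subnKC//; apply: le_trans; rewrite lerDl.
  by have := inc m (n - m)%N; rewrite subnKC// => /le_trans; apply; rewrite lerDl.
have hs : has_sup (range x) by split; [exists (x 0%N), 0%N|exists (x 0%N + L / 2 ^+ 0); exact: ub].
exists (sup (range x)) => n; apply/andP; split.
  by apply: ub_le_sup; [case: hs|exists n].
by apply: sup_le_ub; [case: hs|exact: ub].
Qed.

End Goursat2.

(** * First order expansion of a complex differentiable function *)

Section ComplexDerivative.
Variable R : realType.
Implicit Types (z w : R[i]) (h : R[i] -> R[i]).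

Lemma nbhs_normcP z (A : set R[i]) :
  nbhs z A <-> exists2 d : R, 0 < d & forall w, normc (w - z) < d -> A w.
Proof.
split=> [/nbhs_ballP [[x y]]|[d d0 dA]].
  rewrite /= ltcE /= => /andP[/eqP -> x0] H; exists x => // w wz; apply: H.
  by rewrite -ball_normE /= ltcR normcB.
apply/nbhs_ballP; exists d%:C; first by rewrite /= (ltcR 0).
by move=> w; rewrite -ball_normE /= => h; apply: dA; rewrite normcB -ltcR.
Qed.

(** Multiplying out the difference quotient gives a bound that also holds at w = z, as the estimate
    on whole rectangles requires. *)
Lemma derivable_expansion h z : derivable h z 1 -> exists q : R[i],
  forall e : R, 0 < e -> exists2 d : R, 0 < d & forall w, normc (w - z) < d ->
    normc (h w - h z - q * (w - z)) <= e * normc (w - z).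
Proof.
rewrite /derivable => /cvg_ex[q] /= hq; exists q => e e0.
move/cvg_normcP: hq => /(_ e e0); rewrite /dnbhs.
move=> /nbhs_normcP[d d0 hd]; exists d => // w wz.
have [->|wz0] := eqVneq w z; first by rewrite !subrr mulr0 subr0 normc0 mulr0.
have := hd (w - z); rewrite subr0 => /(_ wz); rewrite subr_eq0 => /(_ wz0) /ltW.
rewrite /GRing.scale /= mulr1 subrK => H.
have wz1 : w - z != 0 by rewrite subr_eq0.
have -> : h w - h z - q * (w - z) = ((w - z)^-1 * (h w - h z) - q) * (w - z).
  by rewrite mulrBl mulrAC mulVf// mul1r.
by rewrite normcM ler_wpM2r ?normc_ge0.
Qed.

End ComplexDerivative.

(** * Goursat's theorem on polar rectangles *)

Section GoursatTheorem.
Variable R : realType.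
Implicit Types (a b r s t : R).

Let four_quarters (e w x y z : R) : e <= w + x + (y + z) ->
  w < e / 4 -> x < e / 4 -> y < e / 4 -> z < e / 4 -> False.
Proof. by lra. Qed.

(** Pigeonhole: four numbers below e / 4 cannot sum to e. The quadrant is given by its lower corner
    only, since its side lengths are known. *)
Let quadrant_big (D : R -> R -> R -> R -> R) a b s t e : a <= b -> s <= t ->
  (forall c m, a <= c <= b -> s <= m <= t ->
    D a b s t <= D a c s m + D a c m t + (D c b s m + D c b m t)) ->
  e <= D a b s t ->
  exists p : R * R, [/\ a <= p.1, p.1 + (b - a) / 2 <= b, s <= p.2, p.2 + (t - s) / 2 <= t &
    e / 4 <= D p.1 (p.1 + (b - a) / 2) p.2 (p.2 + (t - s) / 2)].
Proof.
move=> ab st; set c := (a + b) / 2; set m := (s + t) / 2.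
have ac : a <= c by rewrite /c; lra.
have cb : c <= b by rewrite /c; lra.
have sm : s <= m by rewrite /m; lra.
have mt : m <= t by rewrite /m; lra.
have E1 : a + (b - a) / 2 = c by rewrite /c; lra.
have E2 : c + (b - a) / 2 = b by rewrite /c; lra.
have E3 : s + (t - s) / 2 = m by rewrite /m; lra.
have E4 : m + (t - s) / 2 = t by rewrite /m; lra.
move=> /(_ c m); rewrite ac cb sm mt => /(_ isT isT) hD he.
have := le_trans he hD.
case: (leP (e / 4) (D a c s m)) => [h1 _|h1].
  by exists (a, s); split; rewrite /= ?E1 ?E3.
case: (leP (e / 4) (D a c m t)) => [h2 _|h2].
  by exists (a, m); split; rewrite /= ?E1 ?E4.
case: (leP (e / 4) (D c b s m)) => [h3 _|h3].
  by exists (c, s); split; rewrite /= ?E2 ?E3.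
case: (leP (e / 4) (D c b m t)) => [h4 _|h4].
  by exists (c, m); split; rewrite /= ?E2 ?E4.
by move=> /four_quarters /(_ h1 h2 h3 h4).
Qed.

(** Goursat's bisection, for any [D] that is subadditive under quartering: [q n] is the lower corner
    of the n-th rectangle and (x, y) lies in all of them. *)
Lemma nested_rectangles (D : R -> R -> R -> R -> R) a b s t : a <= b -> s <= t ->
  (forall a' b' s' t' c m, a <= a' -> b' <= b -> s <= s' -> t' <= t ->
    a' <= c <= b' -> s' <= m <= t' ->
    D a' b' s' t' <= D a' c s' m + D a' c m t' + (D c b' s' m + D c b' m t')) ->
  exists (q : nat -> R * R) (x y : R), forall n,
    [/\ a <= (q n).1 <= x, x <= (q n).1 + (b - a) / 2 ^+ n <= b,
        s <= (q n).2 <= y, y <= (q n).2 + (t - s) / 2 ^+ n <= t &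
        D a b s t / 4 ^+ n <=
        D (q n).1 ((q n).1 + (b - a) / 2 ^+ n) (q n).2 ((q n).2 + (t - s) / 2 ^+ n)].
Proof.
move=> ab st hD.
set E := D a b s t.
set L := b - a; set B := t - s.
have L0 : 0 <= L by rewrite subr_ge0.
have B0 : 0 <= B by rewrite subr_ge0.
have p2n0 n : 0 < 2 ^+ n :> R by rewrite exprn_gt0.
have half K n : K / 2 ^+ n.+1 = K / 2 ^+ n / 2 :> R by rewrite exprSr invfM mulrA.
have Ln n : 0 <= L / 2 ^+ n by rewrite divr_ge0// ltW.
have Bn n : 0 <= B / 2 ^+ n by rewrite divr_ge0// ltW.
pose good n (p : R * R) := [/\ a <= p.1, p.1 + L / 2 ^+ n <= b, s <= p.2,
  p.2 + B / 2 ^+ n <= t &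
  E / 4 ^+ n <= D p.1 (p.1 + L / 2 ^+ n) p.2 (p.2 + B / 2 ^+ n)].
pose sub n (p q : R * R) :=
    [/\ p.1 <= q.1, q.1 + L / 2 ^+ n.+1 <= p.1 + L / 2 ^+ n,
        p.2 <= q.2 & q.2 + B / 2 ^+ n.+1 <= p.2 + B / 2 ^+ n].
have next n p : good n p -> exists q : R * R, good n.+1 q /\ sub n p q.
  case=> h1 h2 h3 h4 h5.
  have l1 : p.1 <= p.1 + L / 2 ^+ n by rewrite lerDl.
  have l2 : p.2 <= p.2 + B / 2 ^+ n by rewrite lerDl.
  have [q []] := quadrant_big l1 l2 (fun c m => hD _ _ _ _ c m h1 h2 h3 h4) h5.
  rewrite ![_ + _ - _]addrAC !subrr !add0r -!half => q1 q2 q3 q4 q5.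
  exists q; split; last by split.
  split; [exact: le_trans q1|exact: le_trans h2|exact: le_trans q3|exact: le_trans h4|].
  by apply: le_trans q5; rewrite exprSr invfM mulrA.
have good0 : good 0%N (a, s).
  split; rewrite /= ?expr0 ?divr1 ?lexx// /L /B.
  - by rewrite subrKC.
  - by rewrite subrKC.
  - by rewrite !subrKC.
have [q hq] : exists q : nat -> R * R, forall n, good n (q n) /\ sub n (q n) (q n.+1).
  (* The default [p] only makes [nx] total; [gq] shows that the sequence never reaches it. *)
  pose nx n p := if pselect (good n p) is left H then projT1 (cid (next n p H)) else p.
  pose q := fix q n := if n is k.+1 then nx k (q k) else (a, s).
  have gq n : good n (q n).
    elim: n => [//|n IH] /=; rewrite /nx; case: pselect => // H.
    by case: (cid _) => /= ? [].
  exists q => n; split => //=; rewrite /nx; case: pselect => // H.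
  by case: (cid _) => /= ? [].
have [x hx] : exists x, forall n, (q n).1 <= x <= (q n).1 + L / 2 ^+ n.
  by apply: nested_interval => // n; case: (hq n) => _ [].
have [y hy] : exists y, forall n, (q n).2 <= y <= (q n).2 + B / 2 ^+ n.
  by apply: nested_interval => // n; case: (hq n) => _ [].
exists q, x, y => n; have [[h1 h2 h3 h4 h5] _] := hq n.
have /andP[x1 x2] := hx n; have /andP[y1 y2] := hy n.
by split=> //; apply/andP; split.
Qed.

Lemma polar_boundary_split4 (h : R[i] -> R[i]) a b s t c m :
  a <= c <= b -> s <= m <= t -> polar_cont h a b s t ->
  normc (polar_boundary h a b s t) <=
  normc (polar_boundary h a c s m) + normc (polar_boundary h a c m t) +
  (normc (polar_boundary h c b s m) + normc (polar_boundary h c b m t)).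
Proof.
move=> /andP[ac cb] /andP[sm mt] hc.
have st : s <= t := le_trans sm mt.
have hc1 : polar_cont h a c s t.
  by move=> r u /andP[h1 h2] h3; apply: hc; rewrite // h1 (le_trans h2 cb).
have hc2 : polar_cont h c b s t.
  by move=> r u /andP[h1 h2] h3; apply: hc; rewrite // h2 (le_trans ac h1).
have ac_b : a <= c <= b by apply/andP.
have sm_t : s <= m <= t by apply/andP.
rewrite (polar_boundary_splitr ac_b st hc).
rewrite (polar_boundary_splitt ac sm_t hc1) (polar_boundary_splitt cb sm_t hc2).
apply: (le_trans (le_normcD _ _)).
by apply: lerD; apply: le_normcD.
Qed.

(** Subtracting the affine Taylor polynomial does not change the contour integral and leaves an
    integrand of size at most e D. *)
Lemma polar_boundary_small (h : R[i] -> R[i]) z (q : R[i]) a b s t e D :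
  0 <= a -> a <= b -> s <= t -> polar_cont h a b s t -> 0 <= e ->
  (forall r u, a <= r <= b -> s <= u <= t -> normc (polar r u - z) <= D) ->
  (forall w, normc (w - z) <= D -> normc (h w - h z - q * (w - z)) <= e * normc (w - z)) ->
  normc (polar_boundary h a b s t) <= 4 * (e * D) * ((b - a) + b * (t - s)).
Proof.
move=> a0 ab st hc e0 hD hq.
pose k w := h z - q * z + q * w.
have kc : continuous k.
  move=> w; apply: (@cvgD _ _ _ (nbhs w) _ (fun=> h z - q * z) (fun w => q * w)).
    exact: cvg_cst.
  by apply: cvgM; [exact: cvg_cst|exact: cvg_id].
pose g w := h w + - k w.
have gc : polar_cont g a b s t.
  by move=> r u rab ust; apply: (@cvgB _ _ _ (nbhs (polar r u)) _ h k); [exact: hc|exact: kc].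
have -> : polar_boundary h a b s t = polar_boundary g a b s t.
  have hgk : (fun w => g w + k w) = h by apply/funext => w; rewrite /g subrK.
  have := polar_boundaryD ab st gc (fun r u _ _ => kc (polar r u)).
  by rewrite hgk (polar_boundary_affine (h z - q * z) q ab st) addr0.
apply: (normc_polar_boundary a0 ab st gc) => r u rab ust; rewrite /g.
have -> : h (polar r u) - k (polar r u) = h (polar r u) - h z - q * (polar r u - z).
  by rewrite /k; ring.
apply: le_trans (hq _ (hD _ _ rab ust)) _.
by rewrite ler_wpM2l// hD.
Qed.

(** The n-th rectangle carries at least [E / 4 ^+ n]. Its diameter and its perimeter are both of
    order 2^-n, so it carries at most a constant times e / 4^n, for every e > 0. *)
Lemma goursat_polar (h : R[i] -> R[i]) a b s t : 0 <= a -> a <= b -> s <= t ->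
  (forall r u, a <= r <= b -> s <= u <= t -> derivable h (polar r u) 1) ->
  polar_boundary h a b s t = 0.
Proof.
move=> a0 ab st hd.
have hc : polar_cont h a b s t.
  by move=> r u rab ust; apply: differentiable_continuous; apply/derivable1_diffP; exact: hd.
have [] := @nested_rectangles (fun a b s t => normc (polar_boundary h a b s t)) a b s t ab st.
  move=> a' b' s' t' c m aa bb ss tt' hac hsm; apply: (polar_boundary_split4 hac hsm).
  move=> r u /andP[r1 r2] /andP[u1 u2]; apply: hc.
    by rewrite (le_trans aa r1) (le_trans r2 bb).
  by rewrite (le_trans ss u1) (le_trans u2 tt').
move=> q [x [y hq]].
set E := normc (polar_boundary h a b s t) in hq *.
set L := b - a in hq *; set B := t - s in hq *.
have L0 : 0 <= L by rewrite subr_ge0.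
have B0 : 0 <= B by rewrite subr_ge0.
have b0 : 0 <= b by exact: le_trans ab.
(* [K / 2 ^+ n] bounds the diameter of the n-th rectangle, by [normc_polarB]. *)
pose K := L + 2 * b * B.
have K0 : 0 <= K by rewrite addr_ge0// !mulr_ge0.
have [Dq HD] : exists Dq : R[i], forall e : R, 0 < e -> exists2 d : R, 0 < d & forall w, normc (w - polar x y) < d ->
    normc (h w - h (polar x y) - Dq * (w - polar x y)) <= e * normc (w - polar x y).
  apply: derivable_expansion; apply: hd; have := hq 0%N; rewrite expr0 !divr1.
    by case=> /andP[l1 l2] /andP[l3 l4] _ _ _; rewrite (le_trans l1 l2) (le_trans l3 l4).
  by case=> _ _ /andP[l1 l2] /andP[l3 l4] _; rewrite (le_trans l1 l2) (le_trans l3 l4).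
apply: eq0_normc; apply/eqP; rewrite eq_le normc_ge0 andbT -/E.
have key e : 0 < e -> E <= 4 * e * K * (L + b * B).
  move=> e0; have [d d0 hd'] := HD e e0.
  have [n Kn] : exists n, K / 2 ^+ n < d.
    have := @cvg_geometric R K (2^-1) ; rewrite ger0_norm ?invr_ge0// invf_lt1 ?ltr1n// => /(_ isT).
    move=> /cvgrPdist_lt /(_ d d0) [N _ /(_ N (leqnn N))].
    rewrite sub0r normrN ger0_norm /geometric /=; last by rewrite mulr_ge0// exprn_ge0// invr_ge0.
    by rewrite exprVn; exists N.
  have [/andP[l1 l2] /andP[l3 l4] /andP[l5 l6] /andP[l7 l8] hE] := hq n.
  have p2n0 : 0 < 2 ^+ n :> R by rewrite exprn_gt0.
  have Ln : 0 <= L / 2 ^+ n by rewrite divr_ge0// ltW.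
  have Bn : 0 <= B / 2 ^+ n by rewrite divr_ge0// ltW.
  have hK r u : (q n).1 <= r <= (q n).1 + L / 2 ^+ n -> (q n).2 <= u <= (q n).2 + B / 2 ^+ n ->
      normc (polar r u - polar x y) <= K / 2 ^+ n.
    move=> /andP[r1 r2] /andP[u1 u2].
    apply: le_trans (normc_polarB _ _ _ _) _; first exact: le_trans a0 (le_trans l1 r1).
    rewrite /K [leRHS]mulrDl; apply: lerD.
      by rewrite ler_norml; lra.
    rewrite -[_ * B / _]mulrA; apply: ler_pM => //.
    - by rewrite mulr_ge0//; exact: le_trans a0 (le_trans l1 r1).
    - by rewrite ler_wpM2l// (le_trans r2 l4).
    - by rewrite ler_norml; lra.
  have hc' : polar_cont h (q n).1 ((q n).1 + L / 2 ^+ n) (q n).2 ((q n).2 + B / 2 ^+ n).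
    move=> r u /andP[r1 r2] /andP[u1 u2]; apply: hc.
      by rewrite (le_trans l1 r1) (le_trans r2 l4).
    by rewrite (le_trans l5 u1) (le_trans u2 l8).
  have := @polar_boundary_small h (polar x y) Dq _ _ _ _ e (K / 2 ^+ n)
    (le_trans a0 l1) _ _ hc' (ltW e0) hK.
  rewrite !lerDl => /(_ Ln Bn) H.
  have {H} H := le_trans hE (H (fun w hw => hd' w (le_lt_trans hw Kn))).
  have H2 : (q n).1 + L / 2 ^+ n - (q n).1 + ((q n).1 + L / 2 ^+ n) *
      ((q n).2 + B / 2 ^+ n - (q n).2) <= (L + b * B) / 2 ^+ n.
    rewrite ![_ + _ - _]addrAC !subrr !add0r [leRHS]mulrDl lerD2l -mulrA.
    by rewrite ler_wpM2r.
  have p4n0 : 0 < 4 ^+ n :> R by rewrite exprn_gt0.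
  have E4 : 4 ^+ n = 2 ^+ n * 2 ^+ n :> R by rewrite -exprMn -natrM.
  have : E / 4 ^+ n <= 4 * (e * (K / 2 ^+ n)) * ((L + b * B) / 2 ^+ n).
    apply: le_trans H _; rewrite ler_wpM2l// !mulr_ge0// ?ltW// invr_ge0 ltW//.
  rewrite ler_pdivrMr// => /le_trans; apply.
  rewrite le_eqVlt; apply/orP; left; apply/eqP; rewrite E4; field.
  by rewrite gt_eqF.
apply/ler_addgt0Pr => e e0; rewrite add0r.
set M := 4 * K * (L + b * B).
have M0 : 0 <= M by rewrite !mulr_ge0// addr_ge0// mulr_ge0.
have M1 : 0 < M + 1 by rewrite ltr_wpDl.
apply: le_trans (key (e / (M + 1)) _) _; first by rewrite divr_gt0.
have -> : 4 * (e / (M + 1)) * K * (L + b * B) = e * (M / (M + 1)) by rewrite /M; ring.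
by rewrite ger_pMr// ler_pdivrMr// mul1r lerDl.
Qed.

End GoursatTheorem.

(** * Continuity at a point for complex-valued functions *)

Section PointwiseContinuity.
Variables (R : realType) (T : topologicalType).
Implicit Types (h k : T -> R[i]) (z : T).

Lemma contD h k z : {for z, continuous h} -> {for z, continuous k} ->
  {for z, continuous (fun w => h w + k w)}.
Proof. move=> hc kc; exact: (cvgD hc kc). Qed.

Lemma contM h k z : {for z, continuous h} -> {for z, continuous k} ->
  {for z, continuous (fun w => h w * k w)}.
Proof. move=> hc kc; exact: (cvgM hc kc). Qed.

Lemma contN h z : {for z, continuous h} -> {for z, continuous (fun w => - h w)}.
Proof. by move=> hc; apply: (@cvgN _ _ _ (nbhs z) _ h). Qed.

Lemma cont_cst (c : R[i]) z : {for z, continuous (fun=> c)}.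
Proof. exact: cst_continuous. Qed.

End PointwiseContinuity.

(** * Means over circles and Cauchy's theorem on annuli *)

Section CircleMean.
Variable R : realType.
Implicit Types (a b c r s t : R) (z w : R[i]) (h k : R[i] -> R[i]).

(** The mean of z h(z) is the contour integral of h over |z| = r divided by 2 pi i. Radius 0 is
    meaningful: the mean is then the value at 0, so a disc is an annulus with inner radius 0. *)
Definition mean r h : R[i] :=
  ((2 * pi)^-1)%:C * Cintegral 0 (2 * pi) (fun t => h (polar r t)).

Lemma meanE r h :
  mean r h = ((2 * pi)^-1)%:C * Cintegral 0 (2 * pi) (fun t => h (polar r t)).
Proof. by []. Qed.

Definition circle_cont r h :=
  forall t, 0 <= t <= 2 * pi -> {for polar r t, continuous h}.

Lemma twopi_gt0 : 0 < 2 * pi :> R.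
Proof. by rewrite mulr_gt0// pi_gt0. Qed.

Lemma circle_ccont r h : circle_cont r h -> ccont 0 (2 * pi) (fun t => h (polar r t)).
Proof.
move=> hc t /hc ht; apply: cvg_comp; [exact: polarr_continuous|exact: ht].
Qed.

Lemma circle_contD r h k : circle_cont r h -> circle_cont r k ->
  circle_cont r (fun z => h z + k z).
Proof. by move=> hc kc t ht; apply: contD; [exact: hc|exact: kc]. Qed.

Lemma circle_contM r h k : circle_cont r h -> circle_cont r k ->
  circle_cont r (fun z => h z * k z).
Proof. by move=> hc kc t ht; apply: contM; [exact: hc|exact: kc]. Qed.

Lemma circle_contN r h : circle_cont r h -> circle_cont r (fun z => - h z).
Proof. by move=> hc t ht; apply: contN; exact: hc. Qed.

Lemma circle_cont_cst r z : circle_cont r (fun=> z).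
Proof. by move=> t _; exact: cont_cst. Qed.

Lemma circle_cont_id r : circle_cont r id.
Proof. by move=> t _; exact: cvg_id. Qed.

Lemma eq_mean r h k : (forall t, 0 <= t <= 2 * pi -> h (polar r t) = k (polar r t)) ->
  mean r h = mean r k.
Proof. by move=> hk; rewrite /mean (eq_Cintegral hk). Qed.

Lemma meanD r h k : circle_cont r h -> circle_cont r k ->
  mean r (fun z => h z + k z) = mean r h + mean r k.
Proof. by move=> /circle_ccont hc /circle_ccont kc; rewrite /mean (CintegralD hc kc) mulrDr. Qed.

Lemma meanZ r z h : circle_cont r h -> mean r (fun w => z * h w) = z * mean r h.
Proof. by move=> /circle_ccont hc; rewrite /mean (CintegralZ z hc) mulrCA. Qed.

Lemma meanN r h : circle_cont r h -> mean r (fun w => - h w) = - mean r h.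
Proof. by move=> /circle_ccont hc; rewrite /mean (CintegralN hc) mulrN. Qed.

Lemma meanB r h k : circle_cont r h -> circle_cont r k ->
  mean r (fun z => h z - k z) = mean r h - mean r k.
Proof. by move=> hc kc; rewrite (meanD hc (circle_contN kc)) meanN. Qed.

Lemma mean_cst r z : mean r (fun=> z) = z.
Proof.
rewrite /mean Cintegral_cst ?ltW ?twopi_gt0// subr0 mulrC -mulrA -rmorphM /=.
by rewrite mulfV ?rmorph1 ?mulr1// gt_eqF// twopi_gt0.
Qed.

Lemma mean0 h : mean 0 h = h 0.
Proof. by rewrite -[RHS](mean_cst 0); apply: eq_mean => t _; rewrite polar0. Qed.

Lemma normc_mean_le r h M : circle_cont r h ->
  (forall t, 0 <= t <= 2 * pi -> normc (h (polar r t)) <= M) ->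
  normc (mean r h) <= 2 * M.
Proof.
move=> /circle_ccont hc hM; rewrite /mean normcM normc_real.
have := normc_Cintegral_le (ltW twopi_gt0) hc hM; rewrite subr0 => H.
have i0 : 0 <= (2 * pi)^-1 :> R by rewrite invr_ge0 ltW// twopi_gt0.
rewrite (ger0_norm i0).
by rewrite ler_pdivrMl ?twopi_gt0//; apply: le_trans H _; rewrite [leRHS]mulrC.
Qed.

(** Goursat's theorem on the rectangle with angles from 0 to 2 pi, whose two rays coincide. *)
Lemma mean_annulus a b h : 0 <= a <= b ->
  (forall r t, a <= r <= b -> 0 <= t <= 2 * pi -> derivable h (polar r t) 1) ->
  mean a (fun z => z * h z) = mean b (fun z => z * h z).
Proof.
move=> /andP[a0 ab] hd.
have hc r : a <= r <= b -> circle_cont r h.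
  by move=> rab t ht; apply: differentiable_continuous; apply/derivable1_diffP; exact: hd.
have zc r : circle_cont r (fun z => z) by exact: circle_cont_id.
have arc r : a <= r <= b -> mean r (fun z => z * h z) =
    ((2 * pi)^-1)%:C / 'i * arc_integral h r 0 (2 * pi).
  move=> rab; rewrite /mean -mulrA; congr (_ * _).
  rewrite /arc_integral -CintegralZ; last by apply: ccont_arc => t ht; exact: hc.
  apply: eq_Cintegral => t _; rewrite mulrCA mulKf ?[polar _ _ * _]mulrC//.
  by apply/eqP => /(congr1 (@normc R)) /eqP; rewrite normc_imaginary_unit normc0 oner_eq0.
have := goursat_polar a0 ab (ltW twopi_gt0) hd.
rewrite /polar_boundary {1 2}/ray_integral.
have -> : Cintegral a b (fun r => h (polar r (2 * pi)) * expi (2 * pi)) =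
    Cintegral a b (fun r => h (polar r 0) * expi 0).
  by apply: eq_Cintegral => r _; rewrite /polar expi2pi expi0.
rewrite -/(ray_integral h 0 a b) -addrA addrC addrA -addrA.
set I := ray_integral _ _ _ _; set A := arc_integral _ _ _ _; set B := arc_integral _ _ _ _ => E0.
have {}E0 : A = B by apply/eqP; rewrite eq_sym -subr_eq0 -E0; apply/eqP; ring.
by rewrite !arc ?lexx ?ab// -/A -/B E0.
Qed.

Lemma polar_swap_continuous : continuous (fun p : R * R => polar p.2 p.1).
Proof.
move=> -[t r]; apply: cvgM.
  by apply: (@cvg_complex _ _ _ _ (fun p : R * R => p.2) (fun=> 0)); [exact: cvg_snd|exact: cvg_cst].
apply: (@continuous_comp _ _ _ fst (@expi R)); first exact: cvg_fst.
exact: expi_continuous.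
Qed.

(** Compactness of [0, 2 pi]. The filter is arbitrary, so the same lemma yields uniform radii,
    moduli of continuity, parameter neighbourhoods and, with [+oo], upper bounds. *)
Lemma near_circle (I : Type) (F : set_system I) (FF : Filter F) (P : I -> R -> Prop) :
  (forall t, 0 <= t <= 2 * pi -> \forall t' \near t & i \near F, P i t') ->
  \forall i \near F, forall t, 0 <= t <= 2 * pi -> P i t.
Proof.
move=> H; have /compact_near_coveringP := @segment_compact R 0 (2 * pi).
move=> /(_ I F P FF) h.
have {h} : \forall i \near F, `[0, 2 * pi] `<=` P i.
  by apply: h => t; rewrite /= in_itv /=; exact: H.
by apply: filterS => i h t ht; apply: h; rewrite /= in_itv.
Qed.

Lemma mean_cont a b h : (forall r, a <= r <= b -> circle_cont r h) ->
  forall r e, a <= r <= b -> 0 < e -> exists2 d, 0 < d &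
    forall s, a <= s <= b -> `|s - r| < d -> normc (mean s h - mean r h) <= e.
Proof.
move=> hc r e rab e0.
have e20 : 0 < e / 4 by rewrite divr_gt0.
have : \forall s \near r, forall t, 0 <= t <= 2 * pi ->
    normc (h (polar s t) - h (polar r t)) < e / 2.
  apply: (@near_circle _ (nbhs r) _ (fun s t => normc (h (polar s t) - h (polar r t)) < e / 2)) => t ht.
  have /cvg_normcP /(_ _ e20) := hc r rab t ht.
  rewrite -nbhs_nearE => H.
  have H1 : \forall p \near (t, r), normc (h (polar p.2 p.1) - h (polar r t)) < e / 4.
    exact: (@polar_swap_continuous (t, r) _ H).
  have H2 : \forall u \near t, normc (h (polar r u) - h (polar r t)) < e / 4.
    exact: (@polarr_continuous R r t _ H).
  have H3 : \forall p \near (t, r), normc (h (polar r p.1) - h (polar r t)) < e / 4.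
    exact: (cvg_fst H2).
  apply: filterS2 H1 H3 => p h1 h3.
  have -> : h (polar p.2 p.1) - h (polar r p.1) = (h (polar p.2 p.1) - h (polar r t)) -
     (h (polar r p.1) - h (polar r t)) by ring.
  apply: le_lt_trans (le_normcD _ _) _; rewrite normcN.
  rewrite [e / 2](_ : _ = e / 4 + e / 4); last by field.
  exact: ltrD.
move=> /nbhs_ballP[d d0 hd]; exists d => // s sab sr.
pose F t := h (polar s t) - h (polar r t).
have -> : mean s h - mean r h = ((2 * pi)^-1)%:C * Cintegral 0 (2 * pi) F.
  rewrite /mean /F CintegralB ?mulrBr//; apply: circle_ccont; exact: hc.
have Fc : ccont 0 (2 * pi) F.
  by apply: ccontB; apply: circle_ccont; exact: hc.
have FM t : 0 <= t <= 2 * pi -> normc (F t) <= e / 2.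
  by move=> ht; apply: ltW; apply: hd => //; rewrite /ball /= distrC.
rewrite normcM normc_real; have := normc_Cintegral_le (ltW twopi_gt0) Fc FM; rewrite subr0 => H.
have i0 : 0 <= (2 * pi)^-1 :> R by rewrite invr_ge0 ltW// twopi_gt0.
rewrite (ger0_norm i0).
rewrite ler_pdivrMl ?twopi_gt0//; apply: le_trans H _.
by rewrite [leRHS]mulrC ler_wpM2r ?(ltW twopi_gt0)// mulrC divfK.
Qed.

(** Cauchy's theorem on a slightly smaller annulus, followed by continuity of the mean in the
    radius. *)
Lemma mean_annulus_open a b h : 0 <= a <= b ->
  (forall r, a <= r <= b -> circle_cont r h) ->
  (forall r t, a < r < b -> 0 <= t <= 2 * pi -> derivable h (polar r t) 1) ->
  mean a (fun z => z * h z) = mean b (fun z => z * h z).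
Proof.
move=> /andP[a0 ab] hc hd; move: ab; rewrite le_eqVlt => /predU1P[->//|ab].
have zhc r : a <= r <= b -> circle_cont r (fun z => z * h z).
  by move=> rab; apply: circle_contM; [exact: circle_cont_id|exact: hc].
apply/eqP; rewrite -subr_eq0; apply/eqP; apply: eq0_normc; apply/eqP.
rewrite eq_le normc_ge0 andbT; apply/ler_addgt0Pr => e e0; rewrite add0r.
have e20 : 0 < e / 2 by rewrite divr_gt0.
have aab : a <= a <= b by rewrite lexx ltW.
have bab : a <= b <= b by rewrite lexx ltW.
have [d d0 hd1] := mean_cont zhc aab e20.
have [d' d'0 hd2] := mean_cont zhc bab e20.
(* The division by 3 makes [m] strictly smaller than [d] and [d'] and keeps [a + m <= b - m]. *)
pose m := Num.min (Num.min d d') (b - a) / 3.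
have m0 : 0 < m by rewrite divr_gt0// !lt_min d0 d'0 subr_gt0 ab.
have md : m < d.
  by rewrite /m ltr_pdivrMr// gt_min; apply/orP; left; rewrite gt_min; apply/orP; left; lra.
have md' : m < d'.
  by rewrite /m ltr_pdivrMr// gt_min; apply/orP; left; rewrite gt_min; apply/orP; right; lra.
have mba : 3 * m <= b - a by rewrite /m mulrC divfK// ge_min lexx orbT.
have := hd1 (a + m); rewrite addrAC subrr add0r ger0_norm ?(ltW m0)//.
have -> : a <= a + m <= b by apply/andP; split; lra.
move=> /(_ isT md) h1.
have := hd2 (b - m); rewrite addrAC subrr add0r normrN ger0_norm ?(ltW m0)//.
have -> : a <= b - m <= b by apply/andP; split; lra.
move=> /(_ isT md') h2.
have E : mean (a + m) (fun z => z * h z) = mean (b - m) (fun z => z * h z).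
  apply: mean_annulus; first by apply/andP; split; lra.
  by move=> r t /andP[r1 r2] ht; apply: hd => //; apply/andP; split; lra.
set X := mean a _ in h1 *; set Y := mean b _ in h2 *; rewrite E in h1.
set Z := mean (b - m) _ in h1 h2.
have -> : X - Y = (Z - Y) - (Z - X) by ring.
apply: le_trans (le_normcD _ _) _; rewrite normcN.
by rewrite [e](splitr e); exact: lerD.
Qed.

(** The annulus is cut along the exceptional circle |z| = c, which becomes a boundary of both
    pieces. *)
Lemma mean_annulus_except c a b h : 0 <= a <= b ->
  (forall r, a <= r <= b -> circle_cont r h) ->
  (forall r t, a <= r <= b -> r != c -> 0 <= t <= 2 * pi -> derivable h (polar r t) 1) ->
  mean a (fun z => z * h z) = mean b (fun z => z * h z).
Proof.
move=> /andP[a0 ab] hc hd.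
have [/andP[ac cb]|cab] := boolP (a <= c <= b); last first.
  apply: mean_annulus_open; rewrite ?a0//.
  move=> r t /andP[ar rb] ht; apply: hd => //; first by rewrite !ltW.
  by apply: contraNneq cab => <-; rewrite !ltW.
transitivity (mean c (fun z => z * h z)).
  apply: mean_annulus_open; rewrite ?a0//.
    by move=> r /andP[ar rc]; apply: hc; rewrite ar (le_trans rc cb).
  move=> r t /andP[ar rc] ht; apply: hd => //; last by rewrite lt_eqF.
  by rewrite ltW//= (le_trans (ltW rc)).
apply: mean_annulus_open; first by rewrite (le_trans a0 ac) cb.
  by move=> r /andP[cr rb]; apply: hc; rewrite rb (le_trans ac cr).
move=> r t /andP[cr rb] ht; apply: hd => //; last by rewrite gt_eqF.
by rewrite (ltW rb) andbT (le_trans ac (ltW cr)).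
Qed.

End CircleMean.

(* Unification would otherwise unfold circle means down to Lebesgue integrals. *)
#[local] Opaque mean polar.

(** * Cauchy's formula on a disc and its consequences *)

Section CauchyFormula.
Variable R : realType.
Implicit Types (r s t rho : R) (a z w : R[i]) (h k : R[i] -> R[i]).

Lemma derivable_cont h z : derivable h z 1 -> {for z, continuous h}.
Proof. by move=> hd; apply: differentiable_continuous; apply/derivable1_diffP. Qed.

Lemma derivable_idC z : derivable (fun w : R[i] => w) z 1.
Proof. exact: derivable_id. Qed.

Lemma derivable_subC h k z : derivable h z 1 -> derivable k z 1 -> derivable (fun w => h w - k w) z 1.
Proof. exact: derivableB. Qed.

Lemma derivable_mulC h k z : derivable h z 1 -> derivable k z 1 -> derivable (fun w => h w * k w) z 1.
Proof. exact: derivableM. Qed.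

Lemma derivable_cstC c z : derivable (fun=> c : R[i]) z 1.
Proof. exact: derivable_cst. Qed.

Lemma derivable_pow n z : derivable (fun w : R[i] => w ^+ n) z 1.
Proof.
elim: n => [|n IH].
  have -> : (fun w : R[i] => w ^+ 0) = (fun=> 1) by apply/funext => w; rewrite expr0.
  exact: (@derivable_cstC 1 z).
have -> : (fun w : R[i] => w ^+ n.+1) = (fun w => w * w ^+ n) by apply/funext => w; rewrite exprS.
exact: (derivable_mulC (@derivable_idC z) IH).
Qed.

Lemma derivable_shiftV a z : z != a -> derivable (fun w => (w - a)^-1) z 1.
Proof.
move=> za; apply: derivableV; first by rewrite subr_eq0.
exact (derivable_subC (@derivable_idC z) (@derivable_cstC a z)).
Qed.

Lemma derivable_invC z : z != 0 -> derivable (fun w : R[i] => w^-1) z 1.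
Proof. by move=> z0; apply: derivableV => //; exact: derivable_idC. Qed.

Lemma polar_neq r t a : 0 <= r -> normc a != r -> polar r t != a.
Proof. by move=> r0; apply: contraNneq => <-; rewrite normc_polar. Qed.

Lemma normc_polarB_ge r t a : 0 <= r -> r - normc a <= normc (polar r t - a).
Proof. by move=> r0; have := le_normcB (polar r t) a; rewrite normc_polar. Qed.

(** The mean does not depend on the radius r >= rho, and it differs from 1 by the mean of a / (z -
    a), which tends to 0 as r grows. *)
Lemma mean_kernel rho a : normc a < rho -> mean rho (fun z => z * (z - a)^-1) = 1.
Proof.
move=> arho; have a0 := normc_ge0 a; have rho0 : 0 < rho := le_lt_trans a0 arho.
have kd r t : normc a < r -> derivable (fun w => (w - a)^-1) (polar r t) 1.
  move=> ar; apply: derivable_shiftV; apply: polar_neq; last by rewrite lt_eqF.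
  by rewrite ltW// (le_lt_trans a0 ar).
have key r : rho <= r -> mean rho (fun z => z * (z - a)^-1) = mean r (fun z => z * (z - a)^-1).
  move=> rr; apply: mean_annulus; first by rewrite ltW.
  by move=> r' t /andP[r1 _] _; apply: kd; exact: lt_le_trans r1.
set X := mean rho _.
have bound r : rho <= r -> normc (X - 1) * (r - normc a) <= 2 * normc a.
  move=> rr; have ar := lt_le_trans arho rr; have r0 : 0 < r := le_lt_trans a0 ar.
  have cc : circle_cont r (fun w => (w - a)^-1) by move=> t _; apply: derivable_cont; exact: kd.
  have -> : X - 1 = mean r (fun z => a * (z - a)^-1).
    have := meanB (circle_contM (@circle_cont_id R r) cc) (@circle_cont_cst R r 1).
    rewrite mean_cst -(key r rr) => <-.
    apply: eq_mean => t _; have n0 : polar r t - a != 0.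
      by rewrite subr_eq0; apply: polar_neq; [exact: ltW|rewrite lt_eqF].
    by rewrite -[X in _ - X](mulfV n0) -mulrBl subKr.
  rewrite -ler_pdivlMr ?subr_gt0// -mulrA; apply: normc_mean_le.
    exact: (circle_contM (@circle_cont_cst R r a) cc).
  move=> t _; rewrite normcM normcV ler_wpM2l// lef_pV2 ?posrE ?subr_gt0//.
    exact/normc_polarB_ge/ltW.
  by apply: lt_le_trans (normc_polarB_ge _ _ (ltW r0)); rewrite subr_gt0.
have : normc (X - 1) <= 0.
  rewrite leNgt; apply/negP => N0.
  (* This radius makes the left side of [bound] at least 2 |a| + 1. *)
  pose r := rho + (2 * normc a + 1) / normc (X - 1).
  have rr : rho <= r by rewrite lerDl divr_ge0 ?ltW// ltr_wpDl// mulr_ge0.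
  have := bound r rr; apply/negP; rewrite -ltNge.
  apply: (@lt_le_trans _ _ (normc (X - 1) * ((2 * normc a + 1) / normc (X - 1)))).
    by rewrite mulrCA mulfV ?gt_eqF// mulr1 ltrDl.
  by rewrite ler_pM2l// /r addrAC lerDr subr_ge0 ltW.
rewrite le_eqVlt ltNge normc_ge0 orbF => /eqP /eq0_normc /eqP.
by rewrite subr_eq0 => /eqP.
Qed.

(** The difference quotient with its removable singularity filled in. *)
Definition dquot h a z := if z == a then 'D_1 h a else (h z - h a) / (z - a).

Lemma dquot_cont h a : derivable h a 1 -> {for a, continuous (dquot h a)}.
Proof.
move=> hd; have [q hq] := derivable_expansion hd.
(* The slope of the expansion is identified with the derivative chosen by the library. *)
have Dq : 'D_1 h a = q.
  apply: (cvg_lim (@norm_hausdorff _ _)); apply/cvg_normcP => e e0; rewrite /dnbhs /within /=.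
  have e20 : 0 < e / 2 by rewrite divr_gt0.
  have [d d0 hd'] := hq _ e20; apply/nbhs_normcP; exists d => // w; rewrite subr0 => wd w0.
  have := hd' (w + a); rewrite addrK => /(_ wd) H.
  rewrite /GRing.scale /= mulr1.
  have -> : w^-1 * (h (w + a) - h a) - q = (h (w + a) - h a - q * w) / w by field.
  rewrite normcM normcV ltr_pdivrMr; last first.
    by rewrite lt_def normc_ge0 andbT; apply: contraNneq w0 => /eq0_normc ->.
  apply: le_lt_trans H _; rewrite ltr_pM2r; first by lra.
  by rewrite lt_def normc_ge0 andbT; apply: contraNneq w0 => /eq0_normc ->.
apply/(@cvg_normcP _ _ (nbhs a) _) => e e0; rewrite /dquot eqxx Dq.
have e20 : 0 < e / 2 by rewrite divr_gt0.
have [d d0 hd'] := hq _ e20; apply/nbhs_normcP; exists d => // w wd /=.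
case: (eqVneq w a) => [_|wa]; first by rewrite subrr normc0.
have wa0 : w - a != 0 by rewrite subr_eq0.
have n0 : 0 < normc (w - a).
  by rewrite lt_def normc_ge0 andbT; apply: contraNneq wa0 => /eq0_normc ->.
have -> : (h w - h a) / (w - a) - q = (h w - h a - q * (w - a)) / (w - a) by field.
rewrite normcM normcV ltr_pdivrMr//.
by apply: le_lt_trans (hd' w wd) _; rewrite ltr_pM2r//; lra.
Qed.

Lemma dquot_derivable h a z : z != a -> derivable h z 1 -> derivable (dquot h a) z 1.
Proof.
move=> za hd.
apply: (@near_eq_derivable _ _ _ (fun z => (h z - h a) * (z - a)^-1)); last first.
  exact (derivable_mulC (derivable_subC hd (@derivable_cstC (h a) z)) (derivable_shiftV za)).
apply/nbhs_normcP; exists (normc (z - a)).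
  by rewrite lt_def normc_ge0 andbT; apply: contraNneq za => /eq0_normc /eqP; rewrite subr_eq0.
move=> w wz; rewrite /dquot; case: eqP => // wa.
by move: wz; rewrite wa normcB ltxx.
Qed.

(* The quotient is merely continuous at [a], which [mean_annulus_except] tolerates. *)
Lemma mean_dquot r s h a : 0 <= r <= s ->
  (forall x t, r <= x <= s -> 0 <= t <= 2 * pi -> derivable h (polar x t) 1) ->
  derivable h a 1 ->
  mean r (fun z => z * dquot h a z) = mean s (fun z => z * dquot h a z).
Proof.
move=> rs hd had; apply: (@mean_annulus_except R (normc a) r s (dquot h a) rs).
  move=> x xrs t ht; have [->|ne] := eqVneq (polar x t) a; first exact: dquot_cont.
  exact: (derivable_cont (dquot_derivable ne (hd _ _ xrs ht))).
move=> x t xrs xa ht; apply: dquot_derivable; last exact: (hd x t xrs ht).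
apply: polar_neq; last by rewrite eq_sym.
by case/andP: rs => r0 _; case/andP: xrs => rx _; exact: le_trans rx.
Qed.

(** The point [a] may lie on either side of the circle: inside, the kernel has mean 1 and Cauchy's
    formula results; outside, the case serves the Laurent expansion. *)
Lemma mean_dquotE r h a : 0 <= r -> normc a != r -> circle_cont r h ->
  mean r (fun z => z * dquot h a z) =
  mean r (fun z => z * h z * (z - a)^-1) - h a * mean r (fun z => z * (z - a)^-1).
Proof.
move=> r0 ar hc.
have cc : circle_cont r (fun w => (w - a)^-1).
  by move=> t _; apply: derivable_cont; apply: derivable_shiftV; exact: polar_neq.
have zc := @circle_cont_id R r.
have c1 := circle_contM (circle_contM zc hc) cc.
have c2 := circle_contM zc cc.
rewrite -(meanZ (h a) c2) -(meanB c1 (circle_contM (@circle_cont_cst R r (h a)) c2)).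
apply: eq_mean => t _; rewrite /dquot (negbTE (polar_neq _ r0 ar)).
by rewrite mulrBl mulrBr [h a * (_ * _)]mulrCA mulrA.
Qed.

(** The mean of z times the difference quotient is the same at radius rho and at radius 0, where it
    vanishes. *)
Lemma cauchy_formula rho h a : normc a < rho ->
  (forall z, normc z <= rho -> derivable h z 1) ->
  h a = mean rho (fun z => z * h z * (z - a)^-1).
Proof.
move=> arho hd; have rho0 : 0 <= rho by exact: le_trans (normc_ge0 a) (ltW arho).
have hp x t : 0 <= x <= rho -> 0 <= t <= 2 * pi -> derivable h (polar x t) 1.
  by move=> /andP[x0 xr] _; apply: hd; rewrite normc_polar.
have hc : circle_cont rho h.
  by move=> t ht; apply: derivable_cont; apply: hp; rewrite // rho0 lexx.
have r0 : (0 : R) <= 0 <= rho by apply/andP; split.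
have := mean_dquot r0 hp (hd a (ltW arho)); rewrite mean0 mul0r.
rewrite mean_dquotE ?lt_eqF// mean_kernel// mulr1 => /eqP.
by rewrite eq_sym subr_eq0 => /eqP.
Qed.

Lemma circle_bounded r h : circle_cont r h ->
  exists M, forall t, 0 <= t <= 2 * pi -> normc (h (polar r t)) <= M.
Proof.
move=> /circle_ccont hc.
have : \forall M \near +oo, forall t, 0 <= t <= 2 * pi -> normc (h (polar r t)) <= M.
  apply: (@near_circle R _ (pinfty_nbhs R) _ (fun M t => normc (h (polar r t)) <= M)) => t ht.
  have /cvg_normcP /(_ 1 ltr01) H := hc t ht.
  exists ([set t' | normc (h (polar r t') - h (polar r t)) < 1],
          [set M | normc (h (polar r t)) + 1 < M]) => /=.
    by split; [exact: H|exact: nbhs_pinfty_gt (num_real _)].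
  move=> [t' M] /= [h1 h2].
  rewrite -[h (polar r t')](subrK (h (polar r t))).
  apply: le_trans (le_normcD _ _) _; rewrite addrC ltW//; apply: le_lt_trans h2.
  by rewrite lerD2l ltW.
by move=> /filter_ex [M HM]; exists M.
Qed.

Lemma polar_sub_neq0_inv_le rho t (s : R[i]) : normc s <= rho / 2 -> 0 < rho ->
  polar rho t - s != 0 /\ (normc (polar rho t - s))^-1 <= 2 / rho.
Proof.
move=> srho rho0.
have h1 : rho / 2 <= normc (polar rho t - s).
  by apply: le_trans (normc_polarB_ge _ _ (ltW rho0)); lra.
have h2 : 0 < rho / 2 by rewrite divr_gt0.
split; first by apply: contraTneq h1 => ->; rewrite normc0 -ltNge.
by rewrite -[2 / rho]invf_div lef_pV2// posrE// (lt_le_trans h2).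
Qed.

Lemma normc_gt0 z : z != 0 -> 0 < normc z.
Proof. by move=> z0; rewrite lt_def normc_ge0 andbT; apply: contraNneq z0 => /eq0_normc ->. Qed.

Lemma disc_circle_cont rho h r : 0 <= r <= rho ->
  (forall z, normc z <= rho -> derivable h z 1) -> circle_cont r h.
Proof.
move=> /andP[r0 rr] hd t _; apply: derivable_cont; apply: hd.
by rewrite normc_polar.
Qed.

(** Taylor's formula of order one read off the Cauchy kernel: z / (z - s) - 1 - s / z = s^2 / (z (z
    - s)), with |z - s| >= rho / 2 on the circle. The mean of h(z) / z plays the role of h'(0). *)
Lemma second_order_bound rho h (s : R[i]) M : 0 < rho ->
  (forall z, normc z <= rho -> derivable h z 1) ->
  (forall t, 0 <= t <= 2 * pi -> normc (h (polar rho t)) <= M) ->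
  normc s <= rho / 2 ->
  normc (h s - h 0 - s * mean rho (fun z => h z / z)) <= 4 * M * (normc s / rho) ^+ 2.
Proof.
move=> rho0 hd hM srho.
have s1 : normc s < rho by apply: le_lt_trans srho _; lra.
have o1 : normc (0 : R[i]) < rho by rewrite normc0.
have rr : 0 <= rho <= rho by rewrite ltW/=.
have hc := disc_circle_cont rr hd.
have cc : circle_cont rho (fun w => (w - s)^-1).
  move=> t _; apply: derivable_cont; apply: derivable_shiftV.
  by have [+ _] := polar_sub_neq0_inv_le t srho rho0; rewrite subr_eq0.
have ci : circle_cont rho (fun w => w^-1).
  by move=> t _; apply: derivable_cont; apply: derivable_invC; exact: polar_neq0.
have c1 := circle_contM (circle_contM (@circle_cont_id R rho) hc) cc.
have M0 : 0 <= M by apply: le_trans (hM 0 _); rewrite ?normc_ge0 ?lexx ?ltW ?twopi_gt0.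
have h0E : h 0 = mean rho h.
  rewrite (cauchy_formula o1 hd); apply: eq_mean => t _.
  by rewrite subr0 mulrAC mulfV ?mul1r// polar_neq0.
have c2 := circle_contM hc ci.
have c3 := circle_contM (@circle_cont_cst R rho s) c2.
have c13 := circle_contD c1 (circle_contN hc).
rewrite (cauchy_formula s1 hd) h0E -(meanB c1 hc) -(meanZ s c2) -(meanB c13 c3).
have -> : mean rho (fun z => z * h z * (z - s)^-1 - h z - s * (h z * z^-1)) =
          mean rho (fun z => s ^+ 2 * (h z * z^-1 * (z - s)^-1)).
  apply: eq_mean => t _; have [n0 _] := polar_sub_neq0_inv_le t srho rho0.
  have z0 := polar_neq0 t rho0; move: n0 z0.
  set z := polar rho t; move: (h z) => y; move: z => z n0 z0.
  by field; rewrite z0 n0.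
rewrite (meanZ _ (circle_contM c2 cc)) normcM normcX.
have : normc (mean rho (fun z => h z * z^-1 * (z - s)^-1)) <= 2 * (M * rho^-1 * (2 / rho)).
  apply: normc_mean_le; first exact: circle_contM c2 cc.
  move=> t ht; rewrite !normcM !normcV (normc_polar t (ltW rho0)).
  have [_ n1] := polar_sub_neq0_inv_le t srho rho0.
  have i0 : 0 <= rho^-1 by rewrite invr_ge0 ltW.
  apply: ler_pM => //; [by rewrite mulr_ge0// normc_ge0|by rewrite invr_ge0 normc_ge0|].
  by rewrite ler_wpM2r// hM.
move=> H; have s20 : 0 <= normc s ^+ 2 by rewrite exprn_ge0// normc_ge0.
apply: le_trans (ler_wpM2l s20 H) _.
by rewrite le_eqVlt; apply/orP; left; apply/eqP; field; rewrite gt_eqF.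
Qed.

Lemma expr_le0 (x y B : R) : 0 <= x < 1 -> 0 <= B -> (forall n, y <= B * x ^+ n) -> y <= 0.
Proof.
move=> /andP[x0 x1] B0 H; rewrite leNgt; apply/negP => y0.
have := @cvg_geometric R B x; rewrite ger0_norm// => /(_ x1) /cvgrPdist_lt /(_ y y0) [N _ /(_ N (leqnn N))].
rewrite sub0r normrN ger0_norm /geometric /=; last by rewrite mulr_ge0// exprn_ge0.
by rewrite ltNge H.
Qed.

(* The Cauchy estimate for [h z / z ^ n] at all orders [n] replaces the power series expansion. *)
Lemma zero_near_zero_disc rho h : 0 < rho ->
  (forall z, normc z <= rho -> derivable h z 1) ->
  (\forall z \near 0, h z = 0) ->
  forall s : R[i], normc s < rho -> h s = 0.
Proof.
move=> rho0 hd /nbhs_normcP[d d0 h0] s srho.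
have hz0 z : normc z < d -> h z = 0 by move=> zd; apply: h0; rewrite subr0.
have [->|s0] := eqVneq s 0; first by apply: hz0; rewrite normc0.
have rr : 0 <= rho <= rho by rewrite ltW/=.
have hc := disc_circle_cont rr hd.
have [M hM] := circle_bounded hc.
have M0 : 0 <= M by apply: le_trans (hM 0 _); rewrite ?normc_ge0 ?lexx ?ltW ?twopi_gt0.
(* As [h] vanishes near 0, so does this quotient, whatever value the inverse takes at 0; it is
   therefore holomorphic on the whole disc. *)
pose q n z := h z * z^-1 ^+ n.
have qd n z : normc z <= rho -> derivable (q n) z 1.
  move=> zr; have [z0|z0] := eqVneq z 0.
    apply: (@near_eq_derivable _ _ _ (fun=> 0)); last exact: (@derivable_cstC 0 z).
    rewrite z0; apply/nbhs_normcP; exists d => // w; rewrite subr0 => wd.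
    by rewrite /q hz0// mul0r.
  apply: derivable_mulC; first exact: hd.
  elim: n => [|n IH].
    by have -> : (fun w : R[i] => w^-1 ^+ 0) = (fun=> 1) by apply/funext => w; rewrite expr0.
  have -> : (fun w : R[i] => w^-1 ^+ n.+1) = (fun w => w^-1 * w^-1 ^+ n) by apply/funext => w; rewrite exprS.
  exact: (derivable_mulC (derivable_invC z0) IH).
have gap : 0 < rho - normc s by rewrite subr_gt0.
have ccs : circle_cont rho (fun w => (w - s)^-1).
  move=> t _; apply: derivable_cont; apply: derivable_shiftV.
  by apply: polar_neq; [exact: ltW|rewrite lt_eqF].
have bound n : normc (h s) <= 2 * (rho * M * (rho - normc s)^-1) * (normc s / rho) ^+ n.
  have -> : h s = q n s * s ^+ n by rewrite /q -mulrA -exprMn mulVf// expr1n mulr1.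
  rewrite normcM normcX (cauchy_formula srho (qd n)).
  have : normc (mean rho (fun z => z * q n z * (z - s)^-1)) <= 2 * (rho * (M * rho^-1 ^+ n) * (rho - normc s)^-1).
    apply: normc_mean_le.
      exact: (circle_contM (circle_contM (@circle_cont_id R rho) (disc_circle_cont rr (qd n))) ccs).
    move=> t ht; rewrite normcM [normc (_ * q n _)]normcM (normc_polar t (ltW rho0)) /q normcM normcX !normcV (normc_polar t (ltW rho0)).
    have i0 : 0 <= rho^-1 by rewrite invr_ge0 ltW.
    apply: ler_pM.
    - by rewrite !mulr_ge0 ?normc_ge0 ?exprn_ge0// ltW.
    - by rewrite invr_ge0 normc_ge0.
    - by rewrite ler_pM2l// ler_wpM2r ?exprn_ge0// hM.
    - have H := normc_polarB_ge t s (ltW rho0).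
      by rewrite lef_pV2 ?posrE// (lt_le_trans gap).
  move=> H; apply: le_trans (ler_wpM2r (exprn_ge0 n (normc_ge0 s)) H) _.
  rewrite exprMn le_eqVlt; apply/orP; left; apply/eqP; ring.
apply: eq0_normc; apply/eqP; rewrite eq_le normc_ge0 andbT.
apply: (expr_le0 _ _ bound).
  by rewrite divr_ge0 ?normc_ge0 ?ltW//= ltr_pdivrMr// mul1r.
by rewrite !mulr_ge0// ?invr_ge0 ltW.
Qed.

End CauchyFormula.

(** * Holomorphic dependence of circle means on parameters *)

Section DifferentiableMean.
Variable R : realType.

Lemma norm_ReE (V : normedModType R[i]) (k : V) : `|k| = (complex.Re `|k|)%:C.
Proof.
have := normr_ge0 k; case: `|k| => x y; by rewrite lecE /= => /andP[/eqP -> _].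
Qed.

Lemma Re_norm_ge0 (V : normedModType R[i]) (k : V) : 0 <= complex.Re `|k|.
Proof. by have := normr_ge0 k; rewrite [`|k|]norm_ReE (lecR 0). Qed.

Lemma nbhs_Re_normP (V : normedModType R[i]) (p : V) (A : set V) :
  nbhs p A <-> exists2 d : R, 0 < d & forall k, complex.Re `|k| < d -> A (p + k).
Proof.
split=> [/nbhs_ballP [[x y]]|[d d0 dA]].
  rewrite /= ltcE /= => /andP[/eqP -> x0] H; exists x => // k kx; apply: H.
  by rewrite -ball_normE /= opprD addrA subrr sub0r normrN norm_ReE ltcR.
apply/nbhs_ballP; exists d%:C; first by rewrite /= (ltcR 0).
move=> q; rewrite -ball_normE /= => h; rewrite -[q](subrK p) addrC; apply: dA.
by move: h; rewrite distrC norm_ReE ltcR.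
Qed.

(** A quadratic remainder is little-o; [K + 1] in the proof avoids a division by 0. *)
Lemma differentiable_of_bound (V : normedModType R[i]) (g : V -> R[i]) (p : V)
    (T : {linear V -> R[i]}) (B K d : R) : 0 < d -> 0 <= B -> 0 <= K ->
  (forall k, normc (T k) <= B * complex.Re `|k|) ->
  (forall k, complex.Re `|k| < d -> normc (g (p + k) - g p - T k) <= K * complex.Re `|k| ^+ 2) ->
  differentiable g p.
Proof.
move=> d0 B0 K0 hB hK.
have Tc : continuous T.
  apply/linear_bounded_continuous; apply/linear_boundedP.
  near=> M => k.
  rewrite [in leLHS]/Num.norm /=.
  have BM : B%:C <= M by near: M; apply: nbhs_pinfty_ge; rewrite ger0_real// (lecR 0).
  apply: le_trans (ler_wpM2r (normr_ge0 k) BM).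
  by rewrite [`|k|]norm_ReE -rmorphM lecR.
have E : g \o shift p = cst (g p) + T +o_ 0 id.
  apply/eqaddoP => e e0.
  have [x -> x0] : exists2 x : R, e = x%:C & 0 < x.
    by move: e0; case: e => x y; rewrite ltcE /= => /andP[/eqP -> x0]; exists x.
  pose d' := Num.min d (x / (K + 1)).
  have d'0 : 0 < d' by rewrite lt_min d0 divr_gt0// ltr_wpDl.
  apply/nbhs_Re_normP; exists d' => // k; rewrite lt_min => /andP[k1 k2].
  rewrite add0r.
  have -> : (g \o shift p - (cst (g p) + T)) k = g (p + k) - g p - T k.
    rewrite [LHS](_ : _ = g (k + p) - (g p + T k))//.
    by rewrite [k + p]addrC opprD addrA.
  rewrite [leRHS](_ : _ = (x * complex.Re `|k|)%:C); last by rewrite rmorphM /= -norm_ReE.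
  rewrite [leLHS](_ : _ = (normc (g (p + k) - g p - T k))%:C)// lecR.
  apply: le_trans (hK k k1) _; rewrite expr2 mulrA ler_wpM2r ?Re_norm_ge0//.
  move: k2; rewrite ltr_pdivlMr ?ltr_wpDl// => k2.
  apply: le_trans (ltW k2); rewrite mulrC ler_wpM2l ?Re_norm_ge0// lerDl//.
have dT := diff_unique Tc E.
by apply/diff_locallyP; rewrite dT.
Unshelve. all: by end_near. Qed.

Lemma cont_pairl (U W : topologicalType) (z : U) (y : W) :
  {for z, continuous (fun z : U => (z, y))}.
Proof. exact: (cvg_pair cvg_id (cvg_cst _)). Qed.

Lemma cont_pair (T U W : topologicalType) (f : T -> U) (g : T -> W) (z : T) :
  {for z, continuous f} -> {for z, continuous g} ->
  {for z, continuous (fun z => (f z, g z))}.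
Proof. by move=> hf hg; exact: (cvg_pair hf hg). Qed.

(** Joint continuity along the compact circle makes the convergence in y uniform; e / 6 + e / 6 = e
    / 3 on the circle, then the factor 2 of the mean. *)
Lemma mean_param_cont (W : topologicalType) (w : R[i] * W -> R[i]) r (y0 : W) :
  (forall t, 0 <= t <= 2 * pi -> \forall q \near (polar r t, y0), {for q, continuous w}) ->
  (\forall y \near y0, circle_cont r (fun z => w (z, y))) /\
  {for y0, continuous (fun y => mean r (fun z => w (z, y)))}.
Proof.
move=> hw.
have part q : {for q, continuous w} -> {for q.1, continuous (fun z => w (z, q.2))}.
  case: q => z y wq; apply: (@continuous_comp _ _ _ (fun z => (z, y)) w z) => //.
  exact: cont_pairl.
have polar_y t (Q : set (R[i] * W)) : nbhs (polar r t, y0) Q ->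
    \forall p \near (t, y0), Q (polar r p.1, p.2).
  move=> hQ; apply: (@continuous_comp _ _ _ (fun p : R * W => (polar r p.1, p.2)) id (t, y0)) hQ; last exact: cvg_id.
  apply: (@cont_pair _ _ _ (fun p : R * W => polar r p.1) snd); last exact: cvg_snd.
  by apply: (@continuous_comp _ _ _ fst (polar r)); [exact: cvg_fst|exact: polarr_continuous].
have cc : \forall y \near y0, circle_cont r (fun z => w (z, y)).
  apply: (@near_circle _ _ (nbhs y0) _ (fun y t => {for polar r t, continuous (fun z => w (z, y))})) => t ht.
  by apply: filterS (polar_y _ _ (hw t ht)) => -[t' y] /= /part.
split=> //.
have cc0 : circle_cont r (fun z => w (z, y0)) by exact: nbhs_singleton cc.
apply/(@cvg_normcP _ _ (nbhs y0) _) => e e0.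
have e20 : 0 < e / 3 by rewrite divr_gt0.
have e40 : 0 < e / 6 by rewrite divr_gt0.
have : \forall y \near y0, forall t, 0 <= t <= 2 * pi ->
    normc (w (polar r t, y) - w (polar r t, y0)) < e / 3.
  apply: (@near_circle _ _ (nbhs y0) _ (fun y t => normc (w (polar r t, y) - w (polar r t, y0)) < e / 3)) => t ht.
  have /cvg_normcP /(_ _ e40) H := nbhs_singleton (hw t ht).
  have H1 := polar_y _ _ H.
  have H3 : \forall p \near (t, y0), normc (w (polar r p.1, y0) - w (polar r t, y0)) < e / 6.
    have H0 : w (polar r u, y0) @[u --> t] --> w (polar r t, y0) := circle_ccont cc0 ht.
    have /cvg_normcP /(_ _ e40) H2 := H0.
    exact: (cvg_fst H2).
  apply: filterS2 H1 H3 => -[t' y] /= h1 h3.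
  have -> : w (polar r t', y) - w (polar r t', y0) =
     (w (polar r t', y) - w (polar r t, y0)) - (w (polar r t', y0) - w (polar r t, y0)).
    by rewrite opprB addrA subrK.
  apply: le_lt_trans (le_normcD _ _) _; rewrite normcN.
  rewrite [e / 3](_ : _ = e / 6 + e / 6); last by field.
  exact: ltrD.
apply: filterS2 cc => y cy hy.
rewrite -(meanB cy cc0).
apply: (@le_lt_trans _ _ (2 * (e / 3))); last by lra.
apply: normc_mean_le; first exact: circle_contD cy (circle_contN cc0).
by move=> t ht; apply: ltW; exact: hy.
Qed.

(** The product filter of neighbourhoods of [p0] and of [+oo] lets a single compactness argument
    produce both the radius and the bound. *)
Lemma mean_tube (V : normedModType R[i]) (v : R[i] * V -> R[i]) r p0 :
  (forall t, 0 <= t <= 2 * pi -> \forall q \near (polar r t, p0), differentiable v q) ->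
  exists rho M : R, [/\ 0 < rho, 0 <= M & forall k, complex.Re `|k| < rho ->
    forall t, 0 <= t <= 2 * pi ->
      normc (v (polar r t, p0 + k)) <= M /\
      \forall q \near (polar r t, p0 + k), differentiable v q].
Proof.
move=> hv.
have : \forall pM \near (p0, +oo), forall t, 0 <= t <= 2 * pi ->
   normc (v (polar r t, pM.1)) <= pM.2 /\ \forall q \near (polar r t, pM.1), differentiable v q.
  apply: (@near_circle _ _ (filter_prod (nbhs p0) (pinfty_nbhs R)) _ (fun pM t =>
     normc (v (polar r t, pM.1)) <= pM.2 /\ \forall q \near (polar r t, pM.1), differentiable v q)) => t ht.
  have vc := differentiable_continuous (nbhs_singleton (hv t ht)).
  have /cvg_normcP /(_ 1 ltr01) vc1 := vc.
  have [] := filterI vc1 (near_join (hv t ht)).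
  move=> [A B] [/= hA hB] AB.
  exists ((polar r) @^-1` A, B `*` [set M | normc (v (polar r t, p0)) + 1 < M]) => /=.
    split; first exact: (@polarr_continuous R r t _ hA).
    exists (B, [set M | normc (v (polar r t, p0)) + 1 < M]) => //=.
    by split => //; exact: nbhs_pinfty_gt (num_real _).
  move=> [t' [p M]] /= [At' [Bp HM]].
  have [/= h1 h2] := AB (polar r t', p) (conj At' Bp).
  split=> //.
  rewrite -[v (polar r t', p)](subrK (v (polar r t, p0))).
  apply: le_trans (le_normcD _ _) _; rewrite addrC ltW//; apply: le_lt_trans HM.
  by rewrite lerD2l ltW.
move=> [[A B] [/= hA hB] AB].
have /nbhs_Re_normP[rho rho0 hrho] := hA.
have [M [M0 BM]] : exists M, 0 <= M /\ B M.
  have /filter_ex [M [h1 h2]] : \forall M \near +oo, 0 <= M /\ B M.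
    by apply: filterI => //; exact: nbhs_pinfty_ge (num_real _).
  by exists M.
exists rho, M; split=> // k kr t ht.
by apply: (AB (p0 + k, M)) => //; split => //=; exact: hrho.
Qed.

Lemma quadratic_derivative (h : R[i] -> R[i]) (c : R[i]) (d K : R) : 0 < d -> 0 <= K ->
  (forall s : R[i], normc s <= d -> normc (h s - h 0 - s * c) <= K * normc s ^+ 2) ->
  (s^-1 * (h s - h 0)) @[s --> 0^'] --> c.
Proof.
move=> d0 K0 H; apply/cvg_normcP => e e0; rewrite /dnbhs /within /=.
have d'0 : 0 < Num.min d (e / (K + 1)) by rewrite lt_min d0 divr_gt0// ltr_wpDl.
apply/nbhs_normcP; exists (Num.min d (e / (K + 1))) => // s.
rewrite subr0 lt_min => /andP[s1 s2] s0.
have n0 := normc_gt0 s0.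
have -> : s^-1 * (h s - h 0) - c = (h s - h 0 - s * c) / s.
  by rewrite [RHS]mulrBl [s * c]mulrC mulfK// [s^-1 * _]mulrC.
rewrite normcM normcV ltr_pdivrMr//.
apply: le_lt_trans (H s (ltW s1)) _; rewrite expr2 mulrA ltr_pM2r//.
move: s2; rewrite ltr_pdivlMr ?ltr_wpDl// => s2.
by apply: le_lt_trans s2; rewrite mulrC ler_pM2l// lerDl.
Qed.

Lemma norm_scaleE (V : normedModType R[i]) (s : R[i]) (k : V) :
  complex.Re `|s *: k| = normc s * complex.Re `|k|.
Proof.
by apply: (@complexI R); rewrite -norm_ReE normrZ {1}[`|k|]norm_ReE -rmorphM.
Qed.

Lemma differentiable_line (V : normedModType R[i]) (p k : V) (s : R[i]) :
  differentiable (fun s : R[i] => p + s *: k) s.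
Proof.
apply: differentiableD; first exact: differentiable_cst.
by apply: differentiableZl.
Qed.

Lemma pair_affine (V : normedModType R[i]) (z s : R[i]) (p k : V) :
  (z, p + s *: k) = s *: ((0, k) : R[i] * V) + (z, p).
Proof.
apply/pair_equal_spec; split => /=; last by rewrite addrC.
by rewrite /GRing.scale /= mulr0 add0r.
Qed.

Let radius_eq1 (rho x M : R) : 0 < rho -> 0 < x ->
  8 * M / rho * x = 2 * (2 * (M / (rho / 2 / x))).
Proof. by move=> r0 x0; field; rewrite !gt_eqF. Qed.

Let radius_eq2 (rho x M : R) : 0 < rho -> 0 < x ->
  32 * M / rho ^+ 2 * x ^+ 2 = 2 * (4 * M * (1 / (rho / 2 / x)) ^+ 2).
Proof. by move=> r0 x0; field; rewrite !gt_eqF. Qed.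

Let radius_ge (rho x : R) : 0 < x -> x < rho / 4 -> 1 <= rho / 2 / x / 2.
Proof. by move=> x0 xr; rewrite ler_pdivlMr// ler_pdivlMr//; lra. Qed.

(** The candidate derivative [T] is the mean of the partial differentials. In place of
    differentiation under the integral, the remainder is controlled for each direction k by Cauchy
    estimates on the complex line through [p0] along k, uniformly on the circle. *)
Lemma differentiable_mean (V : normedModType R[i]) (v : R[i] * V -> R[i]) r p0 :
  (forall t, 0 <= t <= 2 * pi -> \forall q \near (polar r t, p0), differentiable v q) ->
  differentiable (fun p => mean r (fun z => v (z, p))) p0.
Proof.
move=> hv; have [rho [M [rho0 M0 tube]]] := mean_tube hv.
pose nv (k : V) := complex.Re `|k|.
have nv0 k : 0 <= nv k by exact: Re_norm_ge0.
(* For |s| <= [sg k] the point [p0 + s *: k] stays in the tube. For k = 0 the convention on division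
   gives radius 0 and [G k] = 0, which is the correct differential. *)
pose sg k := rho / 2 / nv k.
pose G k z := mean (sg k) (fun s : R[i] => v (z, p0 + s *: k) / s).
pose T k := mean r (fun z => 'd v (z, p0) (0, k)).
have rho20 : 0 < rho / 2 by rewrite divr_gt0.
have sg0 k : 0 < nv k -> 0 < sg k by move=> k0; rewrite divr_gt0.
have inside k s : normc s <= sg k -> nv (s *: k) < rho.
  rewrite /nv norm_scaleE -/(nv k) => h.
  apply: (@le_lt_trans _ _ (rho / 2)); last by lra.
  have := nv0 k; rewrite le_eqVlt => /predU1P[<-|k0]; first by rewrite mulr0 ltW.
  by rewrite -ler_pdivlMr.
have hd k t : 0 <= t <= 2 * pi -> forall s, normc s <= sg k ->
    derivable (fun s : R[i] => v (polar r t, p0 + s *: k)) s 1.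
  move=> ht s hs; apply/derivable1_diffP.
  have [_ /nbhs_singleton vd] := tube _ (inside k s hs) t ht.
  apply: (@differentiable_comp _ _ _ _ (fun s : R[i] => (polar r t, p0 + s *: k)) v) => //.
have nvr k u : 0 < nv k -> nv (polar (sg k) u *: k) < rho.
  by move=> k0; apply: inside; rewrite (normc_polar _ (ltW (sg0 k k0))).
have hM k t : 0 < nv k -> 0 <= t <= 2 * pi -> forall u, 0 <= u <= 2 * pi ->
    normc (v (polar r t, p0 + polar (sg k) u *: k)) <= M.
  move=> k0 ht u hu; by have [h _] := tube _ (nvr k u k0) t ht.
have nvP k : nv k = 0 -> k = 0.
  by move=> h; apply/eqP; rewrite -normr_eq0 norm_ReE -/(nv k) h.
have second k t s : 0 < nv k -> 0 <= t <= 2 * pi -> normc s <= sg k / 2 ->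
    normc (v (polar r t, p0 + s *: k) - v (polar r t, p0) - s * G k (polar r t)) <=
      4 * M * (normc s / sg k) ^+ 2.
  move=> k0 ht hs.
  have := second_order_bound (sg0 k k0) (hd k t ht) (hM k t k0 ht) hs.
  by rewrite scale0r addr0.
(* Writing the differential as a Cauchy integral makes its continuity along the circle provable,
   which additivity of the means needs. *)
have dG k t : 0 <= t <= 2 * pi -> 'd v (polar r t, p0) (0, k) = G k (polar r t).
  move=> ht; have := nv0 k; rewrite le_eqVlt => /predU1P[/esym k0|k0].
    rewrite /G /sg k0 invr0 mulr0 mean0 invr0 mulr0 (nvP k k0).
    exact: (linear0 ('d v (polar r t, p0))).
  have vd : differentiable v (polar r t, p0) by exact: nbhs_singleton (hv t ht).
  rewrite -(deriveE (0, k) vd); apply: (cvg_lim (@norm_hausdorff _ _)).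
  have d0 : 0 < sg k / 2 by rewrite divr_gt0// sg0.
  have K0 : 0 <= 4 * M / sg k ^+ 2 by apply: divr_ge0; [exact: mulr_ge0|exact: sqr_ge0].
  have := @quadratic_derivative (fun s : R[i] => v (polar r t, p0 + s *: k)) (G k (polar r t)) _ _ d0 K0.
  have hq s : normc s <= sg k / 2 ->
      normc (v (polar r t, p0 + s *: k) - v (polar r t, p0 + 0 *: k) - s * G k (polar r t)) <=
      4 * M / sg k ^+ 2 * normc s ^+ 2.
    move=> hs; rewrite scale0r addr0; apply: le_trans (second k t s k0 ht hs) _.
    by rewrite expr_div_n mulrA mulrAC.
  move=> /(_ hq).
  rewrite scale0r addr0; under eq_fun do rewrite pair_affine.
  by [].
have Gc k : circle_cont r (G k).
  have := nv0 k; rewrite le_eqVlt => /predU1P[/esym k0|k0] t ht.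
    have -> : G k = fun=> 0 by apply/funext => z; rewrite /G /sg k0 invr0 mulr0 mean0 invr0 mulr0.
    exact: cont_cst.
  pose w (q : R[i] * R[i]) := v (q.2, p0 + q.1 *: k) / q.1.
  suff hw : forall u, 0 <= u <= 2 * pi ->
      \forall q \near (polar (sg k) u, polar r t), {for q, continuous w}.
    by case: (mean_param_cont hw).
  move=> u hu; rewrite /w.
  have [_ H] := tube _ (nvr k u k0) t ht.
  have lc q : {for q, continuous (fun q : R[i] * R[i] => (q.2, p0 + q.1 *: k))}.
    apply: (@cont_pair _ _ _ snd (fun q : R[i] * R[i] => p0 + q.1 *: k)).
      by case: q => a b; exact: cvg_snd.
    apply: (@continuous_comp _ _ _ fst (fun s : R[i] => p0 + s *: k)).
      by case: q => a b; exact: cvg_fst.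
    apply: differentiable_continuous; exact: differentiable_line.
  have N0 : \forall q \near (polar (sg k) u, polar r t), q.1 != 0 :> R[i].
    have pos : polar (sg k) u != 0 := polar_neq0 u (sg0 k k0).
    have /cvg_fst : \forall s \near polar (sg k) u, s != 0 :> R[i].
      apply/nbhs_normcP; exists (normc (polar (sg k) u)); first exact: normc_gt0.
      by move=> s; apply: contraTneq => ->; rewrite sub0r normcN ltxx.
    exact.
  have H1 : \forall q \near (polar (sg k) u, polar r t), differentiable v (q.2, p0 + q.1 *: k).
    exact: (lc (polar (sg k) u, polar r t) _ H).
  apply: filterS2 N0 H1 => q q0 vq.
  apply: contM.
    exact: (continuous_comp (lc q) (differentiable_continuous vq)).
  apply: (@continuous_comp _ _ _ fst (fun s : R[i] => s^-1)).
    by case: q {q0 vq} => a b; exact: cvg_fst.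
  exact: (derivable_cont (derivable_invC q0)).
have Tlin : forall (a : R[i]) k l, T (a *: k + l) = a * T k + T l.
  move=> a k l.
  have E k' : T k' = mean r (G k') by apply: eq_mean => t ht; exact: dG.
  rewrite !E -(meanZ a (Gc k)) -(meanD (circle_contM (@circle_cont_cst R r a) (Gc k)) (Gc l)).
  apply: eq_mean => t ht; rewrite -!dG//.
  by rewrite [a *: k + l]addrC pair_affine linearP.
have TG k : T k = mean r (G k) by apply: eq_mean => t ht; exact: dG.
have Tb k : normc (T k) <= 8 * M / rho * nv k.
  have := nv0 k; rewrite le_eqVlt => /predU1P[/esym k0|k0].
    rewrite TG (_ : G k = fun=> 0) ?mean_cst ?normc0 ?k0 ?mulr0//.
    by apply/funext => z; rewrite /G /sg k0 invr0 mulr0 mean0 invr0 mulr0.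
  rewrite TG; have -> : 8 * M / rho * nv k = 2 * (2 * (M / sg k)).
    exact: radius_eq1.
  apply: normc_mean_le; first exact: Gc.
  move=> t ht; apply: normc_mean_le.
    move=> u hu; apply: contM.
      by apply: derivable_cont; apply: hd => //; rewrite (normc_polar _ (ltW (sg0 k k0))).
    by apply: derivable_cont; apply: derivable_invC; exact: polar_neq0 (sg0 k k0).
  move=> u hu; rewrite normcM normcV (normc_polar _ (ltW (sg0 k k0))).
  by rewrite ler_pM2r ?invr_gt0 ?sg0// hM.
have vc k : nv k < rho -> circle_cont r (fun z => v (z, p0 + k)).
  move=> kr t ht; have [_ /nbhs_singleton/differentiable_continuous vd] := tube k kr t ht.
  apply: (@continuous_comp _ _ _ (fun z => (z, p0 + k)) v (polar r t)) => //.
  exact: cont_pairl.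
have p00 : circle_cont r (fun z => v (z, p0)).
  by have := vc 0; rewrite addr0; apply; rewrite /nv normr0.
pose T' : {linear V -> R[i]} := HB.pack T (GRing.isLinear.Build _ _ _ _ T Tlin).
apply: (@differentiable_of_bound V _ p0 T' (8 * M / rho) (32 * M / rho ^+ 2) (rho / 4)).
- by rewrite divr_gt0.
- by rewrite divr_ge0 ?mulr_ge0// ltW.
- by apply: divr_ge0; [exact: mulr_ge0|exact: sqr_ge0].
- exact: Tb.
move=> k; rewrite -/(nv k) => kr.
have := nv0 k; rewrite le_eqVlt => /predU1P[/esym k0|k0].
  by rewrite (nvP k k0) addr0 subrr sub0r linear0 oppr0 normc0; apply: mulr_ge0; [apply: divr_ge0; [exact: mulr_ge0|exact: sqr_ge0]|exact: sqr_ge0].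
have kc : circle_cont r (fun z => v (z, p0 + k)).
  by apply: vc; apply: lt_trans kr _; lra.
rewrite [T' k]TG -(meanB kc p00) -(meanB (circle_contD kc (circle_contN p00)) (Gc k)).
have -> : 32 * M / rho ^+ 2 * nv k ^+ 2 = 2 * (4 * M * (1 / sg k) ^+ 2).
  exact: radius_eq2.
apply: normc_mean_le.
  exact: (circle_contD (circle_contD kc (circle_contN p00)) (circle_contN (Gc k))).
(* The increment k itself is s = 1, which lies in half the disc of radius [sg k] because |k| < rho /
   4. *)
move=> t ht; have := second k t 1 k0 ht; rewrite scale1r mul1r normc1; apply.
exact: radius_ge.
Qed.

End DifferentiableMean.

(** * The identity principle along a segment *)

Section IdentityPrinciple.
Variable R : realType.

(** Take the supremum of the points where [P] holds. [P] passes between any two points near it, so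
    from a point just below to the supremum and beyond. *)
Lemma segment_induction (P : R -> Prop) (a b : R) : a <= b ->
  (forall t, a <= t <= b -> exists2 e, 0 < e & forall x y, a <= x <= b -> a <= y <= b ->
    `|x - t| < e -> `|y - t| < e -> P x -> P y) ->
  P a -> P b.
Proof.
move=> ab HP Pa.
pose S := [set x : R | a <= x <= b /\ P x].
have hs : has_sup S.
  split; first by exists a; split; rewrite ?lexx.
  by exists b => x [/andP[]].
have as_ : a <= sup S by apply: ub_le_sup; [case: hs|split; rewrite ?lexx].
have sb : sup S <= b by apply: sup_le_ub; [case: hs|move=> x [/andP[]]].
have [e e0 He] : exists2 e, 0 < e & forall x y, a <= x <= b -> a <= y <= b ->
    `|x - sup S| < e -> `|y - sup S| < e -> P x -> P y by apply: HP; rewrite as_ sb.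
have [x [xab Px] xs] := sup_adherent e0 hs.
have xS : x <= sup S by apply: ub_le_sup; [case: hs|split].
have near_sup y : a <= y <= b -> `|y - sup S| < e -> P y.
  move=> yab ye; apply: He Px => //; rewrite ltr_norml; apply/andP; split; lra.
have [//|bs] := leP b (sup S).
  by move=> bs; apply: near_sup; rewrite ?ab ?lexx// (_ : sup S = b) ?subrr ?normr0//; apply/eqP; rewrite eq_le sb.
pose y := Num.min b (sup S + e / 2).
have ys : sup S < y by rewrite lt_min bs ltrDl divr_gt0.
have yb : y <= b by rewrite ge_min lexx.
have ye : y <= sup S + e / 2 by rewrite ge_min lexx orbT.
have yab : a <= y <= b by rewrite yb andbT (le_trans as_ (ltW ys)).
have Py : P y by apply: near_sup => //; rewrite ltr_norml; apply/andP; split; lra.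
have : y <= sup S by apply: ub_le_sup; [case: hs|split].
by rewrite leNgt ys.
Qed.

(** The property propagated along [0, 1] is vanishing on a complex neighbourhood, which passes from
    disc to disc. *)
Lemma identity_segment (h : R[i] -> R[i]) :
  (forall x : R, 0 <= x <= 1 -> \forall z \near x%:C, derivable h z 1) ->
  (\forall z \near 0, h z = 0) -> h 1 = 0.
Proof.
move=> hd h0.
suff H : \forall z \near (1 : R)%:C, h z = 0 by exact: (nbhs_singleton H).
apply: (@segment_induction (fun x => \forall z \near x%:C, h z = 0) 0 1) => //.
move=> t /hd /nbhs_normcP[d d0 hdt].
(* The disc of radius d / 2 about x stays within d of t, while every point within d / 8 of y is
   within 3 d / 8 of x. *)
exists (d / 8); first by rewrite divr_gt0.
move=> x y _ _ xt yt Px.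
pose g z := h (x%:C + z).
have xtC : normc (x%:C - t%:C) < d / 8 by rewrite -rmorphB normc_real.
have ytC : normc (y%:C - t%:C) < d / 8 by rewrite -rmorphB normc_real.
have d2 : 0 < d / 2 by rewrite divr_gt0.
have gd z : normc z <= d / 2 -> derivable g z 1.
  move=> zd; apply/derivable1_diffP.
  apply: (@differentiable_comp _ _ _ _ (fun z => x%:C + z) h).
    by apply: differentiableD => //; exact: differentiable_cst.
  apply/derivable1_diffP; apply: hdt; rewrite addrAC.
  apply: le_lt_trans (le_normcD _ _) _; lra.
have g0 : \forall z \near 0, g z = 0.
  have [e e0 he] := (nbhs_normcP _ _).1 Px.
  by apply/nbhs_normcP; exists e => // z; rewrite subr0 => ze; apply: he; rewrite addrAC subrr add0r.
apply/nbhs_normcP; exists (d / 8) => [|z zy]; first by rewrite divr_gt0.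
rewrite -[z](subrK x%:C) addrC; apply: (zero_near_zero_disc d2 gd g0).
have -> : z - x%:C = (z - y%:C) + (y%:C - t%:C) - (x%:C - t%:C) by ring.
apply: le_lt_trans (le_normcD _ _) _; rewrite normcN.
apply: le_lt_trans (lerD (le_normcD _ _) (lexx _)) _; lra.
Qed.

Lemma differentiable_mean_near (V : normedModType R[i]) (v : R[i] * V -> R[i]) r (p0 : V) :
  (forall t, 0 <= t <= 2 * pi -> \forall q \near (polar r t, p0), differentiable v q) ->
  \forall p \near p0, differentiable (fun p' : V => mean r (fun z => v (z, p'))) p.
Proof.
move=> hv; have [rho [M [rho0 M0 tube]]] := mean_tube hv.
apply/nbhs_Re_normP; exists rho => // k kr; apply: differentiable_mean => t ht.
by have [] := tube k kr t ht.
Qed.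

End IdentityPrinciple.

(** * Fejer means *)

Section Fejer.
Variable R : realType.
Implicit Types (h : R[i] -> R[i]) (i l n N : nat) (r t x : R).

Lemma cRe_real x (z : R[i]) : complex.Re (x%:C * z) = x * complex.Re z.
Proof. by case: z => a b /=; rewrite mul0r subr0. Qed.

(** Domination by an integrable majorant instead of a supremum: it lets the total mass 1 of the
    Fejer kernel be exploited. *)
Lemma normc_mean_le_Re r h g : circle_cont r h -> circle_cont r g ->
  (forall t, 0 <= t <= 2 * pi -> normc (h (polar r t)) <= complex.Re (g (polar r t))) ->
  normc (mean r h) <= 2 * complex.Re (mean r g).
Proof.
move=> /circle_ccont hc /circle_ccont gc hg.
rewrite !meanE normcM normc_real.
have i0 : 0 <= (2 * pi)^-1 :> R by rewrite invr_ge0 ltW// twopi_gt0.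
rewrite (ger0_norm i0) cRe_real mulrCA; apply: ler_wpM2l => //.
apply: le_trans (normc_le_ReIm _) _; rewrite /Cintegral /= [leRHS]mulr_natl [leRHS]mulr2n.
have bnd (f : R -> R) :
    lebesgue_measure.-integrable `[0, 2 * pi] (EFin \o f) ->
    (forall t, 0 <= t <= 2 * pi -> `|f t| <= normc (h (polar r t))) ->
    `|\int[lebesgue_measure]_(t in `[0, 2 * pi]) f t| <=
    \int[lebesgue_measure]_(t in `[0, 2 * pi]) complex.Re (g (polar r t)).
  move=> fi fM; apply: le_trans (le_normr_Rintegral _ fi) _ => //.
  apply: le_Rintegral => //.
  - exact: (integrable_abse fi).
  - exact: integrable_Re gc.
  - by move=> t; rewrite /= in_itv /= => ht; apply: le_trans (fM t ht) (hg t ht).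
by apply: lerD; apply: bnd; [exact: (integrable_Re hc)|move=> t _; exact: Re_le_normc
  |exact: (integrable_Im hc)|move=> t _; exact: Im_le_normc].
Qed.

Lemma circle_cont_sum r (I : Type) (s : seq I) (f : I -> R[i] -> R[i]) :
  (forall j : I, circle_cont r (f j)) -> circle_cont r (fun z => \sum_(k <- s) f k z).
Proof.
move=> fc; elim: s => [|j s IH].
  have -> : (fun z => \sum_(k <- [::]) f k z) = (fun=> 0) by apply/funext => z; rewrite big_nil.
  exact: circle_cont_cst.
have -> : (fun z => \sum_(k <- j :: s) f k z) = (fun z => f j z + \sum_(k <- s) f k z).
  by apply/funext => z; rewrite big_cons.
exact: circle_contD (fc j) IH.
Qed.

Lemma mean_sum r (I : Type) (s : seq I) (f : I -> R[i] -> R[i]) :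
  (forall j : I, circle_cont r (f j)) ->
  mean r (fun z => \sum_(k <- s) f k z) = \sum_(k <- s) mean r (f k).
Proof.
move=> fc; elim: s => [|j s IH].
  have -> : (fun z => \sum_(k <- [::]) f k z) = (fun=> 0) by apply/funext => z; rewrite big_nil.
  by rewrite mean_cst big_nil.
have -> : (fun z => \sum_(k <- j :: s) f k z) = (fun z => f j z + \sum_(k <- s) f k z).
  by apply/funext => z; rewrite big_cons.
by rewrite (meanD (fc j) (circle_cont_sum (s := s) fc)) IH big_cons.
Qed.

(** The Laurent monomial z^(i - l), with natural exponents so that i and l can run over the double
    sum of the Fejer kernel. *)
Definition monom i l (z : R[i]) := z ^+ i / z ^+ l.

Lemma monom_derivable i l (z : R[i]) : z != 0 -> derivable (monom i l) z 1.
Proof.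
move=> z0.
apply: derivable_mulC; first exact: derivable_pow.
by apply: derivableV; [rewrite expf_neq0|exact: derivable_pow].
Qed.

Lemma monom_circle_cont r i l : 0 < r -> circle_cont r (monom i l).
Proof. by move=> r0 t _; apply: derivable_cont; apply: monom_derivable; exact: polar_neq0. Qed.

Lemma monom_expi i l t : monom i l (expi t) = expi ((i%:R - l%:R) * t).
Proof. by rewrite /monom -!expiM_nat -expiN -expiD -mulrBl. Qed.

Lemma normc_monom_expi i l t : normc (monom i l (expi t)) = 1.
Proof. by rewrite monom_expi normc_expi. Qed.

Lemma mean_monom i l : mean 1 (monom i l) = (i == l)%:R.
Proof.
have [->|il] := eqVneq i l.
  rewrite -[RHS](mean_cst 1); apply: eq_mean => t _.
  by rewrite /monom mulfV// expf_neq0// polar_neq0.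
have k0 : (i%:R - l%:R : R) != 0 by rewrite subr_eq0 eqr_nat.
have := Cintegral_expi (i%:R - l%:R) (ltW (twopi_gt0 R)).
have -> : expi ((i%:R - l%:R) * (2 * pi)) = expi ((i%:R - l%:R) * 0) :> R[i].
  by rewrite -!monom_expi expi2pi expi0.
rewrite subrr CintegralZ; last by move=> t _; exact: expiZ_continuous.
have c0 : 'i * (i%:R - l%:R : R)%:C != 0 :> R[i].
  apply: mulf_neq0; last by rewrite (inj_eq (@complexI R)).
  by apply/eqP => /(congr1 (@normc R)) /eqP; rewrite normc_imaginary_unit normc0 oner_eq0.
move=> /eqP; rewrite mulf_eq0 (negbTE c0) /= => /eqP H.
rewrite meanE -[RHS](mulr0 ((2 * pi)^-1)%:C) -H; congr (_ * _).
by apply: eq_Cintegral => t _; rewrite polar1 monom_expi.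
Qed.

(** The sum of (w / z)^(i - l) over all pairs: the usual weights 1 - |k| / N arise by counting the
    pairs with i - l = k, and the double sum factors as a square on the unit circle. *)
Definition fejer_kernel N (w z : R[i]) : R[i] :=
  N%:R^-1 * \sum_(i < N) \sum_(l < N) monom l i z * monom i l w.

Lemma fejer_kernel_cont N w : circle_cont 1 (fejer_kernel N w).
Proof.
apply: circle_contM; first exact: circle_cont_cst.
apply: circle_cont_sum => i; apply: circle_cont_sum => l.
apply: circle_contM; [exact: monom_circle_cont|exact: circle_cont_cst].
Qed.

Lemma mean_fejer_kernel N t : (0 < N)%N -> mean 1 (fejer_kernel N (expi t)) = 1.
Proof.
move=> N0; rewrite /fejer_kernel.
have c i l : circle_cont 1 (fun z => monom l i z * monom i l (expi t)).
  apply: circle_contM; [exact: monom_circle_cont|exact: circle_cont_cst].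
rewrite meanZ; last by apply: circle_cont_sum => i; apply: circle_cont_sum => l; exact: c.
rewrite mean_sum; last by move=> i; apply: circle_cont_sum => l; exact: c.
under eq_bigr => i _.
  rewrite mean_sum; last by move=> l; exact: c.
  under eq_bigr => l _.
    have -> : mean 1 (fun z => monom l i z * monom i l (expi t)) = (i == l)%:R.
      under [fun z => _]eq_fun do rewrite mulrC.
      rewrite meanZ; last exact: monom_circle_cont.
      rewrite mean_monom; have [<-|il] := eqVneq i l; last first.
        by rewrite eq_sym (negbTE (il : (i : nat) != l)) mulr0.
      by rewrite eqxx mulr1 /monom mulfV// expf_neq0// expi_neq0.
    over.
  rewrite (bigD1 i)//= eqxx big1 ?addr0; last by move=> l; rewrite eq_sym => /negbTE ->.
  over.
by rewrite sumr_const card_ord -mulr_natl mulr1 mulVf// pnatr_eq0 -lt0n.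
Qed.

(** On the unit circle the inverse is the conjugate, so the double sum is a geometric sum times its
    conjugate. *)
Lemma fejer_kernelE N s t : fejer_kernel N (expi t) (expi s) =
  ((N%:R)^-1 * normc (\sum_(i < N) expi (t - s) ^+ i) ^+ 2)%:C.
Proof.
rewrite /fejer_kernel rmorphM fmorphV rmorph_nat; congr (_ * _).
set q := expi (t - s).
have qV : q^-1 = Num.conj q.
  by rewrite invC_norm (_ : `|q| = (normc q)%:C)// normc_expi rmorph1 expr1n invr1 mul1r.
rewrite [RHS](_ : _ = `|\sum_(i < N) q ^+ i| ^+ 2); last by rewrite rmorphXn.
rewrite normCK rmorph_sum mulr_suml; apply: eq_bigr => i _.
rewrite mulr_sumr; apply: eq_bigr => l _.
have cX : Num.conj (q ^+ l) = q^-1 ^+ l by rewrite qV rmorphXn.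
rewrite [X in _ = _ * X]cX !monom_expi /q -expiN -!expiM_nat -!expiD; congr expi.
by ring.
Qed.

Lemma fejer_kernel_Re_ge0 N s t : 0 <= complex.Re (fejer_kernel N (expi t) (expi s)).
Proof. by rewrite fejer_kernelE /= mulr_ge0 ?invr_ge0 ?ler0n ?sqr_ge0. Qed.

Lemma normc_fejer_kernel N s t :
  normc (fejer_kernel N (expi t) (expi s)) = complex.Re (fejer_kernel N (expi t) (expi s)).
Proof. by rewrite fejer_kernelE normc_real ger0_norm//= mulr_ge0 ?invr_ge0 ?ler0n ?sqr_ge0. Qed.

(* [(q - 1) (1 + q + ... + q^(N-1)) = q^N - 1] has modulus at most 2. *)
Lemma fejer_kernel_concentrated N s t :
  complex.Re (fejer_kernel N (expi t) (expi s)) * normc (expi s - expi t) ^+ 2 <= 4 / N%:R.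
Proof.
have ReC (x : R) : complex.Re x%:C = x by [].
rewrite fejer_kernelE ReC; set q := expi (t - s); set S := \sum_(i < N) _.
have -> : normc (expi s - expi t) = normc (q - 1).
  by rewrite normcB -[RHS]mul1r -(normc_expi s) -normcM mulrBr mulr1 /q -expiD subrKC.
rewrite -mulrA -exprMn [normc S * _]mulrC -normcM -subrX1 [leRHS]mulrC.
rewrite ler_wpM2l ?invr_ge0 ?ler0n//.
have -> : 4 = 2 ^+ 2 :> R by rewrite -natrX.
rewrite ler_sqr ?nnegrE ?normc_ge0//.
apply: le_trans (le_normcD _ _) _; rewrite normcN normc1 normcX normc_expi expr1n.
by lra.
Qed.

Lemma circle_uniform_cont h (e : R) : circle_cont 1 h -> 0 < e ->
  exists2 d, 0 < d & forall t, 0 <= t <= 2 * pi -> forall z,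
    normc (z - expi t) < d -> normc (h z - h (expi t)) < e.
Proof.
move=> hc e0; have e20 : 0 < e / 2 by rewrite divr_gt0.
have : \forall d \near 0^'+, forall t, 0 <= t <= 2 * pi -> forall z,
    normc (z - expi t) < d -> normc (h z - h (expi t)) < e.
  apply: (@near_circle _ _ (0^'+) _ (fun d t => forall z,
    normc (z - expi t) < d -> normc (h z - h (expi t)) < e)) => t ht.
  have /cvg_normcP /(_ _ e20) /nbhs_normcP[d d0 hd] := hc t ht.
  rewrite polar1 in hd.
  have d20 : 0 < d / 2 by rewrite divr_gt0.
  have H1 : \forall s \near t, normc (expi s - expi t) < d / 2.
    have H0 : expi s @[s --> t] --> expi t := @expi_continuous R t.
    by have /cvg_normcP /(_ _ d20) := H0.
  exists ([set s | normc (expi s - expi t) < d / 2], [set x | x < d / 2]) => /=.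
    split; first exact: H1.
    exact: nbhs_right_lt.
  move=> [s x] /= [h1 h2] z zs.
  have -> : h z - h (expi s) = (h z - h (expi t)) - (h (expi s) - h (expi t)).
    by rewrite opprB addrA subrK.
  apply: le_lt_trans (le_normcD _ _) _; rewrite normcN [e](splitr e); apply: ltrD.
    apply: hd; rewrite -[z - expi t](subrKA (expi s)).
    by apply: le_lt_trans (le_normcD _ _) _; rewrite [d](splitr d); apply: ltrD => //; exact: lt_trans zs h2.
  by apply: hd; apply: lt_trans h1 _; lra.
have : \forall d \near 0^'+, (0 : R) < d by exact: nbhs_right_gt.
move=> H1 H2; have [d [d0 hd]] := @filter_ex _ _ _ _ (@filterI _ _ _ _ _ H1 H2).
by exists d.
Qed.

Definition fejer_sum N h (w : R[i]) : R[i] :=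
  N%:R^-1 * \sum_(i < N) \sum_(l < N) mean 1 (fun z => h z * monom l i z) * monom i l w.

Lemma fejer_sumE N h w : circle_cont 1 h ->
  fejer_sum N h w = mean 1 (fun z => h z * fejer_kernel N w z).
Proof.
move=> hc; rewrite /fejer_sum /fejer_kernel.
have c0 i l : circle_cont 1 (fun z => h z * monom l i z).
  apply: circle_contM; [exact: hc|exact: monom_circle_cont].
have c i l : circle_cont 1 (fun z => monom i l w * (h z * monom l i z)).
  apply: circle_contM; [exact: circle_cont_cst|exact: c0].
transitivity (mean 1 (fun z => N%:R^-1 * \sum_(i < N) \sum_(l < N) monom i l w * (h z * monom l i z))).
  rewrite meanZ; last by apply: circle_cont_sum => i; apply: circle_cont_sum => l; exact: c.
  congr (_ * _); rewrite mean_sum; last by move=> i; apply: circle_cont_sum => l; exact: c.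
  apply: eq_bigr => i _; rewrite mean_sum; last by move=> l; exact: c.
  by apply: eq_bigr => l _; rewrite (meanZ _ (c0 i l)) mulrC.
apply: eq_mean => t _; rewrite [RHS]mulrCA; congr (_ * _).
rewrite mulr_sumr; apply: eq_bigr => i _; rewrite mulr_sumr; apply: eq_bigr => l _.
by rewrite mulrCA [monom i l w * _]mulrC.
Qed.

(** Here x is the oscillation of the function, k the kernel and y the distance to the point: for y <
    d the oscillation is small, otherwise the kernel is at most K / d^2. *)
Lemma fejer_bound (e M d K : R) (x y k : R) : 0 < d -> 0 <= M -> 0 <= k -> 0 <= e -> 0 <= y ->
  k * y ^+ 2 <= K -> (y < d -> x <= e) -> x <= M -> x * k <= e * k + M * K / d ^+ 2.
Proof.
move=> d0 M0 k0 e0 y0 kK xe xM.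
have K0 : 0 <= K by apply: le_trans kK; rewrite mulr_ge0// sqr_ge0.
have [yd|dy] := ltP y d.
  apply: (@le_trans _ _ (e * k)); first by rewrite ler_wpM2r// xe.
  by rewrite lerDl divr_ge0 ?sqr_ge0// mulr_ge0.
apply: (@le_trans _ _ (M * K / d ^+ 2)); last by rewrite lerDr mulr_ge0.
rewrite ler_pdivlMr ?exprn_gt0//.
apply: (@le_trans _ _ (M * (k * y ^+ 2))); last by rewrite ler_wpM2l.
rewrite -mulrA; apply: (@le_trans _ _ (M * (k * d ^+ 2))); first by rewrite ler_wpM2r// mulr_ge0// sqr_ge0.
rewrite ler_wpM2l// ler_wpM2l// ler_sqr ?nnegrE//; exact: ltW.
Qed.

Lemma fejer_approx h (e : R) : circle_cont 1 h -> 0 < e ->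
  exists N0 : nat, forall N, (N0 <= N)%N -> forall t, 0 <= t <= 2 * pi ->
    normc (fejer_sum N h (expi t) - h (expi t)) < e.
Proof.
move=> hc e0; have e40 : 0 < e / 4 by rewrite divr_gt0.
have [d d0 hd] := circle_uniform_cont hc e40.
have [M hM] := circle_bounded hc.
have M0 : 0 <= M by apply: le_trans (hM 0 _); rewrite ?normc_ge0 ?lexx ?ltW ?twopi_gt0.
(* [B / N%:R] is the contribution far from the point: oscillation at most 2 M, kernel at most (4 /
   N) / d^2. For N > 4 B / e the total stays below 2 (e / 4 + e / 4). *)
pose B := 2 * M * 4 / d ^+ 2.
have B0 : 0 <= B by rewrite /B; apply: divr_ge0; [rewrite !mulr_ge0|exact: sqr_ge0].
exists (Num.truncn (4 * B / e)).+1 => N N1 t ht.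
have N0 : (0 < N)%N by exact: leq_ltn_trans N1.
have BN : 4 * B / e < N%:R.
  apply: lt_le_trans (truncnS_gt _) _; by rewrite ler_nat.
have kc := @fejer_kernel_cont N (expi t).
have c1 := circle_contM hc kc.
have c2 := circle_contM (@circle_cont_cst R 1 (h (expi t))) kc.
have -> : fejer_sum N h (expi t) - h (expi t) =
    mean 1 (fun z => (h z - h (expi t)) * fejer_kernel N (expi t) z).
  rewrite (fejer_sumE _ _ hc) -[X in _ - X]mulr1 -(mean_fejer_kernel t N0) -(meanZ _ kc) -(meanB c1 c2).
  by apply: eq_mean => s _; rewrite mulrBl.
pose g z := (e / 4)%:C * fejer_kernel N (expi t) z + (B / N%:R)%:C.
have gc : circle_cont 1 g.
  exact: (circle_contD (circle_contM (@circle_cont_cst R 1 _) kc) (@circle_cont_cst R 1 _)).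
have := @normc_mean_le_Re 1 _ g (circle_contM (circle_contD hc (circle_contN (@circle_cont_cst R 1 (h (expi t))))) kc) gc.
have -> : mean 1 g = (e / 4 + B / N%:R)%:C.
  rewrite /g (meanD (circle_contM (@circle_cont_cst R 1 _) kc) (@circle_cont_cst R 1 _)).
  by rewrite (meanZ _ kc) (mean_fejer_kernel t N0) mulr1 mean_cst rmorphD.
move=> H; apply: le_lt_trans (H _) _.
  move=> s hs; rewrite polar1 normcM normc_fejer_kernel /g cReD cRe_real.
  have M20 : 0 <= 2 * M by rewrite mulr_ge0.
  have -> : B / N%:R = 2 * M * (4 / N%:R) / d ^+ 2 by rewrite /B; ring.
  apply: (fejer_bound d0 M20 (fejer_kernel_Re_ge0 N s t) (ltW e40) (normc_ge0 (expi s - expi t))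
    (fejer_kernel_concentrated N s t)).
    by move=> hst; apply: ltW; exact: hd.
  apply: le_trans (le_normcD _ _) _; rewrite normcN mulr_natl mulr2n.
  by apply: lerD; rewrite -polar1; exact: hM.
have ReC (x : R) : complex.Re x%:C = x by [].
rewrite ReC.
have : B / N%:R < e / 4.
  by rewrite ltr_pdivrMr ?ltr0n//; move: BN; rewrite ltr_pdivrMr//; lra.
by lra.
Qed.

End Fejer.

(** * Entrywise closeness and convexity in the polydisc *)

Section RowVectors.
Variables (R : realType) (m : nat).
Notation rV := ('rV[R[i]]_m).
Implicit Types (w : rV) (d e : R).

Definition close e w w' := forall j, normc (w ord0 j - w' ord0 j) < e.

Lemma nbhs_rowP w (A : set rV) :
  nbhs w A <-> exists2 d, 0 < d & forall w', close d w' w -> A w'.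
Proof.
split=> [/nbhs_ballP[[x y]]|[d d0 dA]].
  rewrite /= ltcE /= => /andP[/eqP -> x0] H; exists x => // w' ww; apply: H.
  split; first by rewrite (ltcR 0).
  by move=> i j; rewrite ord1 -ball_normE /= ltcR normcB; exact: ww.
apply/nbhs_ballP; exists d%:C; first by rewrite /= (ltcR 0).
move=> w' [_ ww]; apply: dA => j; have := ww ord0 j.
by rewrite -ball_normE /= normcB -ltcR.
Qed.

Lemma nbhs_close w e : 0 < e -> \forall w' \near w, close e w' w.
Proof. by move=> e0; apply/nbhs_rowP; exists e. Qed.

Lemma close_trans d e w w' w'' : close d w w' -> close e w' w'' -> close (d + e) w w''.
Proof.
move=> h1 h2 j; rewrite -(subrKA (w' ord0 j)).
by apply: le_lt_trans (le_normcD _ _) _; apply: ltrD; [exact: h1|exact: h2].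
Qed.

Lemma close_le d e w w' : d <= e -> close d w w' -> close e w w'.
Proof. by move=> de h j; apply: lt_le_trans (h j) de. Qed.

Lemma normc_convex (x : R) (a b c : R[i]) e : 0 <= x <= 1 ->
  normc (a - c) < e -> normc (b - c) < e -> normc (a + x%:C * (b - a) - c) < e.
Proof.
move=> /andP[x0 x1] ha hb.
have -> : a + x%:C * (b - a) - c = (1 - x)%:C * (a - c) + x%:C * (b - c).
  by rewrite rmorphB rmorph1; ring.
apply: le_lt_trans (le_normcD _ _) _; rewrite !normcM !normc_real.
rewrite (ger0_norm x0) ger0_norm ?subr_ge0//.
have := x0; rewrite le_eqVlt => /predU1P[<-|xp]; first by rewrite subr0 mul1r mul0r addr0.
have -> : e = (1 - x) * e + x * e by ring.
apply: ler_ltD; first by rewrite ler_wpM2l ?subr_ge0// ltW.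
by rewrite ltr_pM2l.
Qed.

Lemma polydiscE w : polydisc R m w <-> forall j, normc (w ord0 j) < 1.
Proof.
have E (z : R[i]) : (`|z| < 1) = (normc z < 1) by rewrite -(ltcR _ 1).
by split=> h j; have := h j; rewrite /open_disc /= E.
Qed.

(** Finitely many entries leave a positive gap between their maximal modulus and e. *)
Lemma row_ball_open e w : 0 < e -> (forall j, normc (w ord0 j) < e) ->
  \forall w' \near w, forall j, normc ((w' : rV) ord0 j) < e.
Proof.
move=> e0 h.
pose d := \big[Num.max/0]_j normc (w ord0 j).
have de : d < e by apply/bigmax_ltP; split => // j _; exact: h.
have hd j : normc (w ord0 j) <= d by apply: le_bigmax_cond.
apply/nbhs_rowP; exists (e - d) => [|w' ww j]; first by rewrite subr_gt0.
rewrite -(subrK (w ord0 j) (w' ord0 j)); apply: le_lt_trans (le_normcD _ _) _.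
by rewrite -(subrK d e); apply: ltr_leD; [exact: ww|exact: hd].
Qed.

Lemma polydisc_open w : polydisc R m w -> nbhs w (polydisc R m).
Proof. by move=> /polydiscE h; apply: filterS (row_ball_open ltr01 h) => w' /polydiscE. Qed.

Lemma close_open (T : topologicalType) (A B : T -> rV) (z : T) e : 0 < e ->
  {for z, continuous A} -> {for z, continuous B} -> close e (A z) (B z) ->
  \forall z' \near z, close e (A z') (B z').
Proof.
move=> e0 cA cB AB.
have cAB : (A z' - B z') @[z' --> z] --> A z - B z := cvgB cA cB.
have hAB j : normc ((A z - B z) ord0 j) < e by rewrite !mxE; exact: AB.
have H : \forall z' \near z, forall j, normc ((A z' - B z') ord0 j) < e.
  exact: (cAB _ _ (row_ball_open e0 hAB)).
by apply: filterS H => z' h j; have := h j; rewrite !mxE.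
Qed.

Lemma polydisc_convex w w' (x : R) : 0 <= x <= 1 -> polydisc R m w -> polydisc R m w' ->
  polydisc R m (w + x%:C *: (w' - w)).
Proof.
move=> hx /polydiscE h1 /polydiscE h2; apply/polydiscE => j.
have := @normc_convex x (w ord0 j) (w' ord0 j) 0 1 hx.
by rewrite !subr0 !mxE; apply; [exact: h1|exact: h2].
Qed.

Lemma close_convex w w' w0 (x : R) e : 0 <= x <= 1 -> close e w w0 -> close e w' w0 ->
  close e (w + x%:C *: (w' - w)) w0.
Proof.
by move=> hx h1 h2 j; rewrite !mxE; apply: normc_convex; [|exact: h1|exact: h2].
Qed.

End RowVectors.

(** * Laurent polynomials approximating [F] on a circle *)

Section FejerFamily.
Variables (R : realType) (m : nat) (F : R[i] -> 'rV[R[i]]_m).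
Hypothesis F_cont : continuous F.
Hypothesis F_coef : forall (j : 'I_m) (r : R), 0 < r <= 1 ->
  (\esum_(n in [set: int]) (normc (circle_coef F j n r) / r ^ n)%:E < 1)%E.

Lemma coord_cont j z : {for z, continuous (fun z => F z ord0 j)}.
Proof.
apply/(@cvg_normcP _ _ (nbhs z) _) => e e0.
have H : \forall w \near z, close e (F w) (F z) by exact: (F_cont (nbhs_close (F z) e0)).
by apply: filterS H => w /(_ j).
Qed.

Lemma dilate_cont r j z : {for z, continuous (fun z => F (r%:C * z) ord0 j)}.
Proof.
apply: (@continuous_comp _ _ _ (fun z => r%:C * z) (fun z => F z ord0 j)); last exact: coord_cont.
by apply: contM; [exact: cont_cst|exact: cvg_id].
Qed.

Lemma dilate_circle_cont r j : circle_cont 1 (fun z => F (r%:C * z) ord0 j).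
Proof. by move=> t _; exact: dilate_cont. Qed.

Lemma circle_coefE j (i l : nat) r :
  circle_coef F j (i%:Z - l%:Z) r = mean 1 (fun z => F (r%:C * z) ord0 j * monom l i z).
Proof.
rewrite /circle_coef /fourier_coef meanE; congr (_ * _).
apply: eq_Cintegral => t _; rewrite polar1 monom_expi; congr (_ * expi _).
by rewrite intrB -!pmulrn -mulNr opprB.
Qed.

(** For fixed i the indices i - l are distinct, so the left side is a finite part of the weighted
    sum of the hypothesis; s is that full sum. *)
Lemma coef_sum_le j r : 0 < r <= 1 -> exists2 s : R, s < 1 &
  forall i N, \sum_(l < N) normc (circle_coef F j (i%:Z - l%:Z) r) * (r ^+ l / r ^+ i) <= s.
Proof.
move=> hr; have r0 : 0 < r by case/andP: hr.
have rn n : 0 <= r ^ n :> R by rewrite exprz_ge0// ltW.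
pose a (n : int) := (normc (circle_coef F j n r) / r ^ n)%:E.
have a0 n : (0 <= a n)%E by rewrite lee_fin divr_ge0 ?normc_ge0.
have := F_coef j hr; rewrite -/(\esum_(n in [set: int]) a n) => S1.
have S0 : (0 <= \esum_(n in [set: int]) a n)%E by apply: esum_ge0.
have Sfin : \esum_(n in [set: int]) a n \is a fin_num.
  by rewrite ge0_fin_numE// (lt_trans S1) ?ltry.
exists (fine (\esum_(n in [set: int]) a n)).
  by rewrite -lte_fin fineK.
move=> i N; rewrite -lee_fin fineK//.
pose e (l : nat) : int := i%:Z - l%:Z.
have ei : set_inj `I_N e by move=> x y _ _ /eqP; rewrite /e (inj_eq (addrI _)) eqr_opp => /eqP [].
apply: esum_ge; exists (e @` `I_N); first by split=> //; exact: finite_image.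
rewrite -esum_fset; [|exact: finite_image|by []].
rewrite esum_image// esum_fset; [|exact: finite_II|by []].
rewrite -fsbig_ord sumEFin lee_fin; apply: ler_sum => l _.
rewrite le_eqVlt; apply/orP; left; apply/eqP; congr (_ * _).
by rewrite /e expfzDr ?gt_eqF// -invr_expz invfM invrK mulrC.
Qed.

(** The coefficient of z^(i - l) carries r^-(i - l): on |z| = r this undoes the dilation and leaves
    the Fejer mean, on |z| = 1 it is the weight of the hypothesis. *)
Definition fejer_family N r (z : R[i]) : 'rV[R[i]]_m :=
  \sum_(i < N) \sum_(l < N) ((N%:R^-1 * (r ^+ l / r ^+ i)%:C) * monom i l z) *:
    \row_j circle_coef F j (i%:Z - l%:Z) r.

Lemma fejer_family_entry N r z j : fejer_family N r z ord0 j =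
  N%:R^-1 * \sum_(i < N) \sum_(l < N)
    circle_coef F j (i%:Z - l%:Z) r * ((r ^+ l / r ^+ i)%:C * monom i l z).
Proof.
rewrite /fejer_family summxE mulr_sumr; apply: eq_bigr => i _.
rewrite summxE mulr_sumr; apply: eq_bigr => l _.
by rewrite !mxE mulrC -mulrA mulrCA.
Qed.

Lemma fejer_family_differentiable N r z : z != 0 -> differentiable (fejer_family N r) z.
Proof.
move=> z0.
have -> : fejer_family N r = \sum_(i < N) \sum_(l < N) (fun z =>
    ((N%:R^-1 * (r ^+ l / r ^+ i)%:C) * monom i l z) *:
    (\row_j circle_coef F j (i%:Z - l%:Z) r : 'rV[R[i]]_m)).
  rewrite funeqE => w; rewrite fct_sumE; apply: eq_bigr => i _.
  by rewrite fct_sumE.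
apply: differentiable_sum => i; apply: differentiable_sum => l; apply: differentiableZl.
apply/derivable1_diffP; apply: derivable_mulC; first exact: derivable_cstC.
exact: monom_derivable.
Qed.

Lemma fejer_familyE N r t j : 0 < r ->
  fejer_family N r (polar r t) ord0 j =
  fejer_sum N (fun z => F (r%:C * z) ord0 j) (expi t).
Proof.
move=> r0; rewrite fejer_family_entry /fejer_sum; congr (_ * _).
apply: eq_bigr => i _; apply: eq_bigr => l _.
rewrite circle_coefE; congr (_ * _).
have rn n : r%:C ^+ n != 0 :> R[i] by rewrite expf_neq0// (inj_eq (@complexI R)) gt_eqF.
have en n : expi t ^+ n != 0 :> R[i] by rewrite expf_neq0// expi_neq0.
have alg (x y a b : R[i]) : x != 0 -> y != 0 -> b != 0 -> (y / x) * ((x * a) / (y * b)) = a / b.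
  by move=> x0 y0 b0; field; rewrite x0 y0 b0.
by rewrite /monom polarE !exprMn rmorphM fmorphV !rmorphXn alg.
Qed.

(** An average over i of N inner sums, each of modulus at most the same s < 1. *)
Lemma fejer_family_polydisc N r t : (0 < N)%N -> 0 < r <= 1 -> polydisc R m (fejer_family N r (expi t)).
Proof.
move=> N0 hr; have r0 : 0 < r by case/andP: hr.
apply/polydiscE => j; rewrite fejer_family_entry.
have [s s1 hs] := coef_sum_le j hr.
apply: le_lt_trans s1; rewrite normcM normcV.
have -> : normc (N%:R : R[i]) = N%:R by rewrite -(rmorph_nat (real_complex R)) normc_real normr_nat.
rewrite mulrC ler_pdivrMr ?ltr0n//.
apply: le_trans (le_normc_sum _ _ _) _.
apply: (@le_trans _ _ (\sum_(i < N) s)); last by rewrite big_const_ord iter_addr_0 mulr_natr.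
apply: ler_sum => i _; apply: le_trans (le_normc_sum _ _ _) _.
apply: le_trans (hs i N); apply: ler_sum => l _.
have nE (c : R[i]) (x : R) : normc (c * (x%:C * monom i l (expi t))) = normc c * `|x|.
  by rewrite 2!normcM normc_monom_expi mulr1 normc_real.
rewrite nE ger0_norm//.
by rewrite divr_ge0// exprn_ge0// ltW.
Qed.

Lemma circle_approximation r e : 0 < r <= 1 -> 0 < e ->
  exists Phi : R[i] -> 'rV[R[i]]_m, [/\ forall z, z != 0 -> differentiable Phi z,
    forall t, polydisc R m (Phi (expi t)) &
    forall t, 0 <= t <= 2 * pi -> close e (Phi (polar r t)) (F (polar r t))].
Proof.
move=> hr e0; have r0 : 0 < r by case/andP: hr.
have /boolp.choice[N0 HN0] : forall j : 'I_m, exists N0, forall N, (N0 <= N)%N -> forall t, 0 <= t <= 2 * pi ->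
    normc (fejer_sum N (fun z => F (r%:C * z) ord0 j) (expi t) - F (r%:C * expi t) ord0 j) < e.
  by move=> j; have [N0 h] := fejer_approx (@dilate_circle_cont r j) e0; exists N0 => N NN t ht; rewrite -polarE; apply: h.
pose N := (\max_j N0 j).+1.
exists (fejer_family N r); split.
- by move=> z; exact: fejer_family_differentiable.
- by move=> t; exact: fejer_family_polydisc.
move=> t ht j; rewrite fejer_familyE// polarE; apply: HN0 => //.
by apply: leqW; apply: leq_bigmax.
Qed.

(** The mean is the coefficient of index 0, a single term of the weighted sum (i = 0, N = 1). *)
Lemma mean_coef_lt1 r j : 0 < r <= 1 -> normc (mean 1 (fun z => F (r%:C * z) ord0 j)) < 1.
Proof.
move=> hr; have [s s1 hs] := coef_sum_le j hr.
apply: le_lt_trans s1; apply: le_trans (hs 0%N 1%N).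
rewrite big_ord1 expr0 divr1 mulr1 -[leRHS]/(normc (circle_coef F j (0%N%:Z - 0%N%:Z) r)) circle_coefE.
have -> // : mean 1 (fun z => F (r%:C * z) ord0 j * monom 0 0 z) = mean 1 (fun z => F (r%:C * z) ord0 j).
by apply: eq_mean => t _; rewrite /monom expr0 divr1 mulr1.
Qed.

End FejerFamily.

(** * Differentiability of projections and of row-valued maps *)

Section DifferentiableRows.
Variable R : realType.

Lemma differentiable_fst (U V : normedModType R[i]) (q : U * V) :
  differentiable (fun p : U * V => p.1) q.
Proof.
have c : continuous (fst : {linear (U * V)%type -> U}) by move=> -[a b]; exact: cvg_fst.
have H := linear_differentiable q c; exact H.
Qed.

Lemma differentiable_snd (U V : normedModType R[i]) (q : U * V) :
  differentiable (fun p : U * V => p.2) q.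
Proof.
have c : continuous (snd : {linear (U * V)%type -> V}) by move=> -[a b]; exact: cvg_snd.
have H := linear_differentiable q c; exact H.
Qed.

Lemma differentiable_row m (U : normedModType R[i]) (g : U -> 'rV[R[i]]_m) (q : U) :
  (forall j, differentiable (fun p => g p ord0 j : R[i]) q) -> differentiable g q.
Proof.
move=> hg; pose e j : 'rV[R[i]]_m := delta_mx ord0 j.
have -> : g = fun p => \sum_j g p ord0 j *: e j.
  by apply/funext => p; rewrite -row_sum_delta.
have -> : (fun p => \sum_j g p ord0 j *: e j) = \sum_j (fun p => g p ord0 j *: e j).
  by rewrite funeqE => p; rewrite fct_sumE.
by apply: differentiable_sum => j; exact: differentiableZl.
Qed.

Lemma differentiable_entry m (U : normedModType R[i]) (g : U -> 'rV[R[i]]_m) (q : U) j :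
  differentiable g q -> differentiable (fun p => g p ord0 j : R[i]) q.
Proof.
by move=> hg; exact: (differentiable_comp hg (differentiable_coord _ _ _)).
Qed.

End DifferentiableRows.

(** * Compactness of closed annuli *)

Section NearAnnulus.
Variable R : realType.

Lemma near_annulus (I : Type) (G : set_system I) (FG : Filter G) (P : I -> R[i] -> Prop) (a b : R) :
  (forall r t, a <= r <= b -> 0 <= t <= 2 * pi -> \forall z \near polar r t & i \near G, P i z) ->
  \forall i \near G, forall r t, a <= r <= b -> 0 <= t <= 2 * pi -> P i (polar r t).
Proof.
move=> H.
have /compact_near_coveringP K := compact_setX (@segment_compact R a b) (@segment_compact R 0 (2 * pi)).
have := K I G (fun i p => P i (polar p.1 p.2)) FG; move=> {}K.
have {}K : \forall i \near G, `[a, b] `*` `[0, 2 * pi] `<=` (fun p => P i (polar p.1 p.2)).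
  apply: K => -[r t] [/=]; rewrite !in_itv /= => rab ht.
  have [[A B] [/= hA hB] AB] := H r t rab ht.
  exists ((fun p => polar p.1 p.2) @^-1` A, B); last by move=> [p i] /= [pA iB]; exact: (AB (polar p.1 p.2, i)).
  split=> //=; exact: (@polar_continuous R (r, t) _ hA).
apply: filterS K => i K r t rab ht; apply: (K (r, t)).
by split; rewrite /= in_itv.
Qed.

End NearAnnulus.

(** * Deforming the circle of integration along maps near the graph *)

Section GraphDeformation.
Variables (R : realType) (m : nat) (F : R[i] -> 'rV[R[i]]_m) (Omega : set (R[i] * 'rV[R[i]]_m)).
Hypothesis F_cont : continuous F.
Hypothesis F_coef : forall (j : 'I_m) (r : R), 0 < r <= 1 ->
  (\esum_(n in [set: int]) (normc (circle_coef F j n r) / r ^ n)%:E < 1)%E.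
Hypothesis Omega_open : open Omega.
Hypothesis graph_sub : forall r t : R, 0 <= r <= 1 -> Omega (polar r t, F (polar r t)).
Hypothesis torus_sub : forall (t : R) w, polydisc R m w -> Omega (expi t, w).

(** The graph is compact, so one thickness serves all points; half of the local radius absorbs the
    variation of [F], half the displacement of w. *)
Lemma graph_thickening : exists2 e : R, 0 < e &
  forall r t, 0 <= r <= 1 -> 0 <= t <= 2 * pi ->
  forall w, close e w (F (polar r t)) -> Omega (polar r t, w).
Proof.
have H : \forall e \near 0^'+, forall r t : R, 0 <= r <= 1 -> 0 <= t <= 2 * pi ->
  forall w, close e w (F (polar r t)) -> Omega (polar r t, w).
  apply: (@near_annulus _ _ (0^'+) _ (fun e z => forall w, close e w (F z) -> Omega (z, w))).
  move=> r t hr ht; set z0 := polar r t.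
  have O0 : nbhs (z0, F z0) Omega by apply: open_nbhs_nbhs; split; [exact: Omega_open|exact: graph_sub].
  have [[A D] [/= hA hD] AD] := O0.
  have [d d0 hd] := (nbhs_rowP _ _).1 hD.
  have d20 : 0 < d / 2 by rewrite divr_gt0.
  have FA : \forall z \near z0, close (d / 2) (F z) (F z0) by exact: (F_cont (nbhs_close (F z0) d20)).
  exists (A `&` [set z | close (d / 2) (F z) (F z0)], [set x | x < d / 2]) => /=.
    split; first exact: filterI hA FA.
    exact: nbhs_right_lt.
  move=> [z x] /= [[Az Fz] xd] w wF; apply: AD; split => //=; apply: hd.
  rewrite [d](splitr d); apply: close_trans Fz; apply: close_le wF; exact: ltW.
have H0 : \forall e \near 0^'+, (0 : R) < e by exact: nbhs_right_gt.
by have [e [e0 he]] := @filter_ex _ _ _ _ (@filterI _ _ _ _ _ H0 H); exists e.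
Qed.

Section Holomorphic.
Variable f : R[i] * 'rV[R[i]]_m -> R[i].
Hypothesis f_holo : holomorphic_on Omega f.

Definition moment r (Phi : R[i] -> 'rV[R[i]]_m) := mean r (fun z => z * f (z, Phi z)).

Lemma moment_integrand_derivable (Phi : R[i] -> 'rV[R[i]]_m) z :
  differentiable Phi z -> Omega (z, Phi z) -> derivable (fun z => f (z, Phi z)) z 1.
Proof.
move=> dPhi O; apply/derivable1_diffP.
have dp : differentiable (fun z => (z, Phi z)) z.
  exact: (differentiable_pair (f := fun z : R[i] => z)).
exact: (differentiable_comp dp (f_holo O)).
Qed.

Lemma moment_const (Phi : R[i] -> 'rV[R[i]]_m) a b : 0 <= a <= b ->
  (forall r t, a <= r <= b -> 0 <= t <= 2 * pi -> differentiable Phi (polar r t)) ->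
  (forall r t, a <= r <= b -> 0 <= t <= 2 * pi -> Omega (polar r t, Phi (polar r t))) ->
  moment a Phi = moment b Phi.
Proof.
move=> ab dPhi O; apply: (@mean_annulus R a b (fun z => f (z, Phi z)) ab) => r t hr ht.
by apply: moment_integrand_derivable; [exact: dPhi|exact: O].
Qed.

(** The complex line through two maps. A complex parameter makes the moments holomorphic in it; on
    the real segment [0, 1] convexity keeps the line inside the allowed set. *)
Definition pencil (Phi Psi : R[i] -> 'rV[R[i]]_m) (q : R[i] * R[i]) :=
  Phi q.1 + q.2 *: (Psi q.1 - Phi q.1).

Lemma pencil_differentiable (Phi Psi : R[i] -> 'rV[R[i]]_m) (q : R[i] * R[i]) :
  differentiable Phi q.1 -> differentiable Psi q.1 -> differentiable (pencil Phi Psi) q.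
Proof.
move=> dPhi dPsi.
have d1 : differentiable (fun q : R[i] * R[i] => Phi q.1) q.
  exact: (differentiable_comp (differentiable_fst q) dPhi).
have d2 : differentiable (fun q : R[i] * R[i] => Psi q.1) q.
  exact: (differentiable_comp (differentiable_fst q) dPsi).
apply: differentiable_row => j.
have -> : (fun p : R[i] * R[i] => pencil Phi Psi p ord0 j) =
          (fun p => Phi p.1 ord0 j + p.2 * (Psi p.1 ord0 j - Phi p.1 ord0 j)).
  by apply/funext => p; rewrite !mxE.
have e1 := differentiable_entry j d1.
have e2 := differentiable_entry j d2.
exact: (differentiableD e1 (differentiableM (differentiable_snd q) (differentiableB e2 e1))).
Qed.

Lemma pencil_slice_differentiable (Phi Psi : R[i] -> 'rV[R[i]]_m) s z :
  differentiable Phi z -> differentiable Psi z -> differentiable (fun z => pencil Phi Psi (z, s)) z.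
Proof.
by move=> dPhi dPsi; exact: (differentiableD dPhi (differentiableZ s (differentiableB dPsi dPhi))).
Qed.

Lemma pencil_integrand_differentiable (Phi Psi : R[i] -> 'rV[R[i]]_m) r t s :
  0 < r -> (forall z, z != 0 -> differentiable Phi z) -> (forall z, z != 0 -> differentiable Psi z) ->
  Omega (polar r t, pencil Phi Psi (polar r t, s)) ->
  \forall q \near (polar r t, s), differentiable
    (fun q : R[i] * R[i] => q.1 * f (q.1, pencil Phi Psi q)) q.
Proof.
move=> r0 dPhi dPsi O.
pose g (q : R[i] * R[i]) := (q.1, pencil Phi Psi q).
have dg q : q.1 != 0 -> differentiable g q.
  move=> q0; apply: differentiable_pair; first exact: differentiable_fst.
  by apply: pencil_differentiable; [exact: dPhi|exact: dPsi].
have z0 : polar r t != 0 := polar_neq0 t r0.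
have N0 : \forall q \near (polar r t, s), q.1 != 0 :> R[i].
  have /cvg_fst : \forall z \near polar r t, z != 0 :> R[i].
    apply/nbhs_normcP; exists (normc (polar r t)); first exact: normc_gt0.
    by move=> z; apply: contraTneq => ->; rewrite sub0r normcN ltxx.
  exact.
have N1 : \forall q \near (polar r t, s), Omega (g q).
  have gc := differentiable_continuous (dg (polar r t, s) z0).
  apply: gc; exact: open_nbhs_nbhs.
apply: filterS2 N0 N1 => q q0 Oq.
apply: differentiableM; first exact: differentiable_fst.
exact: (differentiable_comp (dg q q0) (f_holo Oq)).
Qed.

Section Thickened.
Variable e : R.
Hypothesis e_gt0 : 0 < e.
Hypothesis thick : forall r t, 0 <= r <= 1 -> 0 <= t <= 2 * pi ->
  forall w, close e w (F (polar r t)) -> Omega (polar r t, w).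

(** All conditions are convex in [Phi]. Differentiability is asked only off 0, where Laurent
    polynomials may have a pole, and nothing is asked between the radii r and 1. *)
Definition admissible r (Phi : R[i] -> 'rV[R[i]]_m) :=
  [/\ forall z, z != 0 -> differentiable Phi z,
      forall t, 0 <= t <= 2 * pi -> polydisc R m (Phi (expi t)) &
      forall t, 0 <= t <= 2 * pi -> close e (Phi (polar r t)) (F (polar r t))].

Definition moments_agree r := forall Phi, admissible r Phi -> moment 1 Phi = moment r Phi.

(* Along the complex line through two admissible maps the difference of the two moments is
   holomorphic, so it vanishes as soon as it vanishes near one of them. *)
Lemma moment_identity (Phi Psi : R[i] -> 'rV[R[i]]_m) r : 0 < r <= 1 ->
  admissible r Phi -> admissible r Psi ->
  (\forall s \near 0, moment 1 (fun z => pencil Phi Psi (z, s)) =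
                      moment r (fun z => pencil Phi Psi (z, s))) ->
  moment 1 Psi = moment r Psi.
Proof.
move=> /andP[r0 r1] [dPhi pPhi cPhi] [dPsi pPsi cPsi] near0.
pose v (q : R[i] * R[i]) := q.1 * f (q.1, pencil Phi Psi q).
pose h s := mean 1 (fun z => v (z, s)) - mean r (fun z => v (z, s)).
suff h1 : h 1 = 0.
  have E x : mean x (fun z => v (z, 1)) = moment x Psi.
    apply: eq_mean => t _; rewrite /v /pencil /= scale1r addrC subrK //.
  by move: h1; rewrite /h !E => /eqP; rewrite subr_eq0 => /eqP.
apply: identity_segment; last first.
  by apply: filterS near0 => s hs; rewrite /h [mean 1 _]hs subrr.
move=> x hx.
(* Stated for any circle, since the two circles lie in [Omega] for different reasons: the torus at
   radius 1, the thickened graph at radius r. *)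
have D a : 0 < a -> (forall t, 0 <= t <= 2 * pi -> Omega (polar a t, pencil Phi Psi (polar a t, x%:C))) ->
    \forall s \near x%:C, differentiable (fun s' : R[i] => mean a (fun z => v (z, s'))) s.
  move=> a0 aO; apply: differentiable_mean_near => t ht.
  by apply: pencil_integrand_differentiable => //; exact: aO.
have D1 : \forall s \near x%:C, differentiable (fun s' : R[i] => mean 1 (fun z => v (z, s'))) s.
  apply: D => // t ht; rewrite polar1; apply: torus_sub.
  by apply: polydisc_convex; [|exact: pPhi|exact: pPsi].
have Dr : \forall s \near x%:C, differentiable (fun s' : R[i] => mean r (fun z => v (z, s'))) s.
  apply: D => // t ht; apply: thick; rewrite ?(ltW r0)//.
  by apply: close_convex; [|exact: cPhi|exact: cPsi].
apply: filterS2 D1 Dr => s d1 dr; apply/derivable1_diffP.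
exact: (differentiableB d1 dr).
Qed.

(** An approximant [Phi] built at radius r is admissible at all nearby radii, whereas [Psi] is only
    known to be close to [F] at radius y. For small s the pencil is so near [Phi] that it is
    admissible on the whole annulus between x and y: its moments at 1, x and y agree, and
    [moment_identity] carries this to [Psi]. *)
Lemma moments_agree_step r : 0 < r <= 1 -> exists2 d, 0 < d & forall x y,
  0 < x <= 1 -> 0 < y <= 1 -> `|x - r| < d -> `|y - r| < d -> moments_agree x -> moments_agree y.
Proof.
move=> hr; have r0 : 0 < r by case/andP: hr.
have [Phi [dPhi pPhi cPhi]] := circle_approximation F_cont F_coef hr e_gt0.
have : \forall x \near r, forall t, 0 <= t <= 2 * pi -> close e (Phi (polar x t)) (F (polar x t)).
  apply: (@near_circle _ _ (nbhs r) _ (fun x t => close e (Phi (polar x t)) (F (polar x t)))) => t ht.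
  have Phic := differentiable_continuous (dPhi _ (polar_neq0 t r0)).
  have := close_open e_gt0 Phic (F_cont (x := polar r t)) (cPhi t ht).
  exact: (@polar_swap_continuous R (t, r)).
move=> /nbhs_ballP[d d0 hd]; exists d => // x y hx hy xr yr gx Psi admPsi.
have adm z : `|z - r| < d -> admissible z Phi.
  move=> zr; split; [exact: dPhi|by move=> t _; exact: pPhi|].
  by apply: hd; rewrite /ball /= distrC.
have x0 : 0 < x by case/andP: hx.
have y0 : 0 < y by case/andP: hy.
apply: (moment_identity hy (adm y yr) admPsi).
case: admPsi => dPsi pPsi cPsi.
pose lo := Num.min x y; pose hi := Num.max x y.
have lo0 : 0 < lo by rewrite lt_min x0 y0.
have hi1 : hi <= 1 by rewrite ge_max; case/andP: hx => _ ->; case/andP: hy => _ ->.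
have pc z : z != 0 -> {for (z, 0), continuous (pencil Phi Psi)}.
  move=> z0; apply: differentiable_continuous.
  by apply: pencil_differentiable; [exact: dPhi|exact: dPsi].
have p0 z : pencil Phi Psi (z, 0) = Phi z by rewrite /pencil scale0r addr0.
have N1 : \forall s \near (0 : R[i]), forall t, 0 <= t <= 2 * pi -> polydisc R m (pencil Phi Psi (expi t, s)).
  (* The unit circle is treated as a degenerate annulus. *)
  have H : \forall s \near (0 : R[i]), forall z t, 1 <= z <= 1 -> 0 <= t <= 2 * pi ->
      polydisc R m (pencil Phi Psi (polar z t, s)).
    apply: (@near_annulus R _ (nbhs (0 : R[i])) _ (fun s z => polydisc R m (pencil Phi Psi (z, s)))).
    move=> z t z1 ht; have -> : z = 1 by apply/eqP; rewrite eq_le andbC.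
    have n0 : polar 1 t != 0 := polar_neq0 t ltr01.
    apply: (pc _ n0); apply: polydisc_open; rewrite p0 polar1; exact: pPhi.
  by apply: filterS H => s hs t ht; rewrite -polar1; apply: hs; rewrite ?lexx.
have N2 : \forall s \near (0 : R[i]), forall z t, lo <= z <= hi -> 0 <= t <= 2 * pi ->
    close e (pencil Phi Psi (polar z t, s)) (F (polar z t)).
  apply: (@near_annulus R _ (nbhs (0 : R[i])) _ (fun s z => close e (pencil Phi Psi (z, s)) (F z))).
  move=> z t /andP[loz zhi] ht.
  have n0 : polar z t != 0 := polar_neq0 t (lt_le_trans lo0 loz).
  have Fc : {for (polar z t, 0 : R[i]), continuous (fun q : R[i] * R[i] => F q.1)}.
    apply: (@continuous_comp _ _ _ fst F); first exact: cvg_fst.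
    exact: F_cont.
  apply: (close_open e_gt0 (pc _ n0) Fc); rewrite p0.
  have zr : `|z - r| < d.
    have [xy|yx] := leP x y; move: loz zhi; rewrite /lo /hi.
      by rewrite (min_idPl xy) (max_idPr xy); move: xr yr; rewrite !ltr_norml; lra.
    by rewrite (min_idPr (ltW yx)) (max_idPl (ltW yx)); move: xr yr; rewrite !ltr_norml; lra.
  by case: (adm z zr) => _ _; exact.
apply: filterS2 N1 N2 => s h1 h2.
have lox : lo <= x <= hi by rewrite ge_min lexx le_max lexx.
have loy : lo <= y <= hi by rewrite ge_min lexx le_max lexx !orbT.
have ds z : z != 0 -> differentiable (fun z => pencil Phi Psi (z, s)) z.
  by move=> z0; apply: pencil_slice_differentiable; [exact: dPhi|exact: dPsi].
have admx : admissible x (fun z => pencil Phi Psi (z, s)).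
  by split=> // t ht; exact: h2.
rewrite (gx _ admx).
have mc a b : lo <= a -> b <= hi -> a <= b ->
    moment a (fun z => pencil Phi Psi (z, s)) = moment b (fun z => pencil Phi Psi (z, s)).
  move=> loa bhi ab; apply: moment_const.
  - by rewrite (le_trans (ltW lo0) loa).
  - by move=> z t /andP[az zb] ht; apply: ds; apply: polar_neq0; exact: lt_le_trans (lt_le_trans lo0 loa) az.
  - move=> z t /andP[az zb] ht; apply: thick => //.
      by rewrite (le_trans (ltW lo0) (le_trans loa az)) (le_trans zb (le_trans bhi hi1)).
    by apply: h2; rewrite // (le_trans loa az) (le_trans zb bhi).
case/andP: lox => l1 l2; case/andP: loy => l3 l4.
by case: (leP x y) => [xy|/ltW yx]; [exact: mc|rewrite (mc y x)].
Qed.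

(** The property has to travel down from 1 to r. The induction goes upwards on the implication from
    radius x to radius r, which is trivial at x = r; at x = 1 its premise is trivial. *)
Lemma moments_agree_all r : 0 < r <= 1 -> moments_agree r.
Proof.
move=> /andP[r0 r1].
have g1 : moments_agree 1 by [].
apply: (@segment_induction R (fun x => moments_agree x -> moments_agree r) r 1 r1 _ _ g1) => // t /andP[rt t1].
have ht : 0 < t <= 1 by rewrite (lt_le_trans r0 rt) t1.
have [d d0 hd] := moments_agree_step ht; exists d => // x y /andP[rx x1] /andP[ry y1] xt yt gx gy.
apply: gx; apply: (hd y x) => //.
  by rewrite (lt_le_trans r0 ry) y1.
by rewrite (lt_le_trans r0 rx) x1.
Qed.

(** The natural constant [F 0] may lie on the boundary of the polydisc: a component 1 - |z| is
    allowed and equals 1 at 0. Its mean over a small circle is strictly inside and still close to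
    [F 0]. *)
Lemma moment_cst_near : exists2 w0 : 'rV[R[i]]_m, polydisc R m w0 &
  \forall w \near w0, moment 1 (fun=> w) = 0.
Proof.
have e40 : 0 < e / 4 by rewrite divr_gt0.
have : \forall z \near (0 : R[i]), close (e / 4) (F z) (F 0) by exact: (F_cont (nbhs_close (F 0) e40)).
move=> /nbhs_normcP[d d0 hd].
pose del := Num.min (d / 2) 1.
have del0 : 0 < del by rewrite lt_min divr_gt0//= ltr01.
have del1 : del <= 1 by rewrite ge_min lexx orbT.
have deld : del < d by rewrite gt_min; apply/orP; left; lra.
have hdel : 0 < del <= 1 by rewrite del0.
have Fd r t : 0 <= r <= del -> close (e / 4) (F (polar r t)) (F 0).
  by move=> /andP[r0 rd]; apply: hd; rewrite subr0 normc_polar// (le_lt_trans rd).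
pose w0 : 'rV[R[i]]_m := \row_j mean 1 (fun z => F (del%:C * z) ord0 j).
exists w0; first by apply/polydiscE => j; rewrite mxE; exact: (mean_coef_lt1 F_coef).
have w0F j : normc (w0 ord0 j - F 0 ord0 j) <= e / 2.
  have cF := dilate_circle_cont F_cont (r := del) (j := j).
  have cc := @circle_cont_cst R 1 (F 0 ord0 j).
  rewrite mxE -[X in _ - X](mean_cst 1) -(meanB cF cc).
  have -> : e / 2 = 2 * (e / 4) by field.
  apply: normc_mean_le; first exact: (circle_contD cF (circle_contN cc)).
  move=> t ht; apply: ltW; rewrite polar1 -polarE; apply: Fd.
  by rewrite ltW/=.
have P0 : nbhs w0 (polydisc R m).
  by apply: polydisc_open; apply/polydiscE => j; rewrite mxE; exact: (mean_coef_lt1 F_coef).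
apply: filterS2 P0 (nbhs_close w0 e40) => w Pw ww.
(* e / 4 from w to [w0], e / 2 from [w0] to [F 0] (with the factor 2 of the mean), e / 4 from [F 0]
   to the value of [F] on the small disc. *)
have wF r t : 0 <= r <= del -> close e w (F (polar r t)).
  move=> hr j; have h1 := ww j; have h2 := w0F j; have h3 := Fd r t hr j.
  have -> : w ord0 j - F (polar r t) ord0 j = (w ord0 j - w0 ord0 j) +
     (w0 ord0 j - F 0 ord0 j) - (F (polar r t) ord0 j - F 0 ord0 j) by ring.
  apply: le_lt_trans (le_normcD _ _) _; rewrite normcN.
  apply: le_lt_trans (lerD (le_normcD _ _) (lexx _)) _.
  by move: h1 h2 h3; lra.
have adm : admissible del (fun=> w).
  split=> [z _|t _ //|t _]; first exact: differentiable_cst.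
  by apply: wF; rewrite ltW/=.
(* A constant map has no pole at 0, so the circle can be shrunk to radius 0, where the moment
   vanishes. *)
rewrite (moments_agree_all hdel adm) -(@moment_const (fun=> w) 0 del).
- by rewrite /moment mean0 mul0r.
- by rewrite lexx ltW.
- by move=> r t _ _; exact: differentiable_cst.
- move=> r t hr ht; apply: thick => //; last exact: wF.
  by case/andP: hr => -> rd /=; exact: le_trans rd del1.
Qed.

(** The identity principle on the complex line from [w0] to w, whose real segment stays in the
    convex polydisc. *)
Lemma moment_cst_eq0 w : polydisc R m w -> mean 1 (fun z => z * f (z, w)) = 0.
Proof.
move=> Pw; have [w0 Pw0 N0] := moment_cst_near.
pose v (q : R[i] * R[i]) := q.1 * f (q.1, pencil (fun=> w0) (fun=> w) q).
pose h s := mean 1 (fun z => v (z, s)).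
have <- : h 1 = mean 1 (fun z => z * f (z, w)).
  by apply: eq_mean => t _; rewrite /v /pencil /= scale1r addrC subrK.
apply: identity_segment; last first.
  have lc : {for (0 : R[i]), continuous (fun s : R[i] => w0 + s *: (w - w0))}.
    apply: differentiable_continuous; exact: differentiable_line.
  have N0' : nbhs (w0 + (0 : R[i]) *: (w - w0)) [set w | moment 1 (fun=> w) = 0].
    by rewrite scale0r addr0.
  exact: (lc _ N0').
move=> x hx.
have D : \forall s \near x%:C, differentiable (fun s' : R[i] => mean 1 (fun z => v (z, s'))) s.
  apply: differentiable_mean_near => t ht.
  apply: pencil_integrand_differentiable => //; [by move=> z _; exact: differentiable_cst..|].
  by rewrite polar1; apply: torus_sub; exact: polydisc_convex.
by apply: filterS D => s d1; apply/derivable1_diffP.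
Qed.

End Thickened.

End Holomorphic.

Lemma moment_vanish f w : holomorphic_on Omega f -> polydisc R m w ->
  mean 1 (fun z => z * f (z, w)) = 0.
Proof. by move=> hf Pw; have [e e0 he] := graph_thickening; exact: (moment_cst_eq0 hf e0 he). Qed.

Lemma moment_vanish_pow n f w : holomorphic_on Omega f -> polydisc R m w ->
  mean 1 (fun z => z * (z ^+ n * f (z, w))) = 0.
Proof.
move=> hf; apply: (@moment_vanish (fun q => q.1 ^+ n * f q)) => q Oq.
apply: differentiableM; last exact: hf.
elim: n => [|n IH].
  have -> : (fun x : R[i] * 'rV[R[i]]_m => x.1 ^+ 0) = (fun=> 1) by apply/funext => x; rewrite expr0.
  exact: differentiable_cst.
have -> : (fun x : R[i] * 'rV[R[i]]_m => x.1 ^+ n.+1) = (fun x => x.1 * x.1 ^+ n).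
  by apply/funext => x; rewrite exprS.
exact: (differentiableM (differentiable_fst q) IH).
Qed.

End GraphDeformation.

(** * Vanishing moments and Cauchy's formula on an annulus *)

Section LaurentPrincipalPart.
Variables (R : realType) (h : R[i] -> R[i]) (r : R) (a : R[i]).
Hypothesis r_gt0 : 0 < r.
Hypothesis ra : r < normc a.
Hypothesis a1 : normc a < 1.
Hypothesis h_deriv : forall x t, r <= x <= 1 -> 0 <= t <= 2 * pi -> derivable h (polar x t) 1.
Hypothesis h_moment : forall n, mean 1 (fun z => z * (z ^+ n * h z)) = 0.

Let r1 : r <= 1. Proof. exact: ltW (lt_trans ra a1). Qed.

Let h_cont : circle_cont r h.
Proof. by move=> t ht; apply: derivable_cont; apply: h_deriv; rewrite ?lexx ?r1. Qed.

Let kernel_derivable x t : 0 <= x <= r -> derivable (fun z => (z - a)^-1) (polar x t) 1.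
Proof.
move=> /andP[x0 xr]; apply: derivable_shiftV; apply: polar_neq => //.
by rewrite gt_eqF// (le_lt_trans xr).
Qed.

Let kernel_cont : circle_cont r (fun z => (z - a)^-1).
Proof. by move=> t ht; apply: derivable_cont; apply: kernel_derivable; rewrite lexx ltW. Qed.

Let pow_cont n : circle_cont r (fun z => z ^+ n).
Proof. by move=> t ht; apply: derivable_cont; exact: derivable_pow. Qed.

Let inner_moment n : mean r (fun z => z * (z ^+ n * h z)) = 0.
Proof.
rewrite -(h_moment n); apply: (@mean_annulus R r 1 (fun z => z ^+ n * h z)).
  by rewrite ltW.
by move=> x t hx ht; exact: (derivable_mulC (@derivable_pow R n _) (h_deriv hx ht)).
Qed.

Let Y n := mean r (fun z => z * (z ^+ n * h z) * (z - a)^-1).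

(** Since z - a cancels the kernel, [Y n.+1 - a * Y n] is the n-th inner moment. *)
Let YS n : Y n.+1 = a * Y n.
Proof.
have zc := @circle_cont_id R r.
have c n' := circle_contM zc (circle_contM (@pow_cont n') h_cont).
have ck n' := circle_contM (@c n') kernel_cont.
apply/eqP; rewrite -subr_eq0 /Y -(meanZ a (@ck n)).
rewrite -(meanB (@ck n.+1) (circle_contM (@circle_cont_cst R r a) (@ck n))).
rewrite -(inner_moment n); apply/eqP; apply: eq_mean => t ht.
have n0 : polar r t - a != 0.
  by rewrite subr_eq0; apply: polar_neq; [exact: ltW|rewrite gt_eqF].
set z := polar r t in n0 *; move: (h z) n0 => y; move: z => z n0.
by rewrite exprS; field.
Qed.

(** [Y n] equals a^n [Y 0] but is at most a constant times r^n, and r < |a|. *)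
Let Y0 : Y 0 = 0.
Proof.
have [M hM] := circle_bounded h_cont.
have M0 : 0 <= M by apply: le_trans (hM 0 _); rewrite ?normc_ge0 ?lexx ?ltW ?twopi_gt0.
have a0 : 0 < normc a := lt_trans r_gt0 ra.
have gap : 0 < normc a - r by rewrite subr_gt0.
have YE n : Y n = a ^+ n * Y 0.
  by elim: n => [|n IH]; rewrite ?expr0 ?mul1r// YS IH exprS mulrA.
apply: eq0_normc; apply/eqP; rewrite eq_le normc_ge0 andbT.
apply: (@expr_le0 R (r / normc a) _ (2 * (r * M / (normc a - r)))).
- by rewrite divr_ge0 ?ltW//= ltr_pdivrMr// mul1r.
- by apply: mulr_ge0 => //; apply: divr_ge0; [apply: mulr_ge0 => //|]; exact: ltW.
move=> n.
have : normc (Y n) <= 2 * (r * (r ^+ n * M) * (normc a - r)^-1).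
  apply: normc_mean_le.
    exact: (circle_contM (circle_contM (@circle_cont_id R r) (circle_contM (@pow_cont n) h_cont)) kernel_cont).
  move=> t ht; rewrite normcM normcV [normc (_ * (_ * _))]normcM [normc (_ * _)]normcM normcX.
  rewrite (normc_polar t (ltW r_gt0)).
  have rn : 0 <= r ^+ n by rewrite exprn_ge0// ltW.
  apply: ler_pM.
  - by apply: mulr_ge0; [exact: ltW|apply: mulr_ge0 => //; exact: normc_ge0].
  - by rewrite invr_ge0 normc_ge0.
  - by rewrite ler_pM2l// ler_wpM2l// hM.
  - rewrite lef_pV2 ?posrE//.
      by have := le_normcB a (polar r t); rewrite (normc_polar t (ltW r_gt0)) normcB.
    apply: lt_le_trans gap _.
    by have := le_normcB a (polar r t); rewrite (normc_polar t (ltW r_gt0)) normcB.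
rewrite YE normcM normcX mulrC -ler_pdivlMr ?exprn_gt0// => /le_trans; apply.
rewrite expr_div_n le_eqVlt; apply/orP; left; apply/eqP; ring.
Qed.

(* The vanishing moments kill the principal part of the Laurent expansion of [h]. *)
Lemma cauchy_formula_annulus : derivable h a 1 -> h a = mean 1 (fun z => z * h z * (z - a)^-1).
Proof.
move=> ha; have hr : 0 <= r <= 1 by rewrite ltW.
have c1 : circle_cont 1 h.
  by move=> t ht; apply: derivable_cont; apply: h_deriv; rewrite ?lexx ?r1.
have := mean_dquot hr h_deriv ha.
rewrite (mean_dquotE (ltW r_gt0) _ h_cont) ?gt_eqF//.
rewrite (mean_dquotE ler01 _ c1) ?lt_eqF// (mean_kernel a1) mulr1.
(* The pole [a] lies outside |z| = r, so this circle shrinks to a point. *)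
have E0 : mean 0 (fun z => z * (z - a)^-1) = mean r (fun z => z * (z - a)^-1).
  apply: (@mean_annulus R 0 r (fun z => (z - a)^-1)); first by rewrite lexx ltW.
  by move=> x t hx _; exact: kernel_derivable.
rewrite -E0 mean0 mul0r mulr0.
have -> : mean r (fun z => z * h z * (z - a)^-1) = 0.
  by rewrite -Y0; apply: eq_mean => t _; rewrite expr0 mul1r.
by rewrite subrr => /eqP; rewrite eq_sym subr_eq0 => /eqP.
Qed.

End LaurentPrincipalPart.

(** * Extending the datum to the plane and gluing holomorphic functions *)

Section Extension.
Variable R : realType.

Lemma near_eq_differentiable (V : normedModType R[i]) (f g : V -> R[i]) (p : V) :
  (\forall q \near p, f q = g q) -> differentiable f p -> differentiable g p.
Proof.
move=> fg df; have fgp : f p = g p := nbhs_singleton fg.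
have := diff_locally df => /eqaddoP H.
have E : g \o shift p = cst (g p) + 'd f p +o_ 0 id.
  apply/eqaddoP => e e0.
  have N : \forall k \near (0 : V), f (k + p) = g (k + p).
    have sc : {for (0 : V), continuous (fun k => k + p)}.
      by apply: (@cvgD _ _ _ (nbhs (0 : V)) _ id (fun=> p)); [exact: cvg_id|exact: cvg_cst].
    have fg0 : nbhs (0 + p) [set q | f q = g q] by rewrite add0r.
    exact: (sc _ fg0).
  apply: filterS2 N (H e e0) => k fgk.
  rewrite -fgp [X in `|X| <= _ -> _](_ : _ = f (k + p) - (f p + 'd f p k))//.
  by rewrite [X in _ -> `|X| <= _](_ : _ = g (k + p) - (f p + 'd f p k))// fgk.
have dE := diff_unique (diff_continuous df) E.
have dc := diff_continuous df.
by apply/diff_locallyP; rewrite dE; exact (conj dc E).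
Qed.

Lemma circle_coef_eq m (F G : R[i] -> 'rV[R[i]]_m) j n r : 0 <= r <= 1 ->
  (forall z, normc z <= 1 -> F z = G z) -> circle_coef F j n r = circle_coef G j n r.
Proof.
move=> /andP[r0 r1] FG; rewrite /circle_coef /fourier_coef; congr (_ * _).
apply: eq_Cintegral => t _; rewrite FG//.
by rewrite -polarE normc_polar.
Qed.

Lemma closed_discE (z : R[i]) : closed_disc R z <-> normc z <= 1.
Proof. by rewrite /closed_disc /= -[leRHS]/(1%:C) lecR. Qed.

(** The radial retraction onto the closed disc. Composing with it makes [F] continuous on the whole
    plane, so that circles up to radius 1 can be handled with full neighbourhoods. *)
Definition retract (z : R[i]) : R[i] := ((Num.max 1 (normc z))^-1)%:C * z.

Lemma normc_retract z : normc (retract z) <= 1.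
Proof.
have m0 : 0 < Num.max 1 (normc z) by rewrite lt_max ltr01.
rewrite normcM normc_real ger0_norm ?invr_ge0 ?(ltW m0)//.
by rewrite mulrC ler_pdivrMr// mul1r le_max lexx orbT.
Qed.

Lemma retract_id z : normc z <= 1 -> retract z = z.
Proof. by move=> z1; rewrite /retract (max_idPl z1) invr1 mul1r. Qed.

Lemma normc_cont : continuous (@normc R).
Proof.
move=> z; apply/(@cvgrPdist_lt _ _ _ (nbhs z) _) => e e0.
apply/nbhs_normcP; exists e => // w wz; apply: le_lt_trans wz.
by rewrite ler_norml; have := le_normcB z w; have := le_normcB w z; rewrite (normcB z w); lra.
Qed.

Lemma retract_cont : continuous retract.
Proof.
move=> z; apply: (@contM R _ (fun z => ((Num.max 1 (normc z))^-1)%:C) (fun z => z) z); last exact: cvg_id.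
apply: (@cvg_complex _ _ (nbhs z) _ (fun z => (Num.max 1 (normc z))^-1) (fun=> 0)); last exact: cvg_cst.
apply: cvgV; first by rewrite gt_eqF// lt_max ltr01.
by apply: continuous_max; [exact: cst_continuous|exact: normc_cont].
Qed.

Lemma retract_comp_cont m (F : R[i] -> 'rV[R[i]]_m) :
  {within closed_disc R, continuous F} -> continuous (F \o retract).
Proof.
move=> /subspace_continuousP Fc z A hA.
have cz : closed_disc R (retract z) by apply/closed_discE; exact: normc_retract.
have := Fc _ cz A hA; rewrite /within /= => H.
have H2 : \forall w \near z, closed_disc R (retract w) -> A (F (retract w)).
  by exact: (retract_cont H).
by apply: filterS H2 => w; apply; apply/closed_discE; exact: normc_retract.
Qed.

End Extension.

Theorem theorem1p3 (R : realType) (m : nat) (m_ge2 : (2 <= m)%N)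
    (F : R[i] -> 'rV[R[i]]_m)
    (F_cont : {within closed_disc R, continuous F})
    (F_circle : forall t : R, 0 <= t < 2 * pi -> polydisc R m (F (expi t)))
    (F_coef : forall (j : 'I_m) (r : R), 0 < r <= 1 ->
      (\esum_(n in [set: int]) (normc (circle_coef F j n r) / r ^ n)%:E < 1)%E)
    (Omega1 : set (R[i] * 'rV[R[i]]_m)) (Omega1_open : open Omega1)
    (Omega1_nbhd :
      graph_over_closed_disc F `|` (unit_circle R `*` polydisc R m)
        `<=` Omega1)
    (Omega2 : set (R[i] * 'rV[R[i]]_m)) (Omega2_open : open Omega2)
    (Omega2_conn : connected Omega2)
    (Omega2_cylinder : Omega2 `<=` [set: R[i]] `*` polydisc R m)
    (Omega2_boundary :
      unit_circle R `*` polydisc R m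
        `<=` closure_in ([set: R[i]] `*` polydisc R m) Omega2)
    (Omega2_closure :
      closure_in ([set: R[i]] `*` polydisc R m) Omega2
        `<=` Omega1 `&` ([set z : R[i] | 1 <= `|z|] `*` polydisc R m))
    (f : R[i] * 'rV[R[i]]_m -> R[i]) (f_holo : holomorphic_on Omega1 f) :
  exists (W : set (R[i] * 'rV[R[i]]_m)) (g : R[i] * 'rV[R[i]]_m -> R[i]),
    [/\ open W,
        (closed_disc R `*` polydisc R m) `|` Omega2 `<=` W,
        holomorphic_on W g &
        forall p, Omega2 p -> g p = f p].
Proof.
pose G := F \o @retract R.
have FG z : normc z <= 1 -> F z = G z by move=> z1; rewrite /G /= retract_id.
have Gc : continuous G := retract_comp_cont F_cont.
have G_coef (j : 'I_m) (r : R) : 0 < r <= 1 ->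
    (\esum_(n in [set: int]) (normc (circle_coef G j n r) / r ^ n)%:E < 1)%E.
  move=> hr; apply: le_lt_trans (F_coef j r hr).
  rewrite le_eqVlt; apply/orP; left; apply/eqP; apply: eq_esum => n _.
  rewrite (@circle_coef_eq R m F G j n r)//.
  by case/andP: hr => /ltW -> ->.
have graph_sub (r t : R) : 0 <= r <= 1 -> Omega1 (polar r t, G (polar r t)).
  move=> /andP[r0 r1]; apply: Omega1_nbhd; left.
  have p1 : normc (polar r t) <= 1 by rewrite normc_polar.
  by split; [apply/closed_discE|rewrite /= FG].
have torus_sub (t : R) w : polydisc R m w -> Omega1 (expi t, w).
  move=> Pw; apply: Omega1_nbhd; right; split=> //=.
  by rewrite /unit_circle /= [LHS](_ : _ = (normc (expi t))%:C)// normc_expi.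
have Om2 p : Omega2 p -> Omega1 p /\ 1 <= normc p.1.
  move=> Op; have [] := Omega2_closure p (conj (subset_closure Op) (Omega2_cylinder p Op)).
  move=> Op1 [/= n1 _]; split=> //; move: n1.
  by rewrite -[leLHS]/(1%:C) lecR.
(* Points where f agrees with the Cauchy integral if |z| < 1: the inner radius 2 |z| - 1 is then
   smaller than |z|, and |z| > 1 / 2 makes it positive. For |z| > 1 the range of radii is empty. *)
pose N : set (R[i] * 'rV[R[i]]_m) := [set p | [/\ polydisc R m p.2, 1 / 2 < normc p.1, Omega1 p &
  forall r t, 2 * normc p.1 - 1 <= r <= 1 -> 0 <= t <= 2 * pi -> Omega1 (polar r t, p.2)]].
pose C0 : set (R[i] * 'rV[R[i]]_m) := [set p | polydisc R m p.2 /\ normc p.1 < 1].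
pose u p := mean 1 (fun z => z * f (z, p.2) * (z - p.1)^-1).
(* The two branches are glued across the unit circle by [uf]. *)
pose g p := if normc p.1 < 1 then u p else f p.
have uf p : N p -> normc p.1 < 1 -> u p = f p.
  case=> Pw p2 Op On p1; rewrite /u.
  have fd z : Omega1 (z, p.2) -> derivable (fun z => f (z, p.2)) z 1.
    move=> Oz.
    exact: (@moment_integrand_derivable R m Omega1 f f_holo (fun=> p.2) z (differentiable_cst _ _) Oz).
  rewrite -(@cauchy_formula_annulus R (fun z => f (z, p.2)) (2 * normc p.1 - 1) p.1).
  - by case: (p).
  - by lra.
  - by lra.
  - by [].
  - by move=> x t hx ht; apply: fd; exact: On.
  - by move=> n; exact: (moment_vanish_pow Gc G_coef Omega1_open graph_sub torus_sub).
  - by apply: fd; case: (p) Op.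
have fst_near (p : R[i] * 'rV[R[i]]_m) (e : R) : 0 < e -> \forall q \near p, normc (q.1 - p.1) < e.
  case: p => z w e0.
  have : \forall z' \near z, normc (z' - z) < e by apply/nbhs_normcP; exists e.
  by move/cvg_fst; exact.
have snd_near (p : R[i] * 'rV[R[i]]_m) : polydisc R m p.2 -> \forall q \near p, polydisc R m q.2.
  by case: p => z w /= /polydisc_open /cvg_snd; exact.
have C0_open p : C0 p -> nbhs p C0.
  case=> Pw p1; have p10 : 0 < 1 - normc p.1 by rewrite subr_gt0.
  apply: filterS2 (snd_near p Pw) (fst_near p _ p10) => q Pq qp; split=> //.
  by have := le_normcB q.1 p.1; lra.
have circle_N p : unit_circle R p.1 -> polydisc R m p.2 -> nbhs p N.
  move=> Up Pw.
  have p1 : normc p.1 = 1 by apply: (@complexI R); rewrite rmorph1 -Up.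
  have OO p' : unit_circle R p'.1 -> polydisc R m p'.2 -> Omega1 p'.
    by move=> h1 h2; apply: Omega1_nbhd; right.
  have e4 : 0 < 1 / 4 :> R by lra.
  have N1 : nbhs p Omega1 by apply: open_nbhs_nbhs; split=> //; exact: OO.
  have H : \forall q \near p, forall r t, 0 <= r <= 1 -> 0 <= t <= 2 * pi ->
      2 * normc q.1 - 1 <= normc (polar r t) -> Omega1 (polar r t, q.2).
    (* The inner radius moves with q, so the lemma is used on the whole disc with the lower bound as
       a premise: at r = 1 the torus lies in [Omega1], at r < 1 the premise fails near p, because 2
       |q.1| - 1 is close to 1. *)
    apply: (@near_annulus R _ (nbhs p) _ (fun q z => 2 * normc q.1 - 1 <= normc z -> Omega1 (z, q.2))).
    move=> r t /andP[r0]; rewrite le_eqVlt => /predU1P[->|r1] ht.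
      have Op : nbhs (polar 1 t, p.2) Omega1.
        by apply: open_nbhs_nbhs; split=> //; rewrite polar1; exact: torus_sub.
      have [[A B] [/= hA hB] AB] := Op.
      have hB' : \forall q \near p, B q.2 by case: (p) hB => z w /= /cvg_snd; exact.
      exists (A, [set q | B q.2]) => //= -[z q] /= [Az Bq] _.
      exact: (AB (z, q.2)).
    have d0 : 0 < (1 - r) / 4 by rewrite divr_gt0// subr_gt0.
    exists ([set z | normc (z - polar r t) < (1 - r) / 4], [set q | normc (q.1 - p.1) < (1 - r) / 4]) => /=.
      split; last exact: fst_near.
      by apply/nbhs_normcP; exists ((1 - r) / 4).
    move=> [z q] /= [zr qp] hz; exfalso.
    have := le_normcB z (polar r t); rewrite normc_polar//.
    have := le_normcB p.1 q.1; rewrite (normcB p.1) p1; move: zr qp hz; lra.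
  apply: filterS2 (filterI (snd_near p Pw) N1) (filterI (fst_near p _ e4) H) => q [Pq Oq] [qp hq].
  have q2 : 1 / 2 < normc q.1.
    by have := le_normcB p.1 q.1; rewrite (normcB p.1) p1; move: qp; lra.
  split=> // r t /andP[r1 r2] ht.
  have r0 : 0 <= r by lra.
  by apply: hq; rewrite ?r0// normc_polar.
have u_diff p : C0 p -> differentiable u p.
  move=> [Pw p1].
  (* The first component is the variable of integration, the second the point at which the Cauchy
     integral is evaluated. *)
  pose v (q : R[i] * (R[i] * 'rV[R[i]]_m)) := q.1 * f (q.1, q.2.2) * (q.1 - q.2.1)^-1.
  apply: (@differentiable_mean R _ v 1 p) => t ht.
  have d2 q : differentiable (fun q : R[i] * (R[i] * 'rV[R[i]]_m) => q.2.1) q.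
    exact: (differentiable_comp (differentiable_snd q) (differentiable_fst _)).
  have d3 q : differentiable (fun q : R[i] * (R[i] * 'rV[R[i]]_m) => q.2.2) q.
    exact: (differentiable_comp (differentiable_snd q) (differentiable_snd _)).
  have d4 q := differentiable_pair (differentiable_fst q) (d3 q).
  have d5 q := differentiableB (differentiable_fst q) (d2 q).
  have N1 : \forall q \near (polar 1 t, p), Omega1 (q.1, q.2.2).
    have c4 := differentiable_continuous (d4 (polar 1 t, p)).
    apply: c4; apply: open_nbhs_nbhs; split=> //=.
    by rewrite polar1; exact: torus_sub.
  have N2 : \forall q \near (polar 1 t, p), q.1 - q.2.1 != 0.
    have c5 := differentiable_continuous (d5 (polar 1 t, p)).
    have n0 : polar 1 t - p.1 != 0.
      by rewrite subr_eq0; apply: polar_neq; rewrite ?lt_eqF.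
    have : \forall z \near polar 1 t - p.1, z != 0 :> R[i].
      apply/nbhs_normcP; exists (normc (polar 1 t - p.1)); first exact: normc_gt0.
      by move=> z; apply: contraTneq => ->; rewrite sub0r normcN ltxx.
    by move=> H; exact: (c5 _ H).
  apply: filterS2 N1 N2 => q Oq q0.
  have d6 : differentiable (fun q : R[i] * (R[i] * 'rV[R[i]]_m) => f (q.1, q.2.2)) q.
    exact: (differentiable_comp (d4 q) (f_holo _ Oq)).
  have d7 : differentiable (fun q : R[i] * (R[i] * 'rV[R[i]]_m) => (q.1 - q.2.1)^-1) q.
    have dV : differentiable (fun z : R[i] => z^-1) (q.1 - q.2.1).
      by apply/derivable1_diffP; exact: derivable_invC.
    exact: (differentiable_comp (d5 q) dV).
  exact: (differentiableM (differentiableM (differentiable_fst q) d6) d7).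
(* The open cylinder, a neighbourhood of its lateral boundary, and [Omega2]. Near each point [g]
   coincides with [u] on the first piece and with [f] on the others. *)
exists (C0 `|` N° `|` Omega2), g; split.
- apply: openU => //; apply: openU; last exact: open_interior.
  by rewrite openE => p; exact: C0_open.
- move=> p [[/= /closed_discE p1 Pw]|Op]; last by right.
  left; move: p1; rewrite le_eqVlt => /predU1P[p1|p1]; last by left.
  right; apply: circle_N => //.
  by rewrite /unit_circle /= [LHS](_ : _ = (normc p.1)%:C)// p1.
- move=> p [[C0p|Np]|Op].
  + apply: (near_eq_differentiable _ (u_diff p C0p)).
    by apply: filterS (C0_open p C0p) => q [_ q1]; rewrite /g q1.
  + have := nbhs_singleton Np; case=> _ _ Op1 _.
    apply: (near_eq_differentiable _ (f_holo p Op1)).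
    by apply: filterS Np => q Nq; rewrite /g; case: ifP => // q1; rewrite uf.
  + have [Op1 _] := Om2 p Op.
    apply: (near_eq_differentiable _ (f_holo p Op1)).
    have : nbhs p Omega2 by apply: open_nbhs_nbhs.
    by apply: filterS => q /Om2 [_ q1]; rewrite /g ltNge q1.
- by move=> p /Om2 [_ p1]; rewrite /g ltNge p1.
Qed.
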